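(* Let $0<c<\infty$ and let $(M,\phi)$ be a $c$ log-convergent nuclear $\sigma$-module which is ordinary at slope zero with $h_0=1$, and let $e=(e_1,e_2,\dots)$ be a $c$ log-convergent basis ordinary at slope zero for which $\phi(e_1)=ue_1+\sum_{i\ge2}b_ie_i$ with $u\in A_0$, $u\equiv1\pmod{\pi A_0}$, and all $b_i\in\pi A_0$. Then the family $(M_\infty,\phi_{\infty,k})$, parametrized by the $p$-adic integer $k\in\mathbf Z_p$, is a uniformly $c$ log-convergent family of nuclear $\sigma$-modules. Furthermore, for every $\varepsilon>0$ the family of $L$-functions $L(\phi_{\infty,k},T)$, $k\in\mathbf Z_p$ (with the $p$-adic metric), is a strong family in the open disc $|T|_\pi<p^{c-\varepsilon}$.
   Context: Let $p$ be a prime, $q$ a power of $p$, $K/\mathbf Q_p$ finite with residue field $\mathbf F_q$, uniformizer $\pi$, ring of integers $R$, $\mathrm{ord}_\pi\pi=1$, $|\pi|_\pi=1/p$. Fix $n\ge1$; $A_0=\{\sum_{u\in\mathbf Z^n}a_uX^u:a_u\in R,a_u\to0\text{ as }|u|\to\infty\}$ with Gauss norm, $\sigma(X^u)=X^{qu}$. A nuclear $\sigma$-module $(M,\phi)$: $M$ = all formal sums $\sum_{i\in I}a_ie_i$ ($a_i\in A_0$, $I\subseteq\mathbf Z_{>0}$ at most countable), norm $\max\|a_i\|$, $\phi(\sum a_ie_i)=\sum\sigma(a_i)\phi(e_i)$, $\|\phi(e_i)\|\to0$; matrix $B=\sum_uB_uX^u$ with $\phi(e_j)=\sum_ib_{ij}e_i$;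 $c$ log-convergent basis: $\liminf_{|u|\to\infty}\mathrm{ord}_\pi B_u/\log_q|u|\ge c$. Ordinary at slope zero basis: with $h_0$ minimal such that $\phi(e_j)\equiv0\pmod\pi$ for $j>h_0$, each $\det(I-B(x)\cdots B(x^{q^{d-1}})T)$ (closed point $\bar x$ of $\mathbf G_m^n/\mathbf F_q$, degree $d$, Teichmüller lift $x$) has exactly $h_0$ unit reciprocal zeros. $L$-function of a nuclear $\sigma$-module with matrix $B$: $\prod_{\bar x}\det(I-B(x)\cdots B(x^{q^{d-1}})T^d)^{-1}$. Limiting $\sigma$-module: write $\phi(e_1)=u(e_1+\pi e)$ with $e=\sum_{i\ge2}(b_i/(\pi u))e_i$. Let $M_\infty=A_0[[f_2,f_3,\dots]]$ be the set of formal sums $\sum_wa_wf^w$ ($a_w\in A_0$ arbitrary) over finitely supported $w=(w_2,w_3,\dots)\in\mathbf Z_{\ge0}^{I\setminus\{1\}}$, $f^w=\prod f_i^{w_i}$, a commutative $A_0$-algebra and Banach module with basis $(f^w)$. Let $\Upsilon:M\to M_\infty$, $\Upsilon(\sum a_ie_i)=a_1+\sum_{i\ge2}a_if_i$. For $k\in\mathbf Z_p$, $\phi_{\infty,k}$ is the $\sigma$-semilinear map on $M_\infty$ with $\phi_{\infty,k}(f_{i_1}\cdots f_{i_r})=u^{k-r}(1+\pi\Upsilon(e))^{k-r}\Upsilon(\phi(e_{i_1}))\cdots\Upsilon(\phi(e_{i_r}))$ (powers with $p$-adic exponents via binomial series); $(M_\infty,\phi_{\infty,k})$ is a nuclear $\sigma$-module.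 Uniformly $c$ log-convergent family of matrices $B(k,X)=\sum_uB_u(k)X^u$, $B_u(k)=(b_{w_1,w_2}(u,k))$: (i) $\liminf_{|u|}\inf_k\mathrm{ord}_\pi B_u(k)/\log_q|u|\ge c$, (ii) for every $C>0$ there is $N_C$ with $\mathrm{ord}_\pi b_{w_1,w_2}(u,k)\ge C$ for all $w_2>N_C$ and all $u,k,w_1$. Strong family in $|T|_\pi<p^{c'}$: a quotient of two families $\sum_mf_m(k)T^m$ ($f_0=1$, $f_m(k)\in R$) each with all $f_m$ uniformly continuous in $k$ and $\liminf_m\inf_k\mathrm{ord}_\pi f_m(k)/m\ge c'$. *)

(* Defs.v *)
From HB Require Import structures.
From mathcomp Require Import all_boot all_order all_algebra all_fingroup.
From mathcomp Require Import finmap multiset.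
From mathcomp Require Import all_classical all_reals all_analysis.

Set Implicit Arguments.
Unset Strict Implicit.
Unset Printing Implicit Defensive.

Import Order.TTheory GRing.Theory Num.Theory.

Local Open Scope classical_set_scope.
Local Open Scope ring_scope.

(* All arithmetic takes place in one complete, algebraically closed valued
   field Om containing K (for instance C_p).  Valuations are additive, with
   values in the extended reals and ord 0 = +oo; |x| = p ^ (- ord x). *)

Section ValuedField.
Variables (R : realType) (Om : closedFieldType) (ord : Om -> \bar R).

Definition is_valuation : Prop :=
  [/\ forall x, ord x = +oo%E <-> x = 0,
      forall x, ord x <> -oo%E,
      forall x y, ord (x * y) = (ord x + ord y)%E
    & forall x y, (Order.min (ord x) (ord y) <= ord (x + y))%E].

Definition is_complete : Prop :=
  forall s : nat -> Om,
    (forall C : R, exists N, forall i j, (N <= i)%N -> (N <= j)%N ->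
      (C%:E <= ord (s i - s j))%E) ->
    exists l, forall C : R, exists N, forall i, (N <= i)%N ->
      (C%:E <= ord (s i - l))%E.

(* [red] is reduction modulo the maximal ideal of the valuation ring; its
   values outside the valuation ring are irrelevant. *)
Definition is_residue_map (kbar : fieldType) (red : Om -> kbar) : Prop :=
  [/\ red 1 = 1,
      forall x y, (0 <= ord x)%E -> (0 <= ord y)%E ->
        red (x + y) = red x + red y,
      forall x y, (0 <= ord x)%E -> (0 <= ord y)%E ->
        red (x * y) = red x * red y,
      forall x, (0 <= ord x)%E -> (red x = 0 <-> (0 < ord x)%E)
    & forall y, exists2 x, (0 <= ord x)%E & red x = y].

(* Q_p and Z_p are the closures of Q and Z in Om. *)
Definition Qp : set Om :=
  [set x | forall C : R, exists r : rat, (C%:E <= ord (x - ratr r))%E].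

Definition Zp : set Om :=
  [set x | forall C : R, exists z : int, (C%:E <= ord (x - z%:~R))%E].

Definition finite_over_Qp (K : {pred Om}) : Prop :=
  [/\ divring_closed K,
      forall x, Qp x -> x \in K
    & exists (m : nat) (b : 'I_m -> Om), (forall i, b i \in K) /\
        forall x, x \in K -> exists2 a : 'I_m -> Om,
          forall i, Qp (a i) & x = \sum_(i < m) a i * b i].

End ValuedField.

Record padic_setting (R : realType) := PadicSetting {
  Om : closedFieldType;
  ord : Om -> \bar R;
  kbar : fieldType;
  red : Om -> kbar;
  Kfield : {pred Om};
  varpi : Om;
  prime_p : nat;
  card_q : nat;
  ord_valuation : is_valuation ord;
  ord_complete : is_complete ord;
  red_residue : is_residue_map ord red;
  Om_char0 : [pchar Om] =i pred0;
  prime_pP : prime prime_p;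
  ord_p_gt0 : (0 < ord prime_p%:R)%E;
  card_qP : exists2 a, (0 < a)%N & card_q = (prime_p ^ a)%N;
  Kfield_finite : finite_over_Qp ord Kfield;
  (* varpi generates the maximal ideal of the ring of integers of K, and ord is
     normalized by it *)
  varpi_Kfield : varpi \in Kfield;
  ord_varpi : ord varpi = 1%E;
  varpi_unif : forall x, x \in Kfield -> (0 < ord x)%E -> (1 <= ord x)%E;
  (* the residue field of K has card_q elements *)
  residue_field_card : exists s : seq kbar, [/\ uniq s, size s = card_q &
        forall y, y \in s <-> exists2 x, x \in Kfield /\ (0 <= ord x)%E & red x = y]
}.

Arguments Kfield {R} p.
Arguments varpi {R} p.
Arguments prime_p {R} p.
Arguments card_q {R} p.

Section PowerSeries.
Variable F : closedFieldType.
Implicit Types f g : nat -> F.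

Definition ps_one : nat -> F := fun m => (m == 0%N)%:R.
Definition ps_mul f g : nat -> F :=
  fun m => \sum_(i < m.+1) f i * g (m - i)%N.
Definition ps_inv f : nat -> F := xget (fun=> 0) [set g | ps_mul f g = ps_one].
(* f(T ^ d), for 0 < d *)
Definition ps_subst_exp (d : nat) f : nat -> F :=
  fun m => if (d %| m)%N then f (m %/ d)%N else 0.
(* 1 - a T *)
Definition ps_lin (a : F) : nat -> F :=
  fun m => if m is 0 then 1 else if m is 1 then - a else 0.
Definition binom (k : F) (m : nat) : F :=
  (\prod_(i < m) (k - i%:R)) / (m`!)%:R.

End PowerSeries.

Section LimitInferior.
Variables (R : realType) (U : Type).

(* liminf of g(u) as size(u) goes to infinity *)
Definition liminf_size (size : U -> nat) (g : U -> \bar R) : \bar R :=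
  ereal_sup (range (fun N : nat =>
    ereal_inf (g @` [set u | (N <= size u)%N]))).

End LimitInferior.

Section Setting.
Variables (R : realType) (S : padic_setting R).
Notation Om := (Om S).
Notation ord := (@ord R S).
Notation pi := (varpi S).
Notation q := (card_q S).
Notation Zp := (Zp ord).

Definition intring : set Om := [set x | x \in Kfield S /\ (0 <= ord x)%E].

Section Sums.
Variable T : choiceType.

(* unconditional summation, over the net of finite subsets of T *)
Definition has_sum (f : T -> Om) (s : Om) : Prop :=
  forall C : R, exists A0 : {fset T}, forall A : {fset T},
    (A0 `<=` A)%fset -> (C%:E <= ord (s - \sum_(i <- A) f i))%E.

Definition osum (f : T -> Om) : Om := xget 0 [set s | has_sum f s].

End Sums.

Section InfiniteMatrices.
Variable J : choiceType.
Implicit Types A B : J -> J -> Om.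

Definition imx_one : J -> J -> Om := fun i j => (i == j)%:R.
Definition imx_mul A B : J -> J -> Om :=
  fun i j => osum (fun l => A i l * B l j).

Definition principal_minor A (X : {fset J}) : Om :=
  \det (\matrix_(a < #|{: X}|, b < #|{: X}|)
          A (val (enum_val a)) (val (enum_val b))).

(* det(I - A T), with coefficient of T ^ m equal to (-1) ^ m times the sum of
   the principal minors of order m *)
Definition fredholm A : nat -> Om :=
  fun m => (-1) ^+ m *
    osum (fun X : {fset J} => if #|` X| == m then principal_minor A X else 0).

End InfiniteMatrices.

(* D has exactly h unit reciprocal zeros, counted with multiplicity: the
   cofactor G converges on the closed unit disc and does not vanish on the
   unit circle. *)
Definition unit_reciprocal_zeros (h : nat) (D : nat -> Om) : Prop :=
  exists (alpha : 'I_h -> Om) (G : nat -> Om),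
    [/\ forall i, ord (alpha i) = 0%E,
        D = ps_mul (\big[@ps_mul Om/@ps_one Om]_(i < h) ps_lin (alpha i)) G,
        forall C : R, exists N, forall m, (N <= m)%N -> (C%:E <= ord (G m))%E
      & forall t, ord t = 0%E -> osum (fun m : nat => G m * t ^+ m) <> 0].

Section Laurent.
Variable n : nat.

Definition usize (u : 'rV[int]_n) : nat := (\sum_(i < n) `|u 0%R i|)%N.
Definition logq (m : nat) : R := ln m%:R / ln q%:R.

(* sum_u (a u) X ^ u *)
Definition lser := 'rV[int]_n -> Om.
Implicit Types a b : lser.

Definition A0 : set lser :=
  [set a | (forall u, intring (a u)) /\
    forall C : R, exists N, forall u, (N <= usize u)%N -> (C%:E <= ord (a u))%E].

Definition ls_zero : lser := fun=> 0.
Definition ls_one : lser := fun u => (u == 0)%:R.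
Definition ls_sub a b : lser := fun u => a u - b u.
Definition ls_scale (z : Om) a : lser := fun u => z * a u.
Definition ls_mul a b : lser := fun u => osum (fun v => a v * b (u - v)).
(* the quotient a / b in A_0 *)
Definition ls_div a b : lser := xget ls_zero [set y | A0 y /\ ls_mul b y = a].
(* a ^ k for a congruent to 1 modulo pi, by the binomial series in a - 1 *)
Definition ls_pow a (k : Om) : lser :=
  fun u => osum (fun m : nat =>
    binom k m * iter m (ls_mul (ls_sub a ls_one)) ls_one u).
Definition ls_sigma a : lser :=
  fun u => if [forall i, (q %| u 0%R i)%Z] then a (\row_i (u 0%R i %/ q)%Z)
           else 0.
Definition ls_eval a (x : 'rV[Om]_n) : Om :=
  osum (fun u => a u * \prod_(i < n) x 0 i ^ u 0 i).

Definition piA0 : set lser := [set a | exists2 b, A0 b & a = ls_scale pi b].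

Definition frob (F : fieldType) (i : nat) (x : 'rV[F]_n) : 'rV[F]_n :=
  map_mx (fun t => t ^+ (q ^ i)) x.

(* closed points of degree d of G_m^n over F_q, as Frobenius orbits of
   geometric points *)
Definition closed_point (d : nat) : set (set 'rV[kbar S]_n) :=
  [set P | exists y : 'rV[kbar S]_n,
    [/\ forall i, y 0 i != 0, (0 < d)%N, frob d y = y,
        forall e, (0 < e < d)%N -> frob e y <> y
      & P = range (fun i : nat => frob i y)]].

(* x is the Teichmueller lift of a geometric point of P *)
Definition is_teichmuller (d : nat) (P : set 'rV[kbar S]_n) (x : 'rV[Om]_n) :=
  (forall i, x 0 i ^+ (q ^ d).-1 = 1) /\ P (map_mx (@red R S) x).

Section SigmaModules.
Variable J : choiceType.

(* sum_j (a j) e_j *)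
Definition vec := J -> lser.
Definition basis_vec (j : J) : vec := fun i => if i == j then ls_one else ls_zero.

(* the sigma-semilinear map a |-> sum_j sigma(a_j) col_j, where the sum is
   computed coefficientwise *)
Definition semilinear_ext (col : J -> vec) : vec -> vec :=
  fun (a : vec) i u => osum (fun j => ls_mul (ls_sigma (a j)) (col j i) u).

Implicit Type phi : vec -> vec.

Definition matrix_of phi (i j : J) : lser := phi (basis_vec j) i.

(* The last clause is ||phi(e_j)|| -> 0 along the index set. *)
Definition nuclear phi : Prop :=
  [/\ forall a : vec, (forall j, A0 (a j)) -> forall i, A0 (phi a i),
      forall a : vec, (forall j, A0 (a j)) ->
        phi a = semilinear_ext (fun j => phi (basis_vec j)) a
    & forall C : R, exists X : {fset J}, forall j, j \notin X ->
        forall i u, (C%:E <= ord (matrix_of phi i j u))%E].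

(* ord_pi B_u *)
Definition ord_coef phi (u : 'rV[int]_n) : \bar R :=
  ereal_inf (range (fun ij : J * J => ord (matrix_of phi ij.1 ij.2 u))).

Definition log_convergent (c : R) phi : Prop :=
  (c%:E <= liminf_size usize
     (fun u => ord_coef phi u * ((logq (usize u))^-1)%:E))%E.

Definition uniformly_log_convergent (c : R) (phi : Om -> vec -> vec) : Prop :=
  [/\ forall k, Zp k -> nuclear (phi k),
      (c%:E <= liminf_size usize
         (fun u => ereal_inf [set ord_coef (phi k) u | k in Zp]
                   * ((logq (usize u))^-1)%:E))%E
    & forall C : R, 0 < C -> exists X : {fset J}, forall j, j \notin X ->
        forall u k i, Zp k -> (C%:E <= ord (matrix_of (phi k) i j u))%E].

(* B(x) B(x ^ q) ... B(x ^ (q ^ (d - 1))) *)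
Definition fiber_matrix phi (d : nat) (x : 'rV[Om]_n) : J -> J -> Om :=
  \big[@imx_mul J/@imx_one J]_(0 <= l < d)
    (fun i j => ls_eval (matrix_of phi i j) (frob l x)).

(* 1 / det(I - B(x) ... B(x ^ (q ^ (d - 1))) T ^ d), which depends only on P *)
Definition euler_factor phi (d : nat) (P : set 'rV[kbar S]_n) : nat -> Om :=
  ps_inv (ps_subst_exp d
    (fredholm (fiber_matrix phi d (xget 0 [set x | is_teichmuller d P x])))).

(* Closed points of degree greater than m do not contribute to the
   coefficient of T ^ m. *)
Definition L_function phi : nat -> Om :=
  fun m => (\big[@ps_mul Om/@ps_one Om]_(1 <= d < m.+1)
              \big[@ps_mul Om/@ps_one Om]_(P <- fset_set (closed_point d))
                euler_factor phi d P) m.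

End SigmaModules.

Section PositiveIndices.
Variable I : {pred nat}.

Definition idx := {i : nat | i \in I}.

Implicit Type phi : vec idx -> vec idx.

Definition zero_mod_pi_above phi (h : nat) : Prop :=
  forall j : idx, (h < val j)%N -> forall i, piA0 (matrix_of phi i j).

Definition ordinary_slope_zero phi (h0 : nat) : Prop :=
  [/\ zero_mod_pi_above phi h0,
      forall h, zero_mod_pi_above phi h -> (h0 <= h)%N
    & forall d P x, closed_point d P -> is_teichmuller d P x ->
        unit_reciprocal_zeros h0 (fredholm (fiber_matrix phi d x))].

Definition idx_tail := {i : idx | val i != 1%N}.
(* exponents w of the monomials f ^ w: finitely supported functions from
   I \ {1} to nat *)
Definition mono : choiceType := multiset idx_tail.

(* sum_w (g w) f ^ w *)
Definition Minf := vec mono.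
Implicit Types g h : Minf.

Definition mi_one : Minf := basis_vec (mset0 : mono).
Definition mi_mul g h : Minf :=
  fun w u => \sum_(w' <- fset_set [set w' : mono | msubset w' w])
               ls_mul (g w') (h (msetB w w')) u.
Definition mi_scale (z : Om) g : Minf := fun w => ls_scale z (g w).
(* (1 + g) ^ k by the binomial series *)
Definition mi_pow1 g (k : Om) : Minf :=
  fun w u => osum (fun m : nat => binom k m * iter m (mi_mul g) mi_one w u).

Variable I1 : 1%N \in I.
Definition i1 : idx := Sub 1%N I1.

(* a_1 + sum_(i >= 2) a_i f_i *)
Definition Upsilon (a : vec idx) : Minf :=
  fun w => match enum_mset w with
           | [::] => a i1
           | [:: i] => a (val i)
           | _ => ls_zero
           end.

Variable phi : vec idx -> vec idx.

Definition unit_coord : lser := phi (basis_vec i1) i1.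

(* phi(e_1) = u (e_1 + pi e) *)
Definition error_vec : vec idx :=
  fun i => if i == i1 then ls_zero
           else ls_div (phi (basis_vec i1) i) (ls_scale pi unit_coord).

Definition phi_inf_col (k : Om) (w : mono) : Minf :=
  let kr := k - (size (enum_mset w))%:R in
  fun w' => ls_mul (ls_pow unit_coord kr)
    (mi_mul (mi_pow1 (mi_scale pi (Upsilon error_vec)) kr)
       (\big[mi_mul/mi_one]_(i <- enum_mset w)
          Upsilon (phi (basis_vec (val i)))) w').

Definition phi_inf (k : Om) : Minf -> Minf := semilinear_ext (phi_inf_col k).

End PositiveIndices.
End Laurent.

(* uniform continuity on Z_p for the p-adic metric *)
Definition unif_continuous (f : Om -> Om) : Prop :=
  forall C : R, exists N : nat, forall k k', Zp k -> Zp k' ->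
    (exists2 z, Zp z & k - k' = (prime_p S)%:R ^+ N * z) ->
    (C%:E <= ord (f k - f k'))%E.

Definition entire_family (c : R) (f : Om -> nat -> Om) : Prop :=
  [/\ forall k, Zp k -> f k 0%N = 1,
      forall k m, Zp k -> intring (f k m),
      forall m, unif_continuous (f ^~ m)
    & (c%:E <= liminf_size id
         (fun m : nat => ereal_inf [set ord (f k m) | k in Zp]
                         * (m%:R^-1)%:E))%E].

(* strong family in the disc |T| < p ^ c *)
Definition strong_family (c : R) (L : Om -> nat -> Om) : Prop :=
  exists f g, [/\ entire_family c f, entire_family c g &
    forall k, Zp k -> ps_mul (L k) (g k) = f k].

End Setting.

(* Main.v *)
(* The proof is Dwork's.  Write B(k) for the matrix of phi_(infty,k) and let
   Psi be the matrix with entries B(k)_(q v - u), indexed by pairs of a Laurent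
   exponent and a basis element.  Since the sum of x ^ a over the (q ^ d - 1)-th
   roots of unity x is nonzero only when q ^ d - 1 divides a, one has
   (q ^ d - 1) ^ n Tr (Psi ^ d) = sum over x of Tr (B(x) ... B(x ^ (q ^ (d - 1)))),
   so that L(T) is the product of the det (I - q ^ i T Psi) to the powers
   (-1) ^ (n - i + 1) 'C(n, i).  The identity is proved exactly for finite
   truncations of B, by comparing logarithmic derivatives, and then passes to
   the limit because all the operations involved preserve congruences of
   integral power series.

   Conjugating Psi by the weights c' log_q |u| gives valuation at least
   c'' < c' to all the columns outside a finite set, hence the growth of the
   Fredholm determinant.

   The estimates on B(k) rest on a subadditive weight
   Lam u = c1 log_q (1 + |u| / M): for M large, every entry of phi that is
   divisible by the uniformizer has coefficients of valuation at least
   max (1, Lam u), and the series with this property are stable under all the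
   operations, products of any length included, used to build phi_(infty,k). *)

From HB Require Import structures.
Require Import Defs.
From mathcomp Require Import all_boot all_order all_algebra all_fingroup all_solvable.
From mathcomp Require Import separable cyclotomic.
From mathcomp Require Import finmap multiset.
From mathcomp Require Import all_classical all_reals all_analysis.
From mathcomp Require Import ring lra zify.

Set Implicit Arguments.
Unset Strict Implicit.
Unset Printing Implicit Defensive.

Import Order.TTheory GRing.Theory Num.Theory.

Local Open Scope classical_set_scope.
Local Open Scope ring_scope.

(** Logarithmic convergence alone cannot control the entries of phi_(infty,k): they are products of
    unboundedly many series, and an estimate c' log_q |u| - D would lose D with every factor.
    Divisibility by the uniformizer replaces the constant. Ordinarity and the hypotheses on phi(e_1)
    put u - 1, the b_i and every phi(e_j) with j > 1 in pi A_0, so the weight only has to stay below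
    1 where the decay has not yet set in, and it can be exactly subadditive with value 0 at 0.
    Moreover a monomial with r factors has a column of valuation at least r, hence nuclearity, and
    the m-th term of a binomial series is divisible by pi^m, hence continuity in k although the
    binomial coefficients are not equicontinuous in m.

    Psi raises another obstacle: its columns need not tend to zero, since B_0 recurs in column v at
    row q v. Its principal minors do tend to zero, and this suffices for Fredholm determinants and
    their finite approximations. Their growth comes from log_q q = 1: the factor q in q v - u gains
    nearly c per column. *)

Section Valuation.
Variables (R : realType) (S : padic_setting R).
Notation Om := (Om S).
Notation ord := (@ord R S).
Notation K := (Kfield S).
Notation vge C x := ((C%:E <= ord x%R)%E).
Implicit Types (x y z : Om) (C D : R).

(** * Valuation inequalities and congruences *)

Lemma ord_zero : ord 0 = +oo%E.
Proof. by have [h _ _ _] := ord_valuation S; apply/h. Qed.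

Lemma ordM x y : ord (x * y) = (ord x + ord y)%E.
Proof. by have [_ _ h _] := ord_valuation S. Qed.

Lemma ord_fin x : x != 0 -> exists r, ord x = r%:E.
Proof.
have [h1 h2 _ _] := ord_valuation S => x0.
case E : (ord x) => [r| |]; first by exists r.
- by case/eqP: x0; apply/h1.
- by case: (h2 x).
Qed.

Lemma ord1 : ord 1 = 0%E.
Proof.
have [r Er] := ord_fin (oner_neq0 Om).
have := ordM 1 1; rewrite mulr1 Er -EFinD => -[] /eqP.
by rewrite -[X in X == _]addr0 (inj_eq (addrI _)) => /eqP <-.
Qed.

Lemma vge0 C : vge C 0.
Proof. by rewrite ord_zero leey. Qed.

Lemma vgeD C x y : vge C x -> vge C y -> vge C (x + y).
Proof.
have [_ _ _ h] := ord_valuation S => hx hy.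
by apply: le_trans (h x y); rewrite le_min hx.
Qed.

Lemma vgeM C D x y : vge C x -> vge D y -> vge (C + D) (x * y).
Proof. by move=> hx hy; rewrite ordM EFinD leeD. Qed.

Lemma ordN1 : ord (-1) = 0%E.
Proof.
have N10 : -1 != 0 :> Om by rewrite oppr_eq0 oner_neq0.
have [r Er] := ord_fin N10; have := ordM (-1) (-1).
rewrite mulrNN mulr1 ord1 Er -EFinD => -[] /esym/eqP.
by rewrite -mulr2n mulrn_eq0 /= => /eqP ->.
Qed.

Lemma ordN x : ord (- x) = ord x.
Proof. by rewrite -mulN1r ordM ordN1 add0e. Qed.

Lemma vgeN C x : vge C x -> vge C (- x).
Proof. by rewrite ordN. Qed.

Lemma vgeB C x y : vge C x -> vge C y -> vge C (x - y).
Proof. by move=> hx hy; apply: vgeD => //; apply: vgeN. Qed.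

Lemma vgeBC C x y : vge C (x - y) -> vge C (y - x).
Proof. by rewrite -opprB ordN. Qed.

Lemma vge_trans C x y z : vge C (x - y) -> vge C (y - z) -> vge C (x - z).
Proof. by move=> h1 h2; rewrite -(subrKA y); apply: vgeD. Qed.

Lemma vge_le C D x : C <= D -> vge D x -> vge C x.
Proof. by move=> CD; apply: le_trans; rewrite lee_fin. Qed.

Lemma vgeMl C x y : vge 0 x -> vge C y -> vge C (x * y).
Proof. by move=> hx hy; rewrite -[C]add0r; apply: vgeM. Qed.

Lemma vgeMr C x y : vge C x -> vge 0 y -> vge C (x * y).
Proof. by move=> hx hy; rewrite -[C]addr0; apply: vgeM. Qed.

Lemma vge_sum (I : Type) (r : seq I) (P : pred I) (F : I -> Om) C :
  (forall i, P i -> vge C (F i)) -> vge C (\sum_(i <- r | P i) F i).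
Proof.
by move=> h; elim/big_ind: _ => //; [exact: vge0 | move=> *; exact: vgeD].
Qed.

Lemma vge_sum_seq (I : eqType) (r : seq I) (F : I -> Om) C :
  (forall i, i \in r -> vge C (F i)) -> vge C (\sum_(i <- r) F i).
Proof. by move=> h; rewrite big_seq; apply: vge_sum. Qed.

Lemma vge1 : vge 0 1.
Proof. by rewrite ord1. Qed.

Lemma vge_nat (m : nat) : vge 0 (m%:R : Om).
Proof. by elim: m => [|m IH]; [exact: vge0 | rewrite -natr1; apply: vgeD IH vge1]. Qed.

Lemma vge_prod (I : Type) (r : seq I) (P : pred I) (F : I -> Om) (f : I -> R) :
  (forall i, P i -> vge (f i) (F i)) ->
  vge (\sum_(i <- r | P i) f i) (\prod_(i <- r | P i) F i).
Proof.
move=> h; elim/big_rec2: _ => [|i C x Pi hx]; first exact: vge1.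
by apply: vgeM => //; exact: h.
Qed.

Lemma vge_prod0 (I : Type) (r : seq I) (P : pred I) (F : I -> Om) :
  (forall i, P i -> vge 0 (F i)) -> vge 0 (\prod_(i <- r | P i) F i).
Proof. by move=> /vge_prod-/(_ r); rewrite big1. Qed.

Lemma vgeX C x m : vge C x -> vge (C *+ m) (x ^+ m).
Proof.
move=> hx; elim: m => [|m IH]; first by rewrite mulr0n expr0; exact: vge1.
by rewrite mulrS exprS; apply: vgeM.
Qed.

Lemma vgeX0 x m : vge 0 x -> vge 0 (x ^+ m).
Proof. by move=> /vgeX-/(_ m); rewrite mul0rn. Qed.

Lemma vge_sign m : vge 0 ((-1) ^+ m : Om).
Proof. by apply/vgeX0/vgeN/vge1. Qed.

Lemma vge_all0 x : (forall C, vge C x) -> x = 0.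
Proof.
move=> h; apply/eqP/negPn/negP => /ord_fin[r Er].
by have := h (r + 1); rewrite Er lee_fin gerDl ler10.
Qed.

Lemma cgM C x x' y y' : vge 0 x -> vge 0 y' ->
  vge C (x - x') -> vge C (y - y') -> vge C (x * y - x' * y').
Proof.
move=> hx hy' hxx hyy.
have -> : x * y - x' * y' = x * (y - y') + (x - x') * y'.
  by rewrite mulrBr mulrBl addrA subrK.
by apply: vgeD; [apply: vgeMl | apply: vgeMr].
Qed.

Lemma cg_sum (I : Type) (r : seq I) (P : pred I) (F G : I -> Om) C :
  (forall i, P i -> vge C (F i - G i)) ->
  vge C (\sum_(i <- r | P i) F i - \sum_(i <- r | P i) G i).
Proof. by move=> h; rewrite -sumrB; apply: vge_sum. Qed.

Lemma cg_prod (I : Type) (r : seq I) (P : pred I) (F G : I -> Om) C :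
  (forall i, P i -> vge 0 (F i)) -> (forall i, P i -> vge 0 (G i)) ->
  (forall i, P i -> vge C (F i - G i)) ->
  vge C (\prod_(i <- r | P i) F i - \prod_(i <- r | P i) G i).
Proof.
move=> hF hG h; elim: r => [|i r IH]; first by rewrite !big_nil subrr vge0.
rewrite !big_cons; case: ifP => // Pi.
by apply: cgM => //; [exact: hF | apply: vge_prod0 | exact: h].
Qed.

Lemma vge_det m (A : 'M[Om]_m) : (forall i j, vge 0 (A i j)) -> vge 0 (\det A).
Proof.
by move=> h; apply: vge_sum => s _; apply: vgeMl; [exact: vge_sign | apply: vge_prod0].
Qed.

Lemma cg_det m (A B : 'M[Om]_m) C : (forall i j, vge 0 (A i j)) ->
  (forall i j, vge 0 (B i j)) -> (forall i j, vge C (A i j - B i j)) ->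
  vge C (\det A - \det B).
Proof.
move=> hA hB h; apply: cg_sum => s _; rewrite -mulrBr.
by apply: vgeMl; [exact: vge_sign | apply: cg_prod].
Qed.

Lemma real_archi C : exists N : nat, C <= N%:R.
Proof.
by exists (Num.bound `|C|); rewrite ltW // (le_lt_trans (ler_norm _)) // archi_boundP.
Qed.

(** * Unconditional sums *)

Section OSum.
Variable T : choiceType.
Implicit Types (f g : T -> Om) (A : {fset T}).

Definition null f := forall C, exists A, forall i, i \notin A -> vge C (f i).

Lemma has_sum_uniq f s t : has_sum f s -> has_sum f t -> s = t.
Proof.
move=> hs ht; apply/eqP; rewrite -subr_eq0; apply/eqP/vge_all0 => C.
have [A hA] := hs C; have [B hB] := ht C.
have {}hA := hA (A `|` B)%fset (fsubsetUl _ _).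
have {}hB := hB (A `|` B)%fset (fsubsetUr _ _).
exact: vge_trans hA (vgeBC hB).
Qed.

Lemma has_sum_osum f s : has_sum f s -> osum f = s.
Proof.
move=> h; rewrite /osum; case: xgetP => [y _ hy | h0].
  exact: has_sum_uniq hy h.
by case: (h0 s).
Qed.

Lemma sum_fset_sub f A B C : (A `<=` B)%fset ->
  (forall i, i \notin A -> vge C (f i)) ->
  vge C (\sum_(i <- B) f i - \sum_(i <- A) f i).
Proof.
move=> AB h; rewrite (big_fsetID _ (mem A) B) /=.
have -> : [fset x in B | x \in A]%fset = A.
  by apply/fsetP => x; rewrite !inE /= andbC; case: (boolP (x \in A)) => //= /(fsubsetP AB).
rewrite addrAC subrr add0r; apply: vge_sum_seq => i.
by rewrite !inE /= => /andP[_ ?]; exact: h.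
Qed.

(** Terms tending to zero suffice in the ultrametric setting: the partial sums over the increasing
    finite sets [A N], outside which all terms have valuation at least [N], form a Cauchy
    sequence. *)
Lemma null_has_sum f : null f -> has_sum f (osum f).
Proof.
move=> nf; suff [s hs] : exists s, has_sum f s by rewrite (has_sum_osum hs).
have /choice[A0 hA0] : forall N : nat, exists A, forall i, i \notin A -> vge N%:R (f i).
  by move=> N; apply: nf.
pose A N := (\big[fsetU/fset0]_(i < N.+1) A0 i)%fset.
have AA0 i N : (i <= N)%N -> (A0 i `<=` A N)%fset.
  rewrite -ltnS => iN; apply/fsubsetP => x xA; apply/bigfcupP.
  by exists (Ordinal iN) => //; rewrite mem_index_enum.
have Ale i j : (i <= j)%N -> (A i `<=` A j)%fset.
  move=> ij; apply/bigfcupsP => l _ _.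
  by apply: AA0; rewrite (leq_trans _ ij) // -ltnS.
have hA N i : i \notin A N -> vge N%:R (f i).
  by move=> iA; apply: hA0; apply: contra iA; apply/fsubsetP/AA0.
have cau N i j : (N <= i)%N -> (N <= j)%N ->
    vge N%:R (\sum_(l <- A i) f l - \sum_(l <- A j) f l).
  move=> Ni Nj; apply: (@vge_trans _ _ (\sum_(l <- A N) f l)).
    by apply: sum_fset_sub (Ale _ _ Ni) _; exact: hA.
  by apply: vgeBC; apply: sum_fset_sub (Ale _ _ Nj) _; exact: hA.
have [|s hs] := @ord_complete R S (fun N => \sum_(l <- A N) f l).
  move=> C; have [N hN] := real_archi C; exists N => i j Ni Nj.
  exact: vge_le hN (cau _ _ _ Ni Nj).
exists s => C; have [N hN] := real_archi C; have [N' hN'] := hs C.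
exists (A (maxn N N')) => B AB.
have {}hN' := hN' (maxn N N') (leq_maxr _ _).
apply: vge_trans (vgeBC hN') (vgeBC _).
apply: sum_fset_sub AB _ => i iA; apply: vge_le hN (hA _ _ _).
by apply: contra iA; apply/fsubsetP/Ale/leq_maxl.
Qed.

(* [osum] is [0] on families that are not summable, so the next two lemmas need no summability. *)
Lemma osum_ind (P : set Om) f : P 0 ->
  (forall s, has_sum f s -> P s) -> P (osum f).
Proof. by move=> P0 h; rewrite /osum; case: xgetP => [y _ hy|_] //; exact: h. Qed.

Lemma vge_osum f C : (forall i, vge C (f i)) -> vge C (osum f).
Proof.
move=> h; apply: (@osum_ind [set s | vge C s]); first exact: vge0.
move=> s /(_ C)[A /(_ A (fsubset_refl _))] hs.
by rewrite -(subrK (\sum_(i <- A) f i) s); apply: vgeD => //; apply: vge_sum.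
Qed.

Lemma osum_approx f A C : null f -> (forall i, i \notin A -> vge C (f i)) ->
  vge C (osum f - \sum_(i <- A) f i).
Proof.
move=> /null_has_sum/(_ C)[B hB] hA.
have {}hB := hB (A `|` B)%fset (fsubsetUr _ _).
by apply: vge_trans hB _; apply: sum_fset_sub hA; exact: fsubsetUl.
Qed.

Lemma osum_fin f A : (forall i, i \notin A -> f i = 0) ->
  osum f = \sum_(i <- A) f i.
Proof.
move=> h; apply: has_sum_osum => C; exists A => B AB.
by apply: vgeBC; apply: sum_fset_sub AB _ => i /h ->; exact: vge0.
Qed.

Lemma osum1 f i0 : (forall i, i != i0 -> f i = 0) -> osum f = f i0.
Proof.
move=> h; rewrite (@osum_fin f [fset i0]%fset) ?big_seq_fset1 //.
by move=> i; rewrite !inE; exact: h.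
Qed.

Lemma osumB f g : null f -> null g -> osum f - osum g = osum (fun i => f i - g i).
Proof.
move=> /null_has_sum hf /null_has_sum hg; apply/esym/has_sum_osum => C.
have [A hA] := hf C; have [B hB] := hg C; exists (A `|` B)%fset => D.
rewrite fsubUset => /andP[/hA h1 /hB h2]; rewrite sumrB.
set a := \sum_(i <- D) f i; set b := \sum_(i <- D) g i.
have -> : osum f - osum g - (a - b) = (osum f - a) - (osum g - b) by ring.
exact: vgeB.
Qed.

Lemma cg_osum f g C : null f -> null g -> (forall i, vge C (f i - g i)) ->
  vge C (osum f - osum g).
Proof. by move=> nf ng h; rewrite osumB //; apply: vge_osum. Qed.

End OSum.

(** * The field K is closed *)

Definition vclosed (V : set Om) :=
  forall x, (forall C, exists2 y, V y & vge C (x - y)) -> V x.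

Lemma Qp_closed : vclosed (Qp ord).
Proof.
move=> x h C; have [y Qy hxy] := h C; have [r hr] := Qy C.
by exists r; apply: vge_trans hxy hr.
Qed.

Lemma intr_eq0_Om (b : int) : (b%:~R == 0 :> Om) = (b == 0).
Proof.
have h (m : nat) : (m.+1%:R == 0 :> Om) = false by rewrite ((pcharf0P Om).1 (@Om_char0 R S)).
case: b => [[|m]|m]; first by rewrite eqxx.
  by rewrite -pmulrn h.
by rewrite NegzE mulrNz oppr_eq0 -pmulrn h.
Qed.

(** [ratr] is computed from the reduced fraction; in characteristic zero any other fraction gives
    the same value, and the ring laws of [ratr] follow by common denominators. *)
Lemma ratr_frac (a b : int) : b != 0 ->
  ratr (a%:~R / b%:~R : rat) = a%:~R / b%:~R :> Om.
Proof.
move=> b0; set r : rat := _ / _; rewrite /ratr.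
have d0 := denq_neq0 r.
apply/eqP; rewrite eqr_div ?intr_eq0_Om // -!intrM; apply/eqP; congr (_%:~R).
apply/(@intr_inj rat); rewrite !intrM /=.
have := divq_num_den r; rewrite {3}/r => /eqP.
by rewrite eqr_div ?intr_eq0 // => /eqP.
Qed.

Lemma ratr0_Om : ratr 0 = 0 :> Om.
Proof. by rewrite -(mul0r 1^-1) (ratr_frac 0 (oner_neq0 _)) mul0r. Qed.

Lemma ratr_int_Om (a : int) : ratr a%:~R = a%:~R :> Om.
Proof. by rewrite -[a%:~R in LHS]divr1 (ratr_frac a (oner_neq0 _)) divr1. Qed.

Lemma ratrB_Om (r s : rat) : ratr (r - s) = ratr r - ratr s :> Om.
Proof.
rewrite -[in LHS](divq_num_den r) -[in LHS](divq_num_den s) {2 3}/ratr.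
have [rd sd] := (denq_neq0 r, denq_neq0 s).
have e (F : fieldType) (a b c d : F) : b != 0 -> d != 0 ->
    a / b - c / d = (a * d - c * b) / (b * d) by move=> *; field; apply/andP.
rewrite e ?intr_eq0 // [RHS]e ?intr_eq0_Om // -!intrM -!intrB ratr_frac //.
by rewrite mulf_neq0.
Qed.

Lemma ratrM_Om (r s : rat) : ratr (r * s) = ratr r * ratr s :> Om.
Proof.
rewrite -[in LHS](divq_num_den r) -[in LHS](divq_num_den s) {2 3}/ratr.
have [rd sd] := (denq_neq0 r, denq_neq0 s).
rewrite !mulf_div -!intrM ratr_frac //.
by rewrite mulf_neq0.
Qed.

Lemma ratrV_Om (r : rat) : ratr r^-1 = (ratr r)^-1 :> Om.
Proof.
have [->|r0] := eqVneq r 0.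
  by rewrite invr0 ratr0_Om invr0.
rewrite -[in LHS](divq_num_den r) {2}/ratr !invf_div ratr_frac //.
by rewrite numq_eq0.
Qed.

Lemma QpB x y : Qp ord x -> Qp ord y -> Qp ord (x - y).
Proof.
move=> hx hy C; have [r hr] := hx C; have [s hs] := hy C; exists (r - s).
have -> : x - y - ratr (r - s) = (x - ratr r) - (y - ratr s).
  by rewrite ratrB_Om; ring.
by apply: vgeB.
Qed.

Lemma QpN x : Qp ord x -> Qp ord (- x).
Proof.
rewrite -[- x]sub0r; apply: QpB => C; exists 0.
by rewrite ratr0_Om subr0 vge0.
Qed.

Lemma QpM x y : Qp ord x -> Qp ord y -> Qp ord (x * y).
Proof.
move=> hx hy C.
have [M hM] : exists M, vge M x.
  by have [->|/ord_fin[r ->]] := eqVneq x 0; [exists 0; exact: vge0 | exists r].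
have [s hs] := hy (C - M).
have [M' hM'] : exists M, vge M (ratr s : Om).
  have [->|/ord_fin[r ->]] := eqVneq (ratr s : Om) 0.
    by exists 0; exact: vge0.
  by exists r.
have [r hr] := hx (C - M'); exists (r * s).
have -> : x * y - ratr (r * s) = x * (y - ratr s) + (x - ratr r) * ratr s.
  by rewrite ratrM_Om; ring.
apply: vgeD; first by rewrite -[C](subrK M) addrC; apply: vgeM.
by rewrite -[C](subrK M'); apply: vgeM.
Qed.

(** A [y] closer to [x] than [C = ord x] has valuation at most [C], and x^-1 - y^-1 = (y - x) / (x
    y). *)
Lemma vge_inv C x y : x != 0 -> ord x = C%:E -> y != 0 ->
  forall D, vge D (x - y) -> C < D -> vge (D - C *+ 2) (x^-1 - y^-1).
Proof.
move=> x0 ox y0 D h CD.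
have oy : (ord y <= C%:E)%E.
  rewrite leNgt; apply/negP => Cy.
  have [r Er] := ord_fin y0; rewrite Er lte_fin in Cy.
  pose m := Num.min D r; have : vge m x.
    rewrite -[x](subrK y); apply: vgeD.
      by apply: vge_le h; rewrite ge_min lexx.
    by rewrite Er lee_fin ge_min lexx orbT.
  by rewrite ox lee_fin leNgt /m lt_min CD Cy.
have [r Er] := ord_fin y0; rewrite Er lee_fin in oy.
have : vge D ((x^-1 - y^-1) * (x * y)).
  by have -> : (x^-1 - y^-1) * (x * y) = y - x;
    [field; apply/andP | exact: vgeBC].
have [->|n0] := eqVneq (x^-1 - y^-1) 0; first by rewrite vge0.
rewrite !ordM ox Er; have [t ->] := ord_fin n0.
by rewrite !lee_fin => ?; lra.
Qed.

Lemma QpV x : Qp ord x -> Qp ord x^-1.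
Proof.
have [->|x0] := eqVneq x 0; first by rewrite invr0.
have [D oD] := ord_fin x0 => hx C.
(* Precision above [D] keeps the rational approximation nonzero; inversion then costs twice [D]. *)
pose E := Num.max (D + 1) (C + D *+ 2).
have [r hr] := hx E; exists r^-1; rewrite ratrV_Om.
have DE : D < E by rewrite /E lt_max ltrDl ltr01.
have r0 : ratr r != 0 :> Om.
  apply/eqP => r0; move: hr; rewrite r0 subr0 oD lee_fin leNgt.
  by rewrite DE.
apply: vge_le (vge_inv x0 oD r0 hr DE).
by rewrite lerBrDr /E le_max lexx orbT.
Qed.

Definition Qspan m (b : 'I_m -> Om) : set Om :=
  [set x | exists2 a : 'I_m -> Om, forall i, Qp ord (a i) & x = \sum_i a i * b i].

Lemma QspanZ m (b : 'I_m -> Om) a x : Qp ord a -> Qspan b x -> Qspan b (a * x).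
Proof.
move=> Qa [f hf ->]; exists (fun i => a * f i) => [i|]; first exact: QpM.
by rewrite mulr_sumr; apply: eq_bigr => i _; rewrite mulrA.
Qed.

Lemma QspanB m (b : 'I_m -> Om) x y : Qspan b x -> Qspan b y -> Qspan b (x - y).
Proof.
move=> [f hf ->] [g hg ->]; exists (fun i => f i - g i) => [i|]; first exact: QpB.
by rewrite -sumrB; apply: eq_bigr => i _; rewrite mulrBl.
Qed.

(** Induction on the number of generators, which may be dependent. Either [b ord0] lies in the span
    [V] of the others and adds nothing, or, [V] being closed, it has positive distance from [V];
    then the first coordinates of approximations to [x] form a Cauchy sequence. *)
Lemma Qspan_closed m (b : 'I_m -> Om) : vclosed (Qspan b).
Proof.
elim: m b => [|m IH] b x hx.
  exists (fun _ => 0) => [[]|] //; rewrite big_ord0; apply: vge_all0 => C.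
  have [y [a _ ->]] := hx C; by rewrite big_ord0 subr0.
pose b' i := b (lift ord0 i); pose V := Qspan b'.
have VS y : Qspan b y <-> exists a v, [/\ Qp ord a, V v & y = a * b ord0 + v].
  split=> [[a ha ->]|[a [v [ha [f hf ->] ->]]]].
    exists (a ord0), (\sum_i a (lift ord0 i) * b' i); split=> //.
      by exists (fun i => a (lift ord0 i)).
    by rewrite big_ord_recl.
  exists (fun i => oapp f a (unlift ord0 i)) => [i|].
    by case: (unlift _ i) => /=.
  rewrite big_ord_recl unlift_none /=; congr (_ + _).
  by apply: eq_bigr => i _; rewrite liftK.
have Q0 : Qp ord 0 by rewrite -(subrr x); move=> C; exists 0; rewrite subrr ratr0_Om subr0 vge0.
have Q1 : Qp ord 1.
  by move=> C; exists 1; rewrite (ratr_int_Om 1) subrr vge0.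
have [Vb|nVb] := pselect (V (b ord0)).
  have SV y : Qspan b y -> V y.
    move=> /VS[a [v [ha hv ->]]]; rewrite -[v]opprK -sub0r.
    rewrite sub0r; apply: QspanB; first exact: QspanZ.
    by rewrite -sub0r; apply: QspanB => //; rewrite -(subrr v); apply: QspanB.
  have Vx : V x by apply: IH => C; have [y /SV Vy hy] := hx C; exists y.
  by apply/VS; exists 0, x; rewrite mul0r add0r.
have [C0 hC0] : exists C0, forall v, V v -> ~ vge C0 (b ord0 - v).
  apply: contrapT => h; apply: nVb; apply: IH => C; apply: contrapT => h'.
  by apply: h; exists C => v Vv hv; apply: h'; exists v.
(* the distance from b 0 to V bounds the first coordinate *)
have key a v C : Qp ord a -> V v -> vge (C + C0) (a * b ord0 + v) -> vge C a.
  move=> Qa Vv h; have [->|a0] := eqVneq a 0; first exact: vge0.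
  have Vav : V (- a^-1 * v) by apply: QspanZ => //; apply/QpN/QpV.
  have := hC0 _ Vav; have [t ot] := ord_fin a0; rewrite ot lee_fin => hn.
  rewrite leNgt; apply/negP => tC; apply: hn.
  have e : a * b ord0 + v = a * (b ord0 - - a^-1 * v) by field.
  move: h; rewrite e ordM ot.
  have [->|n0] := eqVneq (b ord0 - - a^-1 * v) 0; first by rewrite vge0.
  by have [r ->] := ord_fin n0; rewrite -EFinD !lee_fin => ?; lra.
have hx' (N : nat) : exists av : Om * Om,
    [/\ Qp ord av.1, V av.2 & vge N%:R (x - (av.1 * b ord0 + av.2))].
  have [y /VS[a [v [Qa Vv ->]]] hy] := hx N%:R.
  by exists (a, v).
have [av hav] := choice hx'.
have [|l hl] := @ord_complete R S (fun N => (av N).1).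
  move=> C; have [N hN] := real_archi (C + C0); exists N => i j Ni Nj.
  have [Qi Vi hi] := hav i; have [Qj Vj hj] := hav j.
  apply: (key _ ((av i).2 - (av j).2)); [exact: QpB | exact: QspanB |].
  have -> : ((av i).1 - (av j).1) * b ord0 + ((av i).2 - (av j).2) =
     (x - ((av j).1 * b ord0 + (av j).2)) - (x - ((av i).1 * b ord0 + (av i).2)) by ring.
  by apply: vgeB; apply: vge_le (le_trans hN _) _; try eassumption; rewrite ler_nat.
have Ql : Qp ord l.
  apply: Qp_closed => C; have [N hN] := hl C; exists (av N).1; first by case: (hav N).
  by apply/vgeBC/hN.
apply/VS; exists l, (x - l * b ord0); split=> //; last by ring.
apply: IH => C.
have [M hM] : exists M, vge M (b ord0).
  have [->|/ord_fin[r ->]] := eqVneq (b ord0) 0; last by exists r.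
  by exists 0; exact: vge0.
have [N hN] := hl (C - M); have [N' hN'] := real_archi C.
pose n := maxn N N'; have [Qn Vn hn] := hav n; exists (av n).2 => //.
have -> : x - l * b ord0 - (av n).2 =
  (x - ((av n).1 * b ord0 + (av n).2)) + ((av n).1 - l) * b ord0 by ring.
apply: vgeD.
  by apply: vge_le hn; rewrite (le_trans hN') // ler_nat leq_maxr.
by rewrite -[C](subrK M); apply: vgeM => //; apply/hN/leq_maxl.
Qed.

Lemma K1 : 1 \in K. Proof. by have [[]] := Kfield_finite S. Qed.

Lemma KB x y : x \in K -> y \in K -> x - y \in K.
Proof. by have [[_ h _] _ _] := Kfield_finite S; exact: h. Qed.

Lemma K0 : 0 \in K. Proof. by rewrite -(subrr 1); apply: KB K1 K1. Qed.

Lemma KN x : x \in K -> - x \in K.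
Proof. by rewrite -sub0r; apply: KB K0. Qed.

Lemma KD x y : x \in K -> y \in K -> x + y \in K.
Proof. by move=> hx /KN hy; rewrite -[y]opprK; apply: KB. Qed.

Lemma KV x : x \in K -> x^-1 \in K.
Proof. by have [[h1 _ h] _ _] := Kfield_finite S => hx; rewrite -[x^-1]mul1r; apply: h. Qed.

Lemma KM x y : x \in K -> y \in K -> x * y \in K.
Proof. by have [[_ _ h] _ _] := Kfield_finite S => hx /KV hy; rewrite -[y]invrK; apply: h. Qed.

Lemma Ksum (I : Type) (r : seq I) (P : pred I) (F : I -> Om) :
  (forall i, P i -> F i \in K) -> \sum_(i <- r | P i) F i \in K.
Proof. by move=> h; elim/big_ind: _ => //; [exact: K0 | move=> *; exact: KD]. Qed.

Lemma Kprod (I : Type) (r : seq I) (P : pred I) (F : I -> Om) :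
  (forall i, P i -> F i \in K) -> \prod_(i <- r | P i) F i \in K.
Proof. by move=> h; elim/big_ind: _ => //; [exact: K1 | move=> *; exact: KM]. Qed.

Lemma Knat (m : nat) : m%:R \in K.
Proof. by elim: m => [|m IH]; [exact: K0 | rewrite -natr1; apply: KD IH K1]. Qed.

Lemma Ksign m : (-1) ^+ m \in K.
Proof. by elim: m => [|m IH]; rewrite ?expr0 ?K1 // exprS KM ?KN ?K1. Qed.

Lemma Kdet m (A : 'M[Om]_m) : (forall i j, A i j \in K) -> \det A \in K.
Proof. by move=> h; apply: Ksum => s _; apply: KM; [exact: Ksign | apply: Kprod]. Qed.

Lemma KQp x : Qp ord x -> x \in K.
Proof. by have [_ h _] := Kfield_finite S; exact: h. Qed.

(** [K] is a finitely generated subspace over Q_p. Closedness keeps the values of infinite sums in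
    [K]. *)
Lemma K_closed : vclosed [set x | x \in K].
Proof.
have [_ _ [m [b [Kb hb]]]] := Kfield_finite S.
suff -> : [set x | x \in K] = Qspan b by exact: Qspan_closed.
apply/seteqP; split=> [x /= /hb[a ha ->]|x [a ha ->]]; first by exists a.
by apply: Ksum => i _; apply: KM => //; apply: KQp.
Qed.

Lemma Kosum (T : choiceType) (f : T -> Om) : (forall i, f i \in K) -> osum f \in K.
Proof.
move=> h; apply: (@osum_ind _ [set x | x \in K]); first exact: K0.
move=> s hs; apply: K_closed => C; have [A /(_ A (fsubset_refl _)) hA] := hs C.
by exists (\sum_(i <- A) f i) => //; apply: Ksum.
Qed.

End Valuation.

(** * Formal power series *)

Section PowerSeries.
Variable F : closedFieldType.
Implicit Types f g h s t : nat -> F.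

(** Coefficients up to a given order only see truncations, so the laws of series multiplication are
    inherited from polynomials. *)
Lemma ps_mul_poly N f g m : (m < N)%N ->
  ps_mul f g m = ((\poly_(i < N) f i) * (\poly_(i < N) g i))`_m.
Proof.
move=> mN; rewrite coefM /ps_mul; apply: eq_bigr => i _.
rewrite !coef_poly (leq_ltn_trans (leq_subr _ _) mN).
by rewrite (leq_ltn_trans _ mN) // -ltnS.
Qed.

Lemma eq_ps_mul f f' g g' m : (forall i, (i <= m)%N -> f i = f' i) ->
  (forall i, (i <= m)%N -> g i = g' i) -> ps_mul f g m = ps_mul f' g' m.
Proof.
move=> hf hg; apply: eq_bigr => i _.
by rewrite hf -1?ltnS // hg // leq_subr.
Qed.

Lemma ps_mulC f g : ps_mul f g = ps_mul g f.
Proof. by apply/funext => m; rewrite !(ps_mul_poly _ _ (ltnSn m)) mulrC. Qed.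

Lemma ps_mulA f g h : ps_mul f (ps_mul g h) = ps_mul (ps_mul f g) h.
Proof.
apply/funext => m; pose p f := \poly_(i < m.+1) f i.
have e f1 g1 i : (i <= m)%N -> ps_mul f1 g1 i = (p f1 * p g1)`_i.
  by move=> im; rewrite (@ps_mul_poly m.+1).
transitivity ((p f * (p g * p h))`_m).
  rewrite coefM; apply: eq_bigr => i _.
  by rewrite e ?leq_subr // /p coef_poly ltn_ord.
rewrite mulrA coefM; apply: eq_bigr => i _.
by rewrite [in RHS]e -1?ltnS // /p [in LHS]coef_poly ltnS leq_subr.
Qed.

Lemma ps_mul1 f : ps_mul (@ps_one F) f = f.
Proof.
apply/funext => m; rewrite /ps_mul big_ord_recl /= subn0 /ps_one mul1r.
by rewrite big1 ?addr0 // => i _; rewrite /= mul0r.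
Qed.

HB.instance Definition _ := Monoid.isComLaw.Build _ (@ps_one F) (@ps_mul F)
  ps_mulA ps_mulC ps_mul1.

Lemma ps_mul_at0 f g : ps_mul f g 0%N = f 0%N * g 0%N.
Proof. by rewrite /ps_mul big_ord1. Qed.

Lemma ps_big_at0 (I : Type) (r : seq I) (P : pred I) (f : I -> nat -> F) :
  (forall i, P i -> f i 0%N = 1) ->
  (\big[@ps_mul F/@ps_one F]_(i <- r | P i) f i) 0%N = 1.
Proof.
move=> h; apply: (big_ind (fun f => f 0%N = 1)) => // f1 f2 h1 h2.
by rewrite ps_mul_at0 h1 h2 mulr1.
Qed.

(** Each coefficient of the inverse depends on all the previous ones, hence a recursion that carries
    the whole list. *)
Fixpoint ps_inv_seq f m : seq F :=
  if m is m'.+1 then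
    rcons (ps_inv_seq f m') (- \sum_(i < m) f i.+1 * (ps_inv_seq f m')`_(m' - i))
  else [:: 1].

Lemma ps_inv_exists f : f 0%N = 1 -> exists g, ps_mul f g = @ps_one F.
Proof.
move=> f0; pose l := ps_inv_seq f.
have sz m : size (l m) = m.+1 by elim: m => //= m IH; rewrite size_rcons IH.
have st m i : (i <= m)%N -> (l m)`_i = (l i)`_i.
  elim: m => [|m IH]; first by rewrite leqn0 => /eqP ->.
  rewrite leq_eqVlt => /orP[/eqP -> //|im].
  by rewrite /= nth_rcons sz im IH.
exists (fun m => (l m)`_m); apply/funext => -[|m].
  by rewrite ps_mul_at0 f0 mul1r.
rewrite /ps_mul big_ord_recl f0 mul1r /= subn0.
rewrite nth_rcons -/(l m) sz ltnn eqxx addrC; apply/eqP; rewrite subr_eq0.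
apply/eqP/eq_bigr => i _; rewrite /= subSS; congr (_ * _).
by rewrite [RHS]st // leq_subr.
Qed.

Lemma ps_invP f : f 0%N = 1 -> ps_mul f (ps_inv f) = @ps_one F.
Proof.
move=> /ps_inv_exists[g hg]; rewrite /ps_inv; case: xgetP => // h0.
by case: (h0 g).
Qed.

Lemma ps_inv_at0 f : f 0%N = 1 -> ps_inv f 0%N = 1.
Proof. by move=> f0; have := congr1 (@^~ 0%N) (ps_invP f0); rewrite ps_mul_at0 f0 mul1r. Qed.

Lemma ps_invS f m : f 0%N = 1 ->
  ps_inv f m.+1 = - \sum_(i < m.+1) f i.+1 * ps_inv f (m - i)%N.
Proof.
move=> f0; have /eqP := congr1 (@^~ m.+1) (ps_invP f0).
rewrite /ps_mul big_ord_recl f0 mul1r /= subn0 addr_eq0 => /eqP ->.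
by congr (- _); apply: eq_bigr => i _.
Qed.

Definition ps_dil (a : F) f : nat -> F := fun m => a ^+ m * f m.

Lemma ps_dilM a f g : ps_dil a (ps_mul f g) = ps_mul (ps_dil a f) (ps_dil a g).
Proof.
apply/funext => m; rewrite /ps_dil mulr_sumr; apply: eq_bigr => i _.
have -> : a ^+ m = a ^+ i * a ^+ (m - i) by rewrite -exprD subnKC // -ltnS.
by rewrite mulrACA.
Qed.

Lemma ps_subst_expM d f g : (0 < d)%N ->
  ps_subst_exp d (ps_mul f g) = ps_mul (ps_subst_exp d f) (ps_subst_exp d g).
Proof.
move=> d0; apply/funext => m; pose p f := \poly_(i < m.+1) f i.
have e f1 i : (i <= m)%N -> ps_subst_exp d f1 i = (p f1 \Po 'X^d)`_i.
  move=> im; rewrite coef_comp_poly_Xn // /ps_subst_exp; case: ifP => // _.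
  by rewrite coef_poly ltnS (leq_trans (leq_div _ _) im).
transitivity (((p f * p g) \Po 'X^d)`_m).
  rewrite coef_comp_poly_Xn // /ps_subst_exp; case: ifP => // _.
  by rewrite (@ps_mul_poly m.+1) // ltnS leq_div.
rewrite comp_polyM coefM; apply: eq_bigr => i _.
by rewrite !e // ?leq_subr // -ltnS.
Qed.

(* [logd f s] says that [- T f' / f = s]. *)
Definition logd f s :=
  f 0%N = 1 /\ forall m, m%:R * f m = - ps_mul s f m.

Lemma eq_logd f s t : s =1 t -> logd f s -> logd f t.
Proof. by move=> /funext ->. Qed.

Lemma logd1 : logd (@ps_one F) (fun=> 0).
Proof.
split=> // m; rewrite /ps_mul big1 ?oppr0 => [|i _]; last by rewrite mul0r.
by case: m => [|m]; rewrite /ps_one ?mul0r ?mulr0.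
Qed.

Lemma ps_mul_th f g m :
  m%:R * ps_mul f g m = ps_mul (fun i => i%:R * f i) g m + ps_mul f (fun i => i%:R * g i) m.
Proof.
rewrite /ps_mul mulr_sumr -big_split; apply: eq_bigr => i _ /=.
have -> : m%:R = i%:R + (m - i)%N%:R :> F by rewrite -natrD subnKC // -ltnS.
by ring.
Qed.

Lemma ps_mulDl f f' g m :
  ps_mul (fun i => f i + f' i) g m = ps_mul f g m + ps_mul f' g m.
Proof. by rewrite /ps_mul -big_split; apply: eq_bigr => i _; rewrite mulrDl. Qed.

Lemma ps_mulNl f g : ps_mul (fun i => - f i) g = fun m => - ps_mul f g m.
Proof.
by apply/funext => m; rewrite /ps_mul -sumrN; apply: eq_bigr => i _; rewrite mulNr.
Qed.

Lemma logdM f g s t : logd f s -> logd g t -> logd (ps_mul f g) (fun k => s k + t k).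
Proof.
move=> [f0 hf] [g0 hg]; split; first by rewrite ps_mul_at0 f0 g0 mulr1.
move=> m; rewrite ps_mul_th (funext hf) (funext hg) [ps_mul f (fun _ => _)]ps_mulC !ps_mulNl.
rewrite ps_mulDl opprD ps_mulA; congr (_ - _).
by rewrite [ps_mul f g]ps_mulC ps_mulA.
Qed.

Lemma logd_big (I : eqType) (r : seq I) (f : I -> nat -> F) (s : I -> nat -> F) :
  (forall i, i \in r -> logd (f i) (s i)) ->
  logd (\big[@ps_mul F/@ps_one F]_(i <- r) f i) (fun k => \sum_(i <- r) s i k).
Proof.
elim: r => [|i r IH] h.
  by rewrite big_nil; apply: eq_logd logd1 => k; rewrite big_nil.
rewrite big_cons; apply: eq_logd (logdM (h i _) (IH _)) => [k||j jr].
- by rewrite big_cons.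
- by rewrite mem_head.
- by apply: h; rewrite in_cons jr orbT.
Qed.

Lemma logd_inv f s : logd f s -> logd (ps_inv f) (fun k => - s k).
Proof.
move=> [f0 hf]; set g := ps_inv f; have fg := ps_invP f0.
split; first exact: ps_inv_at0.
have h : ps_mul f (fun m => m%:R * g m) = s.
  have : ps_mul (fun m => m%:R * f m) g = (fun m => - s m).
    by rewrite (funext hf) ps_mulNl -ps_mulA fg [ps_mul s _]ps_mulC ps_mul1.
  move=> e; apply/funext => m; have := ps_mul_th f g m.
  rewrite fg e; have -> : m%:R * @ps_one F m = 0.
    by rewrite /ps_one; case: m => [|m]; rewrite ?mul0r ?mulr0.
  by move=> /esym/eqP; rewrite addrC subr_eq0 => /eqP.
move=> m; rewrite ps_mulNl opprK -h [ps_mul f _]ps_mulC -ps_mulA fg.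
by rewrite ps_mulC ps_mul1.
Qed.

Lemma logd_subst d f s : (0 < d)%N -> logd f s ->
  logd (ps_subst_exp d f) (fun k => d%:R * ps_subst_exp d s k).
Proof.
move=> d0 [f0 hf]; split; first by rewrite /ps_subst_exp dvdn0 div0n.
move=> m.
have -> : ps_mul (fun k => d%:R * ps_subst_exp d s k) (ps_subst_exp d f) m =
    d%:R * ps_mul (ps_subst_exp d s) (ps_subst_exp d f) m.
  by rewrite /ps_mul mulr_sumr; apply: eq_bigr => i _; rewrite mulrA.
rewrite -ps_subst_expM // /ps_subst_exp; case: ifP => [dm|]; last by rewrite !mulr0 oppr0.
by rewrite -mulrN -hf mulrA -natrM mulnC divnK.
Qed.

Lemma logd_dil a f s : logd f s -> logd (ps_dil a f) (ps_dil a s).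
Proof.
move=> [f0 hf]; split; first by rewrite /ps_dil expr0 mul1r.
by move=> m; rewrite -ps_dilM /ps_dil mulrCA hf mulrN.
Qed.

(** The relation forces s_0 = 0, so it is a recursion for k f_k in terms of earlier coefficients;
    characteristic zero allows division by k. *)
Lemma logd_uniq f g s t M : [pchar F] =i pred0 -> logd f s -> logd g t ->
  (forall k, (k <= M)%N -> s k = t k) -> forall k, (k <= M)%N -> f k = g k.
Proof.
move=> ch [f0 hf] [g0 hg] st k; elim/ltn_ind: k => -[|k] IH kM; first by rewrite f0 g0.
have k0 : k.+1%:R != 0 :> F by rewrite ((pcharf0P F).1 ch).
apply: (mulfI k0); rewrite hf hg; congr (- _); rewrite /ps_mul big_ord_recl [RHS]big_ord_recl.
have s0 f1 s1 : f1 0%N = 1 -> (forall m, m%:R * f1 m = - ps_mul s1 f1 m) -> s1 0%N = 0.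
  move=> f10 /(_ 0%N); rewrite mul0r ps_mul_at0 f10 mulr1 => /esym/eqP.
  by rewrite oppr_eq0 => /eqP.
rewrite (s0 f s) // (s0 g t) // !mul0r; congr (_ + _); apply: eq_bigr => i _ /=.
rewrite /bump add1n subSS st ?(leq_trans _ kM) // ?ltnS -1?ltnS // IH //.
  by rewrite ltnS leq_subr.
by apply: leq_trans kM; rewrite leqW // leq_subr.
Qed.

(** * Characteristic power series of finite matrices *)

Definition cdet m (A : 'M[F]_m) : {poly F} := \det (1%:M - 'X *: map_mx polyC A).

Lemma deriv_prod (I : finType) (p : I -> {poly F}) :
  (\prod_i p i)^`() = \sum_i (p i)^`() * \prod_(j | j != i) p j.
Proof.
have h (r : seq I) : uniq r -> (\prod_(i <- r) p i)^`() =
    \sum_(i <- r) (p i)^`() * \prod_(j <- r | j != i) p j.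
  elim: r => [|i r IH] /=; first by rewrite !big_nil derivC.
  move=> /andP[ir ur]; rewrite !big_cons derivM IH // eqxx /=; congr (_ * _ + _).
    rewrite [RHS]big_seq_cond [LHS]big_seq; apply: eq_bigl => j.
    by case: (boolP (j \in r)) => //= jr; rewrite (memPn ir).
  rewrite mulr_sumr !big_seq; apply: eq_bigr => j jr.
  rewrite big_cons; have -> : i != j by apply: contraNneq ir => ->.
  by rewrite mulrCA.
by rewrite h ?index_enum_uniq.
Qed.

(** Jacobi's formula: differentiate one row at a time and expand along that row. *)
Lemma deriv_det m (M : 'M[{poly F}]_m) :
  (\det M)^`() = \tr (\adj M *m map_mx (@deriv F) M).
Proof.
rewrite mxtrace_mulC /mxtrace.
transitivity (\sum_i \det (\matrix_(k, l) if k == i then (M k l)^`() else M k l)).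
  rewrite /determinant raddf_sum /= exchange_big /=; apply: eq_bigr => s _.
  rewrite -mulr_sumr; have -> : (-1) ^+ s = ((-1) ^+ s)%:P :> {poly F}.
    by rewrite rmorphXn rmorphN1.
  rewrite derivM derivC mul0r add0r deriv_prod; congr (_ * _).
  apply: eq_bigr => i _; rewrite [RHS](bigD1 i) //= mxE eqxx; congr (_ * _).
  by apply: eq_bigr => j /negbTE ji; rewrite mxE ji.
apply: eq_bigr => i _; rewrite (expand_det_row _ i) mxE; apply: eq_bigr => j _.
rewrite !mxE eqxx; congr (_ * _); rewrite /cofactor; congr (_ * \det _).
by apply/matrixP => k l; rewrite !mxE eq_sym (negbTE (neq_lift _ _)).
Qed.

(** The adjugate Q of I - X A satisfies Q = P + X Q A with P the determinant, so its coefficients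
    are the partial sums of P_(l - a) A^a; Jacobi's formula gives P' = - Tr (Q A). *)
Lemma logd_cdet m (A : 'M[F]_m) :
  logd (fun k => (cdet A)`_k) (fun k => if k is 0 then 0 else \tr (A ^+ k)).
Proof.
set M := 1%:M - 'X *: map_mx polyC A; pose Q := \adj M; pose P := cdet A.
have M0 : P`_0 = 1.
  rewrite -horner_coef0 -/(horner_eval 0 P) -det_map_mx.
  have -> : map_mx (horner_eval 0) M = 1%:M.
    apply/matrixP => i j; rewrite !mxE /horner_eval !hornerE /= hornerMn hornerC.
    by rewrite subr0.
  by rewrite det1.
split=> [|k]; first exact: M0.
pose q k := map_mx (coefp k) Q.
have qS l : q l.+1 = (P`_l.+1)%:M + q l *m A.
  have : Q *m M = P%:M by rewrite mul_adj_mx.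
  rewrite mulmxBr mulmx1 => /eqP; rewrite subr_eq => /eqP e.
  rewrite {1}/q e; apply/matrixP => i j; rewrite !mxE /= coefD coefMn.
  congr (_ + _); rewrite coef_sum; apply: eq_bigr => a _.
  by rewrite !mxE mulrCA coefXM /= coefMC.
have q0 : q 0%N = 1%:M.
  have : Q *m M = P%:M by rewrite mul_adj_mx.
  rewrite mulmxBr mulmx1 => /eqP; rewrite subr_eq => /eqP e.
  rewrite {1}/q e; apply/matrixP => i j; rewrite !mxE /= coefD coefMn.
  rewrite M0 coef_sum [X in _ + X]big1 ?addr0 // => a _.
  by rewrite !mxE mulrCA coefXM.
have qE l : q l = \sum_(a < l.+1) P`_(l - a) *: A ^+ a.
  elim: l => [|l IH]; first by rewrite big_ord1 q0 M0 scale1r.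
  rewrite qS IH [RHS]big_ord_recl subn0 expr0 scalemx1; congr (_ + _).
  rewrite mulmx_suml; apply: eq_bigr => a _.
  by rewrite -scalemxAl lift0 subSS exprSr.
case: k => [|k]; first by rewrite mul0r ps_mul_at0 mul0r oppr0.
rewrite -/P mulrC mulr_natr -coef_deriv /P /cdet deriv_det -/M -/Q.
have -> : map_mx (@deriv F) M = - map_mx polyC A.
  apply/matrixP => i j; rewrite !mxE derivB derivMn derivC mul0rn sub0r.
  by rewrite derivM derivX derivC mulr0 addr0 mul1r.
rewrite mulmxN raddfN coefN; congr (- _).
have -> : (\tr (Q *m map_mx polyC A))`_k = \tr (q k *m A).
  rewrite /mxtrace coef_sum; apply: eq_bigr => i _; rewrite !mxE coef_sum.
  by apply: eq_bigr => a _; rewrite !mxE coefMC.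
rewrite qE mulmx_suml raddf_sum /= /ps_mul [RHS]big_ord_recl mul0r add0r.
apply: eq_bigr => a _; rewrite -scalemxAl mxtraceZ lift0 subSS mulrC.
by rewrite exprSr.
Qed.

(** In the product over the rows, [Y] is the set of rows that contribute - X A. Rows outside [Y]
    keep their identity row, so that all the determinants have the same size. *)
Lemma coef_cdet m (A : 'M[F]_m) k : (cdet A)`_k =
  (-1) ^+ k * \sum_(Y : {set 'I_m} | #|Y| == k)
     \det (\matrix_(i, j) if i \in Y then A i j else (i == j)%:R).
Proof.
have e : cdet A = \sum_(Y : {set 'I_m})
    ((-1) ^+ #|Y| * \det (\matrix_(i, j) if i \in Y then A i j else (i == j)%:R)) *: 'X^#|Y|.
  rewrite /cdet /determinant.
  under eq_bigr => s _.
    have -> : \prod_i (1%:M - 'X *: map_mx polyC A) i (s i) =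
      \prod_i (- 'X * (A i (s i))%:P + ((i == s i)%:R)%:P).
      apply: eq_bigr => i _; rewrite !mxE addrC mulNr; congr (_ + _).
      by rewrite polyC_natr.
    rewrite bigA_distr mulr_sumr.
    over.
  rewrite exchange_big /=; apply: eq_bigr => Y _.
  rewrite mulr_sumr scaler_suml; apply: eq_bigr => s _.
  have -> : \prod_i (if i \in Y then - 'X * (A i (s i))%:P else ((i == s i)%:R)%:P) =
     (\prod_i (if i \in Y then - 'X else 1)) *
     (\prod_i (if i \in Y then A i (s i) else (i == s i)%:R))%:P.
    rewrite rmorph_prod -big_split; apply: eq_bigr => i _ /=.
    by case: ifP; rewrite ?mul1r.
  rewrite -big_mkcond prodr_const [(- 'X) ^+ _]exprNn.
  under [X in _ = (_ * (_ * X)) *: _]eq_bigr do rewrite mxE.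
  rewrite -mul_polyC !rmorphM /= !rmorphXn !rmorphN1.
  by rewrite -!mulrA [X in _ * (_ * X)]mulrC mulrCA.
rewrite e coef_sum mulr_sumr [RHS]big_mkcond; apply: eq_bigr => Y _.
by rewrite coefZ coefXn eq_sym; case: eqP => [->|]; rewrite ?mulr1 ?mulr0.
Qed.

End PowerSeries.

(** * Fredholm determinants *)

Section Fredholm.
Variables (R : realType) (S : padic_setting R).
Notation Om := (Om S).
Notation ord := (@ord R S).
Notation K := (Kfield S).
Notation vge C x := ((C%:E <= ord x%R)%E).

Section Minors.
Variable J : choiceType.
Implicit Types (A B : J -> J -> Om) (X Y Z : {fset J}) (C D : R).

Definition fval Z (a : 'I_#|{: Z}|) : J := val (enum_val a).

Definition fsub A Z : 'M[Om]_#|{: Z}| := \matrix_(a, b) A (fval a) (fval b).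

Lemma fval_inj Z : injective (@fval Z).
Proof. by move=> a b /val_inj/enum_val_inj. Qed.

Lemma fvalP Z (a : 'I_#|{: Z}|) : fval a \in Z.
Proof. exact: valP. Qed.

Lemma fval_surj Z j : j \in Z -> exists a : 'I_#|{: Z}|, fval a = j.
Proof. by move=> jZ; exists (enum_rank [` jZ]%fset); rewrite /fval enum_rankK. Qed.

Lemma big_fval (T : Type) (idx : T) (op : Monoid.com_law idx) Z (F : J -> T) :
  \big[op/idx]_(j <- Z) F j = \big[op/idx]_(a < #|{: Z}|) F (fval a).
Proof.
rewrite big_seq_fsetE /= (reindex (@enum_val {: Z} predT)) //=.
by exists enum_rank => ? _; rewrite ?enum_rankK ?enum_valK.
Qed.

(** Rows and columns undergo the same permutation, so the two signs cancel. *)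
Lemma minor_reindex A N (h : 'I_N -> J) Y : injective h ->
  (forall y, y \in Y <-> exists a, h a = y) ->
  \det (\matrix_(a, b) A (h a) (h b)) = principal_minor A Y.
Proof.
move=> hi hY.
have eN : N = #|{: Y}|.
  rewrite -cardfE -[LHS]card_ord -(size_codom h); apply: perm_size.
  apply: uniq_perm; [by apply/injectiveP | exact: fset_uniq |].
  move=> y; apply/codomP/idP => [[a ->]|/hY[a <-]]; last by exists a.
  by apply/hY; exists a.
subst N; have hY' a : h a \in Y by apply/hY; exists a.
pose s a := enum_rank [` hY' a]%fset.
have sE a : fval (s a) = h a by rewrite /fval enum_rankK.
have si : injective s by move=> a b e; apply: hi; rewrite -!sE e.
have -> : \matrix_(a, b) A (h a) (h b) =
    row_perm (perm si) (col_perm (perm si) (fsub A Y)).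
  by apply/matrixP => a b; rewrite !mxE !permE !sE.
rewrite row_permE col_permE !det_mulmx !det_perm odd_permV mulrCA.
by rewrite -signr_addb addbb mulr1.
Qed.

(** Expanding along an identity row deletes one index outside [Y]; induction deletes them all. *)
Lemma det_unit_rows A N (h : 'I_N -> J) Y : injective h ->
  (forall y, y \in Y -> exists a, h a = y) ->
  \det (\matrix_(a, b) if h a \in Y then A (h a) (h b) else (a == b)%:R) =
  principal_minor A Y.
Proof.
elim: N h => [|N IH] h hi hY.
  rewrite -(@minor_reindex A 0 h) //.
    by congr (\det _); apply/matrixP => -[].
  by move=> y; split=> [/hY //|[[]]].
have [a0 ha0|hall] := pickP (fun a => h a \notin Y); last first.
  have hA a : h a \in Y by apply/negPn; rewrite hall.
  rewrite -(@minor_reindex A _ h) //.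
    by congr (\det _); apply/matrixP => a b; rewrite !mxE hA.
  by move=> y; split=> [/hY //|[a <-]].
rewrite (expand_det_row _ a0) (bigD1 a0) //= big1 ?addr0; last first.
  by move=> b ba; rewrite mxE (negbTE ha0) eq_sym (negbTE ba) mul0r.
rewrite mxE (negbTE ha0) eqxx mul1r /cofactor -signr_odd oddD addbb mul1r.
rewrite -(IH (h \o lift a0)).
- congr (\det _); apply/matrixP => a b; rewrite !mxE /=; case: ifP => // _.
  by rewrite (inj_eq lift_inj).
- by move=> a b /hi/lift_inj.
- move=> y yY; have [a ha] := hY y yY.
  case: (unliftP a0 a) => [b ab|aa]; first by exists b; rewrite /= -ab.
  by case/negP: ha0; rewrite -aa ha.
Qed.

(** This is the sum that defines [fredholm], restricted to subsets of [Z]: the bridge between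
    infinite and finite determinants. *)
Lemma coef_cdet_fsub A Z k : (cdet (fsub A Z))`_k =
  (-1) ^+ k * \sum_(Y <- fpowerset Z | #|` Y| == k) principal_minor A Y.
Proof.
rewrite coef_cdet; congr (_ * _).
pose im (Y : {set 'I_#|{: Z}|}) : {fset J} := [fset fval a | a in Y]%fset.
have imE (Y : {set 'I_#|{: Z}|}) a : (fval a \in im Y) = (a \in Y).
  apply/imfsetP/idP => [[b bY /fval_inj ->] //|aY]; by exists a.
have imi : injective im.
  by move=> Y Y' e; apply/setP => a; rewrite -!imE e.
have p : perm_eq (fpowerset Z) [seq im W | W <- index_enum {set 'I_#|{: Z}|}].
  apply: uniq_perm; first exact: fset_uniq.
    by rewrite map_inj_uniq // index_enum_uniq.
  move=> Y; rewrite fpowersetE; apply/idP/mapP => [/fsubsetP YZ|[Y' _ ->]].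
    exists (finset (fun a => fval a \in Y)); first by rewrite mem_index_enum.
    apply/fsetP => y; apply/idP/idP => [yY|].
      have [a ay] := fval_surj (YZ y yY); rewrite -ay imE inE ay //.
    by move=> /imfsetP[a]; rewrite inE => aY ->.
  by apply/fsubsetP => y /imfsetP[a _ ->]; exact: fvalP.
rewrite (perm_big _ p) big_map; apply: eq_big => [Y|Y _].
  by rewrite /im card_imfset //=; [rewrite cardE | exact: fval_inj].
rewrite -(@det_unit_rows A _ (@fval Z)); last first.
- by move=> y /imfsetP[a _ ->]; exists a.
- exact: fval_inj.
by congr (\det _); apply/matrixP => a b; rewrite !mxE imE.
Qed.

Lemma minor_fset0 A : principal_minor A fset0 = 1.
Proof.
rewrite -(@minor_reindex A 0 (fun a => False_rect J (notF (ltn_ord a)))); first exact: det_mx00.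
  by case.
by move=> y; rewrite inE; split=> // -[[]].
Qed.

Lemma vge_minor_col A Y j D : (forall i j, vge 0 (A i j)) -> j \in Y ->
  (forall i, i \in Y -> vge D (A i j)) -> vge D (principal_minor A Y).
Proof.
move=> A0 /fval_surj[b <-] h; rewrite /principal_minor (expand_det_col _ b).
apply: vge_sum => a _; rewrite mxE; apply: vgeMr; first by apply: h; exact: fvalP.
apply: vgeMl; first exact: vge_sign.
by apply: vge_det => i l; rewrite !mxE.
Qed.

(** Conjugation by a diagonal matrix does not change principal minors: along each permutation the
    weights [la] cancel. *)
Lemma vge_minor_weight A Y (g la : J -> R) :
  (forall i j, vge (g j + la j - la i) (A i j)) ->
  vge (\sum_(j <- Y) g j) (principal_minor A Y).
Proof.
move=> h; rewrite big_fval; apply: vge_sum => s _.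
apply: vgeMl; first exact: vge_sign.
have -> : \sum_(a < #|{: Y}|) g (fval a) =
    \sum_(a < #|{: Y}|) (g (fval (s a)) + la (fval (s a)) - la (fval a)).
  rewrite sumrB big_split /= [in LHS](reindex_inj (@perm_inj _ s)).
  by rewrite [X in _ - X](reindex_inj (@perm_inj _ s)) addrK.
by apply: vge_prod => a _; rewrite mxE.
Qed.

Lemma vge_minor A Y : (forall i j, vge 0 (A i j)) -> vge 0 (principal_minor A Y).
Proof. by move=> h; apply: vge_det => i j; rewrite mxE. Qed.

(** Weaker than [cols_null] for integral matrices. The Dwork matrix may fail [cols_null], because
    its column (v, j) contains the coefficient of exponent 0 of B in row (q v, i) for every v. *)
Definition minors_null A :=
  forall D, exists Z, forall Y, ~~ (Y `<=` Z)%fset -> vge D (principal_minor A Y).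

Definition cols_null A :=
  forall D, exists X, forall j, j \notin X -> forall i, vge D (A i j).

Lemma vge_minor_out A X D : (forall i j, vge 0 (A i j)) ->
  (forall j, j \notin X -> forall i, vge D (A i j)) ->
  forall Y, ~~ (Y `<=` X)%fset -> vge D (principal_minor A Y).
Proof.
move=> A0 hX Y /fsubsetPn[j jY jX].
by apply: (vge_minor_col A0 jY) => i _; exact: hX.
Qed.

Lemma cols_null_minors A : (forall i j, vge 0 (A i j)) -> cols_null A -> minors_null A.
Proof. by move=> A0 h D; have [X hX] := h D; exists X; exact: vge_minor_out. Qed.

Lemma minors_null_sum A m : minors_null A ->
  null (fun X : {fset J} => if #|` X| == m then principal_minor A X else 0).
Proof.
move=> h D; have [Z hZ] := h D; exists (fpowerset Z) => Y; rewrite fpowersetE => YZ.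
by case: ifP => _; [exact: hZ | exact: vge0].
Qed.

Lemma vge_cdet N (M : 'M[Om]_N) m : (forall a b, vge 0 (M a b)) -> vge 0 (cdet M)`_m.
Proof.
move=> hM; rewrite coef_cdet; apply: vgeMl; first exact: vge_sign.
apply: vge_sum => Y _; apply: vge_det => i j; rewrite mxE.
by case: ifP => _ //; exact: vge_nat.
Qed.

Lemma cg_cdet N (M M' : 'M[Om]_N) C m : (forall a b, vge 0 (M a b)) ->
  (forall a b, vge 0 (M' a b)) -> (forall a b, vge C (M a b - M' a b)) ->
  vge C ((cdet M)`_m - (cdet M')`_m).
Proof.
move=> hM hM' h; rewrite !coef_cdet -mulrBr; apply: vgeMl; first exact: vge_sign.
apply: cg_sum => Y _; apply: cg_det => i j; rewrite !mxE; case: ifP => _ //;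
  by [exact: vge_nat | rewrite subrr vge0].
Qed.

Lemma fredholm_approx A Z C (M : 'M[Om]_#|{: Z}|) m :
  (forall i j, vge 0 (A i j)) -> minors_null A ->
  (forall Y, ~~ (Y `<=` Z)%fset -> vge C (principal_minor A Y)) ->
  (forall a b, vge 0 (M a b)) ->
  (forall a b, vge C (A (fval a) (fval b) - M a b)) ->
  vge C (fredholm A m - (cdet M)`_m).
Proof.
move=> A0 An AZ M0 AM.
apply: (@vge_trans _ _ _ _ (cdet (fsub A Z))`_m); last first.
  by apply: cg_cdet => // a b; rewrite mxE.
rewrite coef_cdet_fsub /fredholm -mulrBr; apply: vgeMl; first exact: vge_sign.
rewrite [X in _ - X]big_mkcond; apply: osum_approx; first exact: minors_null_sum.
move=> Y; rewrite fpowersetE => YZ.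
by case: ifP => _; [exact: AZ | exact: vge0].
Qed.

Lemma vge_fredholm A m : (forall i j, vge 0 (A i j)) -> vge 0 (fredholm A m).
Proof.
move=> h; apply: vgeMl; first exact: vge_sign.
apply: vge_osum => Y; case: ifP => _; [exact: vge_minor | exact: vge0].
Qed.

Lemma K_fredholm A m : (forall i j, A i j \in K) -> fredholm A m \in K.
Proof.
move=> h; apply: KM; first exact: Ksign.
apply: Kosum => Y; case: ifP => _; last exact: K0.
by apply: Kdet => i j; rewrite mxE.
Qed.

Lemma fredholm_at0 A : fredholm A 0 = 1.
Proof.
rewrite /fredholm mul1r (@osum1 _ _ _ _ fset0) ?cardfs0 ?eqxx ?minor_fset0 //.
by move=> Y; rewrite -cardfs_eq0 => /negbTE ->.
Qed.

Lemma cg_fredholm A B C m : (forall i j, vge 0 (A i j)) -> (forall i j, vge 0 (B i j)) ->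
  minors_null A -> minors_null B -> (forall i j, vge C (A i j - B i j)) ->
  vge C (fredholm A m - fredholm B m).
Proof.
move=> A0 B0 nA nB h; rewrite /fredholm -mulrBr; apply: vgeMl; first exact: vge_sign.
apply: cg_osum; [exact: minors_null_sum | exact: minors_null_sum |] => Y.
case: ifP => _; last by rewrite subrr vge0.
by apply: cg_det => a b; rewrite !mxE.
Qed.

End Minors.
End Fredholm.

(** * Roots of unity and closed points *)

Section PrimitiveRoots.

Lemma closed_prim_root (F : closedFieldType) (m : nat) : [pchar F] =i pred0 ->
  (0 < m)%N -> exists z : F, m.-primitive_root z.
Proof.
move=> ch m0; have [r hr] := closed_field_poly_normal ('X^m - 1 : {poly F}).
have lc : lead_coef ('X^m - 1 : {poly F}) = 1 by rewrite lead_coefXnsubC.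
rewrite lc scale1r in hr.
have ur : uniq r.
  rewrite -separable_prod_XsubC -hr separable_Xn_sub_1 //.
  by rewrite ((pcharf0P F).1 ch) -lt0n.
have sr : size r = m.
  by apply/eqP; rewrite -eqSS -(size_prod_XsubC r id) -hr size_XnsubC.
have /(has_prim_root m0) : all m.-unity_root r.
  by apply/allP => x xr; rewrite /root_of_unity hr root_prod_XsubC.
by rewrite sr => /(_ ur (leqnn _))/hasP[z _ hz]; exists z.
Qed.

Lemma sum_prim_root (F : fieldType) (m : nat) (z : F) (a : int) :
  m.-primitive_root z ->
  \sum_(j < m) (z ^ a) ^+ j = if (m %| a)%Z then m%:R else 0.
Proof.
move=> zm; have m0 := prim_order_gt0 zm.
have zu : z \is a GRing.unit.
  by rewrite unitfE; apply: contraTneq m0 => z0; have := prim_expr_order zm;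
     rewrite z0 expr0n; case: m zm => // m zm /eqP; rewrite eq_sym oner_eq0.
have e : (z ^ a == 1) = (m %| a)%Z.
  rewrite dvdzE absz_nat; case: a => a.
    by rewrite -exprnP (prim_order_dvd zm).
  by rewrite NegzE -exprnN invr_eq1 (prim_order_dvd zm) abszN.
rewrite -e; case: eqP => [->|/eqP z1].
  by under eq_bigr do rewrite expr1n; rewrite sumr_const card_ord.
have : (z ^ a - 1) * \sum_(j < m) (z ^ a) ^+ j = 0.
  by rewrite -subrX1 exprnP exprz_exp mulrC -exprz_exp -exprnP (prim_expr_order zm) exp1rz subrr.
by move/eqP; rewrite mulf_eq0 subr_eq0 (negbTE z1) => /eqP.
Qed.

End PrimitiveRoots.

Section ClosedPoints.
Variables (R : realType) (S : padic_setting R) (n : nat).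
Notation Om := (Om S).
Notation ord := (@ord R S).
Notation red := (@red R S).
Notation q := (card_q S).
Notation vge C x := ((C%:E <= ord x%R)%E).
Notation rd := (map_mx red).

Lemma q_gt1 : (1 < q)%N.
Proof.
have [a a0 ->] := card_qP S; apply: leq_trans (prime_gt1 (prime_pP S)) _.
by rewrite -{1}[prime_p S]expn1 leq_pexp2l // prime_gt0 // prime_pP.
Qed.

Lemma qk_gt1 k : (0 < k)%N -> (1 < q ^ k)%N.
Proof. by move=> k0; rewrite -(exp1n k) ltn_exp2r // q_gt1. Qed.

Lemma red1 : red 1 = 1.
Proof. by have [] := red_residue S. Qed.

Lemma redD x y : vge 0 x -> vge 0 y -> red (x + y) = red x + red y.
Proof. by have [_ h _ _ _] := red_residue S; exact: h. Qed.

Lemma redM x y : vge 0 x -> vge 0 y -> red (x * y) = red x * red y.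
Proof. by have [_ _ h _ _] := red_residue S; exact: h. Qed.

Lemma red_eq0 x : vge 0 x -> red x = 0 <-> (0 < ord x)%E.
Proof. by have [_ _ _ h _] := red_residue S; exact: h. Qed.

Lemma red0 : red 0 = 0.
Proof. by apply/red_eq0; [exact: vge0 | rewrite ord_zero]. Qed.

Lemma red_nat m : red m%:R = m%:R.
Proof.
elim: m => [|m IH]; first exact: red0.
by rewrite -!natr1 redD ?IH ?red1 ?vge_nat ?vge1.
Qed.

Lemma redX x m : vge 0 x -> red (x ^+ m) = red x ^+ m.
Proof.
move=> x0; elim: m => [|m IH]; first by rewrite !expr0 red1.
by rewrite !exprS redM ?IH // vgeX0.
Qed.

(** The residue characteristic divides q, so q^k - 1 reduces to -1. *)
Lemma kbar_qk1 k : (0 < k)%N -> (q ^ k).-1%:R != 0 :> kbar S.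
Proof.
move=> k0; have p0 : (prime_p S)%:R = 0 :> kbar S.
  by rewrite -red_nat; apply/red_eq0; [exact: vge_nat | exact: ord_p_gt0].
have q0 : (q ^ k)%:R = 0 :> kbar S.
  have [a a0 ->] := card_qP S; rewrite -expnM natrX p0 expr0n muln_eq0.
  by rewrite !gtn_eqF.
apply/eqP => h; have := q0; rewrite -(ltn_predK (qk_gt1 k0)) -natr1 h add0r.
by apply/eqP/oner_neq0.
Qed.

Lemma unity_ord x m : (0 < m)%N -> x ^+ m = 1 -> ord x = 0%E.
Proof.
move=> m0 xm; have x0 : x != 0.
  by apply: contra_eq_neq xm => ->; rewrite expr0n gtn_eqF // eq_sym oner_eq0.
have [r ox] := ord_fin x0.
have oX l : ord (x ^+ l) = (r *+ l)%:E.
  by elim: l => [|l IH]; rewrite ?expr0 ?ord1 // exprS ordM IH ox mulrS.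
have := oX m; rewrite xm ord1 => -[] /esym/eqP.
by rewrite mulrn_eq0 gtn_eqF //= ox => /eqP ->.
Qed.

Lemma unity_neq0 (F : fieldType) (x : F) m : (0 < m)%N -> x ^+ m = 1 -> x != 0.
Proof.
by move=> m0 xm; apply: contra_eq_neq xm => ->; rewrite expr0n gtn_eqF // eq_sym oner_eq0.
Qed.

Lemma unity_vge x m : (0 < m)%N -> x ^+ m = 1 -> vge 0 x.
Proof. by move=> m0 /(unity_ord m0) ->. Qed.

Lemma qk1_gt0 k : (0 < k)%N -> (0 < (q ^ k).-1)%N.
Proof. by move=> /qk_gt1; case: (q ^ k)%N => // -[]. Qed.

(** If t = x / y reduces to 1 but differs from 1, then the sum of the t^i for i < m vanishes, while
    it reduces to m = q^k - 1, which is nonzero in the residue field. *)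
Lemma red_unity_inj k x y : (0 < k)%N ->
  x ^+ (q ^ k).-1 = 1 -> y ^+ (q ^ k).-1 = 1 -> red x = red y -> x = y.
Proof.
move=> k0; set m := (q ^ k).-1 => xm ym xy; have m0 := qk1_gt0 k0.
have y0 : y != 0 by apply: unity_neq0 ym.
have tm : (x / y) ^+ m = 1 by rewrite expr_div_n xm ym divr1.
have ht : red (x / y) = 1.
  have ry : red y != 0.
    apply/eqP => /red_eq0; rewrite (unity_vge m0 ym) (unity_ord m0 ym) ltxx.
    by move/(_ isT).
  apply: (mulIf ry); rewrite mul1r -redM ?divfK //; exact: (@unity_vge _ m).
have [/divr1_eq //|t1] := eqVneq (x / y) 1.
have /eqP : (x / y - 1) * \sum_(i < m) (x / y) ^+ i = 0 by rewrite -subrX1 tm subrr.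
rewrite mulf_eq0 subr_eq0 (negbTE t1) /= => /eqP/(congr1 red).
have t0 : vge 0 (x / y) by apply: (@unity_vge _ m).
have -> : red (\sum_(i < m) (x / y) ^+ i) = \sum_(i < m) 1.
  pose P (a : Om) b := vge 0 a /\ red a = b.
  suff [] : P (\sum_(i < m) (x / y) ^+ i) (\sum_(i < m) 1) by [].
  apply: (big_ind2 P) => [|a b c d [a0 <-] [c0 <-]|i _].
  - by split; [exact: vge0 | exact: red0].
  - by split; [exact: vgeD | exact: redD].
  - by split; [exact: vgeX0 | rewrite redX // ht expr1n].
rewrite red0 sumr_const card_ord => h.
by have := kbar_qk1 k0; rewrite -/m h eqxx.
Qed.

(** By injectivity of reduction, a primitive m-th root of unity reduces to a primitive one, whose
    powers are all the m-th roots of unity of the residue field. *)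
Lemma teich_exists k (y : kbar S) : (0 < k)%N -> y ^+ (q ^ k).-1 = 1 ->
  exists2 x : Om, x ^+ (q ^ k).-1 = 1 & red x = y.
Proof.
move=> k0; set m := (q ^ k).-1 => ym; have m0 := qk1_gt0 k0.
have [z hz] := closed_prim_root (@Om_char0 R S) m0.
have zm := prim_expr_order hz; have z0 := unity_vge m0 zm.
have rzm : red z ^+ m = 1 by rewrite -redX // zm red1.
have [m' hm' m'm] := prim_order_exists m0 rzm.
have mm' : m = m'.
  apply/eqP; rewrite eqn_dvd m'm andbT (prim_order_dvd hz); apply/eqP.
  apply: (@red_unity_inj k) => //; rewrite ?expr1n //.
    by rewrite exprAC zm expr1n.
  by rewrite redX // (prim_expr_order hm') red1.
rewrite -mm' in hm'; have [i ->] := prim_rootP hm' ym.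
exists (z ^+ i); last by rewrite redX.
by rewrite exprAC zm expr1n.
Qed.

Lemma frobD (F : fieldType) i j (x : 'rV[F]_n) : frob S i (frob S j x) = frob S (i + j) x.
Proof. by apply/rowP => l; rewrite !mxE -exprM -expnD addnC. Qed.

Lemma frob0 (F : fieldType) (x : 'rV[F]_n) : frob S 0 x = x.
Proof. by apply/rowP => l; rewrite !mxE expn0 expr1. Qed.

Lemma frob_mul (F : fieldType) (x : 'rV[F]_n) d a : frob S d x = x -> frob S (a * d) x = x.
Proof. by move=> h; elim: a => [|a IH]; rewrite ?frob0 // mulSn -frobD IH h. Qed.

Lemma frob_mod (F : fieldType) (x : 'rV[F]_n) d i : frob S d x = x ->
  frob S (i %% d) x = frob S i x.
Proof. by move=> h; rewrite [in RHS](divn_eq i d) addnC -frobD frob_mul. Qed.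

Lemma frob_fix (F : fieldType) (x : 'rV[F]_n) k : (0 < k)%N ->
  (forall i, x 0 i ^+ (q ^ k).-1 = 1) <-> (forall i, x 0 i != 0) /\ frob S k x = x.
Proof.
move=> k0; have e := ltn_predK (qk_gt1 k0); split=> [h|[x0 h] i].
  split=> [i|]; first exact: unity_neq0 (qk1_gt0 k0) (h i).
  by apply/rowP => i; rewrite !mxE -e exprS h mulr1.
apply: (mulfI (x0 i)); rewrite mulr1 -exprS e.
by move/rowP/(_ i): h; rewrite !mxE.
Qed.

Lemma red_frob i (x : 'rV[Om]_n) : (forall l, vge 0 (x 0 l)) ->
  rd (frob S i x) = frob S i (rd x).
Proof. by move=> h; apply/rowP => l; rewrite !mxE redX. Qed.

Definition period d (y : 'rV[kbar S]_n) :=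
  [/\ (0 < d)%N, frob S d y = y & forall e, (0 < e < d)%N -> frob S e y <> y].

Lemma period_dvd d y k : period d y -> frob S k y = y -> (d %| k)%N.
Proof.
move=> [d0 hd hm] hk; rewrite /dvdn; case: posnP => // r0.
by case: (hm (k %% d)%N); [rewrite r0 ltn_pmod | rewrite frob_mod].
Qed.

Lemma period_frob d y i : period d y -> period d (frob S i y).
Proof.
move=> [d0 hd hm]; split=> //; first by rewrite frobD addnC -frobD hd.
move=> e he h; apply: (hm e he).
have back : frob S (i * d.-1) (frob S i y) = y.
  by rewrite frobD addnC -mulnS prednK // frob_mul.
by rewrite -[in RHS]back -h frobD addnC -frobD back.
Qed.

Lemma closed_pointP d P (y : 'rV[kbar S]_n) : closed_point d P -> P y ->
  [/\ forall i, y 0 i != 0, period d y & P = range (fun i => frob S i y)].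
Proof.
move=> [y0 [y00 d0 hd hm ->]] [i _ <-].
have per0 : period d y0 by [].
split; [by move=> l; rewrite mxE expf_neq0 | exact: period_frob |].
apply/seteqP; split=> _ [j _ <-].
  exists (j + i * d.-1)%N => //.
  rewrite frobD -addnA [(_ + i)%N]addnC -mulnS prednK // -frobD frob_mul //.
by exists (j + i)%N => //; rewrite frobD.
Qed.

Lemma period_closed_point d (y : 'rV[kbar S]_n) : (forall i, y 0 i != 0) -> period d y ->
  closed_point d (range (fun i => frob S i y)).
Proof. by move=> y0 [d0 hd hm]; exists y. Qed.

Lemma mu_exists k : (0 < k)%N -> exists s : seq 'rV[Om]_n, [/\ uniq s,
  forall x, x \in s <-> forall i, x 0 i ^+ (q ^ k).-1 = 1 &
  forall a : 'rV[int]_n, \sum_(x <- s) \prod_(i < n) x 0 i ^ a 0 i =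
    if [forall i, ((q ^ k).-1 %| a 0%R i)%Z] then ((q ^ k).-1%:R) ^+ n else 0].
Proof.
move=> k0; set m := (q ^ k).-1; have m0 := qk1_gt0 k0.
have [z hz] := closed_prim_root (@Om_char0 R S) m0.
pose g (f : {ffun 'I_n -> 'I_m}) : 'rV[Om]_n := \row_i z ^+ f i.
have gi : injective g.
  move=> f f' /rowP e; apply/ffunP => i; have := e i; rewrite !mxE => /eqP.
  by rewrite (eq_prim_root_expr hz) !modn_small // => /eqP/val_inj.
exists [seq g f | f <- index_enum {ffun 'I_n -> 'I_m}]; split.
- by rewrite map_inj_uniq // index_enum_uniq.
- move=> x; split=> [/mapP[f _ ->] i|h].
    by rewrite mxE exprAC (prim_expr_order hz) expr1n.
  have /choice[f hf] : forall i, exists j : 'I_m, x 0 i = z ^+ j.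
    by move=> i; have [j ->] := prim_rootP hz (h i); exists j.
  apply/mapP; exists (finfun f); first by rewrite mem_index_enum.
  by apply/rowP => i; rewrite !mxE ffunE hf.
- move=> a; rewrite big_map.
  under eq_bigr => f _.
    under eq_bigr => i _.
      rewrite mxE exprnP exprz_exp mulrC -exprz_exp -exprnP.
      over.
    over.
  rewrite -(bigA_distr_bigA (fun i j => (z ^ a 0 i) ^+ nat_of_ord j)) /=.
  under eq_bigr do rewrite (sum_prim_root _ hz).
  case: forallP => [h|h].
    by under eq_bigr => i _ do rewrite h; rewrite prodr_const card_ord.
  have [i hi] : exists i, ~~ (m %| a 0%R i)%Z.
    by apply/existsP; rewrite -negb_forall; apply/negP => /forallP.
  by rewrite (bigD1 i) //= (negbTE hi) mul0r.
Qed.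

(** The Teichmueller lifts of the points of G_m^n with values in the field of q^k elements, listed
    together with their orthogonality relation. *)
Definition mu k : seq 'rV[Om]_n :=
  xget [::] [set s : seq 'rV[Om]_n | [/\ uniq s,
    forall x, x \in s <-> forall i, x 0 i ^+ (q ^ k).-1 = 1 &
    forall a : 'rV[int]_n, \sum_(x <- s) \prod_(i < n) x 0 i ^ a 0 i =
    if [forall i, ((q ^ k).-1 %| a 0%R i)%Z] then ((q ^ k).-1%:R) ^+ n else 0]].

Lemma muP k : (0 < k)%N -> [/\ uniq (mu k),
  forall x, x \in mu k <-> forall i, x 0 i ^+ (q ^ k).-1 = 1 &
  forall a : 'rV[int]_n, \sum_(x <- mu k) \prod_(i < n) x 0 i ^ a 0 i =
    if [forall i, ((q ^ k).-1 %| a 0%R i)%Z] then ((q ^ k).-1%:R) ^+ n else 0].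
Proof.
by move=> /mu_exists[s hs]; rewrite /mu; case: xgetP => [y _ //|/(_ s)].
Qed.

Lemma mu_vge k x : (0 < k)%N -> x \in mu k -> forall i, vge 0 (x 0 i).
Proof.
move=> k0; have [_ h _] := muP k0 => /h hx i.
exact: unity_vge (qk1_gt0 k0) (hx i).
Qed.

Lemma red_mu k x : (0 < k)%N -> x \in mu k ->
  (forall i, (rd x) 0 i != 0) /\ frob S k (rd x) = rd x.
Proof.
move=> k0 xk; apply/frob_fix => // i; rewrite mxE.
have [_ h _] := muP k0; have /h hx := xk.
by rewrite -redX ?hx ?red1 // (mu_vge k0 xk).
Qed.

Lemma red_mu_inj k x y : (0 < k)%N -> x \in mu k -> y \in mu k -> rd x = rd y -> x = y.
Proof.
move=> k0; have [_ h _] := muP k0 => /h hx /h hy /rowP e; apply/rowP => i.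
by apply: (red_unity_inj k0 (hx i) (hy i)); have := e i; rewrite !mxE.
Qed.

Lemma teich_exists_row k (y : 'rV[kbar S]_n) : (0 < k)%N -> (forall i, y 0 i != 0) -> frob S k y = y ->
  exists2 x, x \in mu k & rd x = y.
Proof.
move=> k0 y0 hy; have h : forall i, y 0 i ^+ (q ^ k).-1 = 1 by apply/frob_fix.
have /choice[f hf] : forall i, exists x : Om, x ^+ (q ^ k).-1 = 1 /\ red x = y 0 i.
  by move=> i; have [x ? ?] := teich_exists k0 (h i); exists x.
exists (\row_i f i); last by apply/rowP => i; rewrite !mxE; case: (hf i).
by have [_ hm _] := muP k0; apply/hm => i; rewrite mxE; case: (hf i).
Qed.

(** [fset_set] is empty on infinite sets, so finiteness is what gives the products of Euler factors
    their meaning. A closed point is the Frobenius orbit of the reduction of an element of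
    [mu d]. *)
Lemma closed_point_finite d : finite_set (@closed_point R S n d).
Proof.
apply: (@sub_finite_set _ _
  ((fun x => range (fun i => frob S i (rd x))) @` [set` mu d])); last first.
  exact/finite_image/finite_seq.
move=> P [y [y0 d0 hd hm ->]].
have [x xd <-] := teich_exists_row d0 y0 hd.
by exists x.
Qed.

(** Literally the representative chosen in [euler_factor]. *)
Definition teich_lift d (P : set 'rV[kbar S]_n) : 'rV[Om]_n :=
  xget 0 [set x | is_teichmuller d P x].

Lemma teich_liftP d P : closed_point d P ->
  [/\ (0 < d)%N, teich_lift d P \in mu d & P (rd (teich_lift d P))].
Proof.
move=> [y [y0 d0 hd hm ->]]; have [_ hmu _] := muP d0.
have [x xd xy] := teich_exists_row d0 y0 hd.
rewrite /teich_lift; case: xgetP => [z _ [hz Pz]|/(_ x)].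
  by split=> //; apply/hmu.
case; split; first exact/hmu.
by exists 0%N => //; rewrite frob0.
Qed.

Lemma frob_mu k x i : (0 < k)%N -> x \in mu k -> frob S i x \in mu k.
Proof.
move=> k0; have [_ h _] := muP k0 => /h hx; apply/h => l.
by rewrite mxE exprAC hx expr1n.
Qed.

Lemma mu_dvd d k x : (0 < d)%N -> (0 < k)%N -> (d %| k)%N -> x \in mu d -> x \in mu k.
Proof.
move=> d0 + /dvdnP[a e]; rewrite {}e => k0; have [_ h _] := muP d0 => /h/(frob_fix _ d0)[x0 hx].
move: k0; rewrite muln_gt0 => /andP[a0 _].
have ad0 : (0 < a * d)%N by rewrite muln_gt0 a0.
have [_ h' _] := muP ad0; apply/h'/frob_fix => //; split=> //.
exact: frob_mul.
Qed.

(** The points of [mu k] over [P] are the [d] Frobenius conjugates of its lift when [d] divides [k];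
    otherwise there are none. *)
Lemma sum_mu_point k d P (F : 'rV[Om]_n -> Om) : (0 < k)%N -> closed_point d P ->
  (forall x, x \in mu k -> F (frob S 1 x) = F x) ->
  \sum_(x <- mu k | `[< P (rd x) >]) F x =
  if (d %| k)%N then d%:R * F (teich_lift d P) else 0.
Proof.
move=> k0 Pd hF; have [d0 xd Px] := teich_liftP Pd.
set x0 := teich_lift d P in xd Px *.
have [uk hk _] := muP k0; have [_ hd _] := muP d0.
have [_ per PE] := closed_pointP Pd Px.
case: ifP => [dk|/negP ndk]; last first.
  rewrite big_seq_cond big_pred0 // => x; apply/negP => /andP[xk /asboolP Pxx].
  have [_ perx _] := closed_pointP Pd Pxx.
  by apply: ndk; apply: period_dvd perx _; case: (red_mu k0 xk).
have x0k : x0 \in mu k by exact: mu_dvd xd.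
have Fi i : F (frob S i x0) = F x0.
  by elim: i => [|i IH]; rewrite ?frob0 // -add1n -frobD hF // frob_mu.
have x0v := mu_vge d0 xd.
have fx0 : frob S d x0 = x0.
  by have /hd/(frob_fix _ d0)[] := xd.
rewrite -big_filter (perm_big [seq frob S i x0 | i <- iota 0 d]); last first.
  apply: uniq_perm; first exact: filter_uniq.
    rewrite map_inj_in_uniq ?iota_uniq // => i j.
    wlog ij : i j / (i <= j)%N.
      move=> h; have [ij|ji] := leqP i j; first exact: h.
      by move=> hi hj /esym e; apply/esym; apply: h e => //; exact: ltnW.
    rewrite !mem_iota !add0n /= => _ jd /(congr1 rd); rewrite !red_frob // => e.
    have : (d %| j - i)%N.
      apply: (@period_dvd _ (frob S i (rd x0))); first exact: period_frob.
      by rewrite frobD subnK.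
    rewrite /dvdn modn_small; last by rewrite (leq_ltn_trans (leq_subr _ _)).
    by rewrite subn_eq0 => ji; apply/eqP; rewrite eqn_leq ij.
  move=> x; rewrite mem_filter; apply/andP/mapP => [[/asboolP Pxx xk]|[i _ ->]].
    move: Pxx; rewrite PE => -[i _ e]; exists (i %% d)%N.
      by rewrite mem_iota add0n ltn_pmod.
    apply: (red_mu_inj k0) => //; first exact: frob_mu.
    by rewrite frob_mod // red_frob.
  split; last exact: frob_mu.
  by apply/asboolP; rewrite PE red_frob //; exists i.
rewrite big_map; under eq_bigr do rewrite Fi.
by rewrite big_const_seq count_predT size_iota iter_addr_0 mulr_natl.
Qed.

(** Each point of [mu k] lies over exactly one closed point, whose degree is the period of its
    reduction; it is at most k, hence at most [M]. The common bound [M] lets one finite product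
    serve all orders up to [M]. *)
Lemma sum_mu_closed_points k M (F : 'rV[Om]_n -> Om) : (0 < k <= M)%N ->
  (forall x, x \in mu k -> F (frob S 1 x) = F x) ->
  \sum_(x <- mu k) F x =
  \sum_(1 <= d < M.+1) \sum_(P <- fset_set (@closed_point R S n d))
    if (d %| k)%N then d%:R * F (teich_lift d P) else 0.
Proof.
move=> /andP[k0 kM] hF.
transitivity (\sum_(1 <= d < M.+1) \sum_(P <- fset_set (@closed_point R S n d))
    \sum_(x <- mu k | `[< P (rd x) >]) F x); last first.
  apply: eq_bigr => d _; rewrite !big_seq; apply: eq_bigr => P.
  rewrite in_fset_set; last exact: closed_point_finite.
  by rewrite inE => Pd; exact: sum_mu_point.
transitivity (\sum_(1 <= d < M.+1) \sum_(x <- mu k)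
    \sum_(P <- fset_set (@closed_point R S n d)) if `[< P (rd x) >] then F x else 0);
  last first.
  apply: eq_bigr => d _; rewrite exchange_big /=; apply: eq_bigr => P _.
  by rewrite [RHS]big_mkcond.
rewrite exchange_big /= !big_seq; apply: eq_bigr => x xk.
have [y0 yk] := red_mu k0 xk; set y := rd x in y0 yk *.
have /ex_minnP[d /andP[d0 /eqP yd] dmin] : exists d, (0 < d)%N && (frob S d y == y).
  by exists k; rewrite k0 yk eqxx.
have per : period d y.
  split=> // e /andP[e0 ed] he; have := dmin e; rewrite e0 he eqxx leqNgt ed.
  by move/(_ isT).
have dM : (d < M.+1)%N by rewrite ltnS (leq_trans _ kM) // dmin // k0 yk eqxx.
have dd e P : closed_point e P -> P y -> e = d.
  move=> Pe Py; have [_ pere _] := closed_pointP Pe Py.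
  apply/eqP; rewrite eqn_dvd (period_dvd pere yd) (period_dvd per) //.
  by case: pere.
pose P0 := range (fun i => frob S i y).
have P0d : closed_point d P0 by exact: period_closed_point.
have P0y : P0 y by exists 0%N => //; rewrite frob0.
have mem e P : P \in fset_set (@closed_point R S n e) -> closed_point e P.
  by rewrite in_fset_set ?inE //; exact: closed_point_finite.
rewrite (bigD1_seq d) ?mem_index_iota ?d0 ?iota_uniq //= [X in _ + X]big1_seq ?addr0; last first.
  move=> e /andP[ed _]; rewrite big1_seq // => P /andP[_ /mem Pe].
  by case: asboolP => // Py; rewrite (dd e P Pe Py) eqxx in ed.
have P0m : P0 \in fset_set (@closed_point R S n d).
  by rewrite in_fset_set ?inE //; exact: closed_point_finite.
rewrite (bigD1_seq P0) ?fset_uniq //= asboolT // big1_seq ?addr0 //.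
move=> P /andP[PP0 /mem Pd]; case: asboolP => // Py.
by have [_ _ PE] := closed_pointP Pd Py; rewrite PE eqxx in PP0.
Qed.

End ClosedPoints.

(** * The trace formula for truncated matrices *)

Section TraceFormula.
Variables (R : realType) (S : padic_setting R) (n : nat).
Notation Om := (Om S).
Notation ord := (@ord R S).
Notation q := (card_q S).
Notation vge C x := ((C%:E <= ord x%R)%E).
Notation Zn := 'rV[int]_n.

Lemma usizeD (u v : Zn) : (usize (u + v) <= usize u + usize v)%N.
Proof.
rewrite /usize -big_split /=; apply: leq_sum => i _; rewrite mxE.
by move: (u _ _) (v _ _) => a b; lia.
Qed.

Lemma usizeZ (a : int) (u : Zn) : usize (a *: u) = (`|a| * usize u)%N.
Proof. by rewrite /usize big_distrr /=; apply: eq_bigr => i _; rewrite mxE abszM. Qed.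

Lemma usize0 : usize (0 : Zn) = 0%N.
Proof. by rewrite /usize big1 // => i _; rewrite mxE. Qed.

Lemma usize_coord (u : Zn) i : (`|u 0%R i| <= usize u)%N.
Proof. by rewrite /usize (bigD1 i) //= leq_addr. Qed.

Lemma ball_finite N : finite_set [set u : Zn | (usize u <= N)%N].
Proof.
pose g (f : {ffun 'I_n -> 'I_(N + N).+1}) : Zn := \row_i ((f i)%:Z - N%:Z).
apply: (@sub_finite_set _ _ (g @` setT)); last exact/finite_image/finite_finset.
move=> u /= uN; exists [ffun i => inord `|(u 0 i + N%:Z)%R|%N] => //.
apply/rowP => i; rewrite mxE ffunE inordK; last first.
  by have := leq_trans (usize_coord u i) uN; lia.
by have := leq_trans (usize_coord u i) uN; lia.
Qed.

Definition ball N : {fset Zn} := fset_set [set u : Zn | (usize u <= N)%N].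

Lemma in_ball N u : (u \in ball N) = (usize u <= N)%N.
Proof. by rewrite in_fset_set ?inE //; [apply/asboolP/idP | exact: ball_finite]. Qed.

Definition mono_at (F : fieldType) (x : 'rV[F]_n) (u : Zn) : F := \prod_(i < n) x 0 i ^ u 0 i.

Lemma mono_atD (F : fieldType) (x : 'rV[F]_n) u v : (forall i, x 0 i != 0) ->
  mono_at x (u + v) = mono_at x u * mono_at x v.
Proof.
by move=> x0; rewrite -big_split; apply: eq_bigr => i _; rewrite mxE expfzDr.
Qed.

Lemma mono_at0 (F : fieldType) (x : 'rV[F]_n) : mono_at x 0 = 1.
Proof. by rewrite /mono_at big1 // => i _; rewrite mxE expr0z. Qed.

Lemma mono_at_frob (F : fieldType) (x : 'rV[F]_n) u :
  mono_at (frob S 1 x) u = mono_at x (q%:Z *: u).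
Proof.
by apply: eq_bigr => i _; rewrite !mxE expn1 exprnP exprz_exp.
Qed.

Variables (J : choiceType) (X : {fset J}) (N : nat) (b : J -> J -> Zn -> Om).
Notation V := (ball N).

(** A word a_0, ..., a_(k-1) of exponents indexes one term in the expansion of B(x) ...
    B(x^(q^(k-1))): [walpha] is its exponent a_0 + q a_1 + ... and [wmat] its coefficient, a product
    of the matrices B_(a_l). *)
Fixpoint words k : finType := if k is k'.+1 then ({: V} * words k')%type else unit.

Fixpoint walpha k : words k -> Zn :=
  if k is k'.+1 then fun t => val t.1 + q%:Z *: walpha t.2 else fun=> 0.

Fixpoint wmat k : words k -> J -> J -> Om :=
  if k is k'.+1 then fun t i j => \sum_(l <- X) b i l (val t.1) * wmat t.2 l j
  else fun _ i j => (i == j)%:R.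

Definition trunc_eval (y : 'rV[Om]_n) i j : Om := \sum_(u <- V) b i j u * mono_at y u.

Fixpoint trunc_fiber k (x : 'rV[Om]_n) : J -> J -> Om :=
  if k is k'.+1 then
    fun i j => \sum_(l <- X) trunc_eval x i l * trunc_fiber k' (frob S 1 x) l j
  else fun i j => (i == j)%:R.

Lemma trunc_fiberE k (x : 'rV[Om]_n) i j : (forall l, x 0 l != 0) ->
  trunc_fiber k x i j = \sum_(t : words k) mono_at x (walpha t) * wmat t i j.
Proof.
elim: k x i j => [|k IH] x i j x0 /=.
  by rewrite (big_pred1 tt) ?mono_at0 ?mul1r // => -[].
transitivity (\sum_(l <- X) \sum_(a : V) \sum_(t : words k)
   (b i l (val a) * mono_at x (val a)) * (mono_at (frob S 1 x) (walpha t) * wmat t l j)).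
  apply: eq_bigr => l _; rewrite IH => [|s]; last by rewrite mxE expf_neq0.
  rewrite /trunc_eval big_seq_fsetE /= mulr_suml; apply: eq_bigr => a _.
  by rewrite mulr_sumr.
rewrite exchange_big /=; under eq_bigr do rewrite exchange_big /=.
rewrite pair_bigA /=; apply: eq_bigr => -[a t] _ /=.
rewrite mulr_sumr; apply: eq_bigr => l _.
by rewrite mono_at_frob mono_atD //; ring.
Qed.

Definition dwork_trunc (y z : Zn * J) : Om :=
  let u := q%:Z *: z.1 - y.1 in if u \in V then b y.2 z.2 u else 0.

Definition box : {fset Zn * J} := [fset ((u, i) : Zn * J) | u in V, i in X]%fset.

Lemma big_box (F : Zn * J -> Om) :
  \sum_(z <- box) F z = \sum_(u <- V) \sum_(i <- X) F (u, i).
Proof.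
rewrite -big_allpairs /=; apply: perm_big; apply: uniq_perm.
- exact: fset_uniq.
- by apply: allpairs_uniq; [exact: fset_uniq | exact: fset_uniq | move=> [? ?] [? ?]].
- move=> [u i]; apply/imfset2P/allpairsP => [[u' hu' [i' hi' [-> ->]]]|[[u' i'] /= [h1 h2 [-> ->]]]].
    by exists (u', i').
  by exists u' => //; exists i'.
Qed.

Lemma in_box z : (z \in box) = (z.1 \in V) && (z.2 \in X).
Proof.
apply/imfset2P/andP => [[u hu [i hi ->]]|[h1 h2]]; first by split.
by exists z.1 => //; exists z.2 => //; case: z h1 h2.
Qed.

Fixpoint dwork_pow k : Zn * J -> Zn * J -> Om :=
  if k is k'.+1 then fun y z => \sum_(w <- box) dwork_trunc y w * dwork_pow k' w z
  else fun y z => (y == z)%:R.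

(** A path u = v_0, ..., v_k = w uses the exponents a_l = q v_(l+1) - v_l, and the sum of the q^l
    a_l telescopes to q^k w - u. Conversely the word and the endpoints determine the intermediate
    vertices. *)
Lemma dwork_powE k y z : y.1 \in V ->
  dwork_pow k y z =
  \sum_(t : words k | walpha t == (q ^ k)%N%:Z *: z.1 - y.1) wmat t y.2 z.2.
Proof.
elim: k y z => [|k IH] [u i] [w j] uV /=.
  rewrite expn0 scale1r; case: (eqVneq u w) => [->|uw].
    by rewrite subrr (big_pred1 tt) ?xpair_eqE ?eqxx // => -[]; rewrite /= eqxx.
  rewrite xpair_eqE (negbTE uw) big_pred0 // => t.
  by rewrite eq_sym subr_eq0 eq_sym (negbTE uw).
pose c (a : Zn) (t : words k) := \sum_(l <- X) b i l a * wmat t l j.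
rewrite big_box.
transitivity (\sum_(v <- V) \sum_(a : V) \sum_(t : words k)
   if (val a == q%:Z *: v - u) && (walpha t == (q ^ k)%N%:Z *: w - v)
   then c (val a) t else 0).
  rewrite !big_seq; apply: eq_bigr => v vV.
  transitivity (\sum_(l <- X) \sum_(a : V) \sum_(t : words k)
     if (val a == q%:Z *: v - u) && (walpha t == (q ^ k)%N%:Z *: w - v)
     then b i l (val a) * wmat t l j else 0).
    apply: eq_bigr => l _; rewrite IH // /dwork_trunc /=.
    case: ifP => [aV|aV]; last first.
      rewrite mul0r big1 // => a _; rewrite big1 // => t _.
      by case: eqP => //= e; rewrite -e (valP a) in aV.
    rewrite [RHS](bigD1 [` aV]%fset) //= [X in _ = _ + X]big1 ?addr0 => [|a na]; last first.
      rewrite big1 // => t _; case: eqP => //= e.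
      by case/eqP: na; apply/val_inj.
    rewrite eqxx /= big_mkcond mulr_sumr; apply: eq_bigr => t _.
    by case: ifP; rewrite ?mulr0.
  rewrite exchange_big /=; apply: eq_bigr => a _; rewrite exchange_big /=.
  apply: eq_bigr => t _; case: ifP => _; first by [].
  by rewrite big1.
rewrite exchange_big /=; under eq_bigr do rewrite exchange_big /=.
rewrite pair_bigA /= [RHS]big_mkcond /=; apply: eq_bigr => -[a t] _ /=.
pose v0 := (q ^ k)%N%:Z *: w - walpha t.
have e v : (walpha t == (q ^ k)%N%:Z *: w - v) = (v == v0).
  by rewrite /v0 -subr_eq0 -[RHS]subr_eq0 opprB addrA [walpha t + v]addrC opprB addrA.
have e0 : (val a == q%:Z *: v0 - u) =
  (val a + q%:Z *: walpha t == (q ^ k.+1)%N%:Z *: w - u).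
  rewrite /v0 scalerBr scalerA -PoszM -expnS -[LHS]subr_eq0 -[RHS]subr_eq0.
  by congr (_ == 0); rewrite !opprB !addrA; congr (_ - _); rewrite addrAC.
under eq_bigr do rewrite e.
have [h|h] := boolP (val a + _ == _); last first.
  rewrite big1_seq // => v _; case: (eqVneq v v0) => [->|_]; last by rewrite andbF.
  by rewrite e0 (negbTE h).
(* The truncation is exact here: q v0 = a + u with |a| and |u| at most N gives |v0| <= 2 N / q <= N,
   so no path leaves the box. *)
have hv0 : v0 \in V.
  have q0 : (0 < q)%N by exact: ltnW (q_gt1 S).
  have : q%:Z *: v0 = val a + u by move: h; rewrite -e0 => /eqP ->; rewrite subrK.
  move/(congr1 (@usize n)); rewrite usizeZ absz_nat => hq.
  have := usizeD (val a) u; rewrite -hq.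
  have := valP a; rewrite /= in_ball; move: uV; rewrite !in_ball /=.
  have := q_gt1 S; nia.
rewrite (bigD1_seq v0) ?fset_uniq //= e0 h eqxx /= big1 ?addr0 // => v /negbTE ->.
by rewrite andbF.
Qed.

(** If the exponent of a word is (q^k - 1) u, this bound puts u in the ball of radius N. *)
Lemma usize_walpha k (t : words k) : (usize (walpha t) <= N * (q ^ k).-1)%N.
Proof.
elim: k t => [|k IH] t /=; first by rewrite usize0.
apply: leq_trans (usizeD _ _) _; rewrite usizeZ absz_nat.
have h1 := IH t.2; have := valP t.1; rewrite /= in_ball => h2.
have := q_gt1 S; have : (0 < q ^ k)%N by rewrite expn_gt0 ltnW ?q_gt1.
rewrite expnS; move: (q ^ k)%N h1 => Q h1 Q0 q1.
have -> : (q * Q).-1 = (q * Q.-1 + q.-1)%N by nia.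
rewrite mulnDr addnC leq_add //; first by rewrite mulnCA leq_mul2l h1 orbT.
by apply: leq_trans h2 _; rewrite leq_pmulr // -subn1 subn_gt0.
Qed.

(** Summation over [mu k] retains the words whose exponent is divisible by q^k - 1, and the quotient
    is the unique diagonal position u at which such a word contributes to the trace. *)
Lemma dwork_trace k : (0 < k)%N ->
  \sum_(x <- mu S n k) \sum_(i <- X) trunc_fiber k x i i =
  ((q ^ k).-1%:R) ^+ n * \sum_(z <- box) dwork_pow k z z.
Proof.
move=> k0; set m := (q ^ k).-1; have [_ hmu hsum] := muP S n k0.
pose wtr (t : words k) := \sum_(i <- X) wmat t i i.
have -> : \sum_(x <- mu S n k) \sum_(i <- X) trunc_fiber k x i i =
  \sum_(t : words k) (\sum_(x <- mu S n k) mono_at x (walpha t)) * wtr t.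
  under [RHS]eq_bigr do rewrite mulr_suml.
  rewrite [RHS]exchange_big /= !big_seq; apply: eq_bigr => x xk.
  have x0 : forall l, x 0 l != 0.
    by have /hmu/(frob_fix S _ k0)[] := xk.
  under [RHS]eq_bigr do rewrite mulr_sumr.
  rewrite exchange_big /=; apply: eq_bigr => i _.
  by rewrite trunc_fiberE.
have -> : \sum_(z <- box) dwork_pow k z z =
  \sum_(t : words k) (\sum_(u <- V) (walpha t == m%:Z *: u)%:R) * wtr t.
  under [RHS]eq_bigr do rewrite mulr_suml.
  rewrite [RHS]exchange_big /= big_box !big_seq; apply: eq_bigr => u uV.
  under [RHS]eq_bigr do rewrite mulr_sumr.
  rewrite exchange_big /=; apply: eq_bigr => i _.
  rewrite dwork_powE //= big_mkcond; apply: eq_bigr => t _.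
  have -> : (q ^ k)%N%:Z *: u - u = m%:Z *: u.
    rewrite -{2}[u]scale1r -scalerBl; congr (_ *: _).
    by rewrite /m; have := qk_gt1 S k0; lia.
  by case: eqP; rewrite ?mul1r ?mul0r.
rewrite mulr_sumr; apply: eq_bigr => t _; rewrite hsum mulrA; congr (_ * _).
have m0 : (0 < m)%N by exact: qk1_gt0.
have mi : injective (fun u : Zn => m%:Z *: u).
  move=> u v /rowP e; apply/rowP => i; have := e i; rewrite !mxE => /mulfI; apply.
  by rewrite -lt0n in m0 *.
case: forallP => [h|h].
  pose u0 : Zn := \row_i (walpha t 0%R i %/ m%:Z)%Z.
  have e0 : walpha t = m%:Z *: u0.
    by apply/rowP => i; rewrite !mxE mulrC divzK.
  have u0V : u0 \in V.
    by rewrite in_ball -(leq_pmul2l m0) -[X in (X * _)%N]absz_nat -usizeZ -e0 mulnC usize_walpha.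
  rewrite (bigD1_seq u0) ?fset_uniq //= e0 eqxx big1 ?addr0 ?mulr1 // => u uu0.
  by rewrite (inj_eq mi) eq_sym (negbTE uu0).
rewrite big1 ?mulr0 // => u _; case: eqP => // e; case: h => i.
by rewrite e mxE dvdz_mulr.
Qed.

End TraceFormula.

(** The exponents, with multiplicity, of the positive and of the negative terms of (z - 1)^n.
    Multiplication by z - 1 shifts both lists and exchanges unshifted copies. Evaluation at z = q^k
    turns the factor (q^k - 1)^n of the trace formula into dilations by q^i. *)
Fixpoint dwork_exps n : seq nat * seq nat :=
  if n is n'.+1 then
    let: (r, s) := dwork_exps n' in (map succn r ++ s, map succn s ++ r)
  else ([:: 0%N], [::]).

Lemma dwork_exps_sum (F : comPzRingType) (z : F) n :
  \sum_(i <- (dwork_exps n).1) z ^+ i - \sum_(i <- (dwork_exps n).2) z ^+ i = (z - 1) ^+ n.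
Proof.
elim: n => [|n IH] /=; first by rewrite big_seq1 big_nil subr0 !expr0.
case: (dwork_exps n) IH => r s /= IH; rewrite !big_cat !big_map /= exprS -IH.
under eq_bigr do rewrite exprS; rewrite -mulr_sumr.
under [X in _ - (X + _)]eq_bigr do rewrite exprS; rewrite -mulr_sumr.
by ring.
Qed.

(** * Truncated L-functions as quotients of determinants *)

Section TruncatedL.
Variables (R : realType) (S : padic_setting R) (n : nat).
Notation Om := (Om S).
Notation ord := (@ord R S).
Notation q := (card_q S).
Notation vge C x := ((C%:E <= ord x%R)%E).
Notation Zn := 'rV[int]_n.

Section Fsub.
Variables (J : choiceType) (X : {fset J}).
Implicit Types A : J -> J -> Om.

Lemma fsub_mul A A' :
  fsub (fun i j => \sum_(l <- X) A i l * A' l j) X = fsub A X *m fsub A' X.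
Proof.
by apply/matrixP => a b; rewrite !mxE big_fval; apply: eq_bigr => l _; rewrite !mxE.
Qed.

Lemma fsub_one : fsub (fun i j => (i == j)%:R : Om) X = 1%:M.
Proof. by apply/matrixP => a b; rewrite !mxE (inj_eq (@fval_inj _ _)). Qed.

Lemma tr_fsub A : \tr (fsub A X) = \sum_(i <- X) A i i.
Proof. by rewrite big_fval; apply: eq_bigr => a _; rewrite mxE. Qed.

End Fsub.

Definition dwork_prod (r : seq nat) (D : nat -> Om) : nat -> Om :=
  \big[@ps_mul Om/@ps_one Om]_(i <- r) ps_dil (q%:R ^+ i) D.

Lemma logd_dwork_prod r D s : logd D s ->
  logd (dwork_prod r D) (fun k => (\sum_(i <- r) (q ^ k)%:R ^+ i) * s k).
Proof.
move=> h; have := @logd_big Om nat r (fun i => ps_dil (q%:R ^+ i) D)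
  (fun i => ps_dil (q%:R ^+ i) s) (fun i _ => logd_dil _ h).
apply: eq_logd => k; rewrite mulr_suml; apply: eq_bigr => i _.
by rewrite /ps_dil exprAC natrX.
Qed.

Variables (J : choiceType) (X : {fset J}) (N : nat) (b : J -> J -> Zn -> Om).

Definition trunc_fiber_mx k x := fsub (trunc_fiber X N b k x) X.
Notation tf := trunc_fiber_mx.

Lemma trunc_fiber_mxS k x : tf k.+1 x = fsub (trunc_eval N b x) X *m tf k (frob S 1 x).
Proof. by rewrite -fsub_mul. Qed.

Lemma trunc_fiber_mxD k l x : tf (k + l) x = tf k x *m tf l (frob S k x).
Proof.
elim: k x => [|k IH] x; first by rewrite {2}/tf fsub_one mul1mx frob0.
by rewrite addSn !trunc_fiber_mxS IH mulmxA frobD addn1.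
Qed.

Lemma trunc_fiber_mxX d e x : frob S d x = x -> tf (e * d) x = tf d x ^+ e.
Proof.
move=> h; elim: e => [|e IH]; first by rewrite mul0n expr0 /tf fsub_one.
by rewrite mulSn trunc_fiber_mxD h IH exprS.
Qed.

(** The Frobenius invariance required by [sum_mu_closed_points]: the product is cyclically rotated,
    the wrapped factor being taken at x^(q^k) = x. *)
Lemma tr_trunc_fiber_mx k x : frob S k x = x -> \tr (tf k (frob S 1 x)) = \tr (tf k x).
Proof.
case: k => [|k] h; first by rewrite /tf !fsub_one.
rewrite -{1}addn1 trunc_fiber_mxD frobD addn1 h trunc_fiber_mxS.
by rewrite [tf 0 _]fsub_one mulmx1 [in RHS]trunc_fiber_mxS mxtrace_mulC.
Qed.

Lemma dwork_powX k :
  fsub (dwork_pow X N b k) (box n X N) = fsub (dwork_trunc N b) (box n X N) ^+ k.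
Proof.
elim: k => [|k IH]; first by rewrite expr0 fsub_one.
rewrite exprS -IH; exact: fsub_mul.
Qed.

Definition trunc_euler d (P : set 'rV[kbar S]_n) : nat -> Om :=
  ps_inv (ps_subst_exp d (fun m => (cdet (tf d (teich_lift d P)))`_m)).

Definition trunc_L M : nat -> Om :=
  \big[@ps_mul Om/@ps_one Om]_(1 <= d < M.+1)
    \big[@ps_mul Om/@ps_one Om]_(P <- fset_set (@closed_point R S n d)) trunc_euler d P.

(** At a point of degree d dividing k the fibre product of length k is the (k / d)-th power of the
    one of length d, and the substitution of T^d produces the factor d that counts its
    conjugates. *)
Lemma logd_trunc_L M : exists2 s, logd (trunc_L M) s &
  forall k, (0 < k <= M)%N -> s k = - \sum_(x <- mu S n k) \tr (tf k x).
Proof.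
pose s0 d P k := - (d%:R * ps_subst_exp d
   (fun k => if k is 0 then 0 else \tr (tf d (teich_lift d P) ^+ k)) k) : Om.
exists (fun k => \sum_(1 <= d < M.+1)
    \sum_(P <- fset_set (@closed_point R S n d)) s0 d P k).
  apply: logd_big => d; rewrite mem_index_iota => /andP[d0 _].
  apply: logd_big => P _; apply: logd_inv; apply: logd_subst => //.
  exact: logd_cdet.
move=> k kM; have /andP[k0 _] := kM.
rewrite (sum_mu_closed_points kM) => [|x xk]; last first.
  apply: tr_trunc_fiber_mx; have [_ h _] := muP S n k0.
  by have /h/(frob_fix S _ k0)[] := xk.
rewrite big_nat [in RHS]big_nat -sumrN; apply: eq_bigr => d /andP[d0 _].
rewrite -sumrN !big_seq; apply: eq_bigr => P.
rewrite in_fset_set ?inE; last exact: closed_point_finite.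
move=> /teich_liftP[_ xd _]; rewrite /s0 /ps_subst_exp.
case: ifP => dk; last by rewrite mulr0.
have [_ h _] := muP S n d0; have /h/(frob_fix S _ d0)[_ fx] := xd.
have e : (k %/ d * d = k)%N by rewrite divnK.
rewrite -[in RHS]e trunc_fiber_mxX //.
by case: (k %/ d)%N e => // e; rewrite -e mul0n in k0.
Qed.

(** The logarithmic derivatives agree because the two lists of exponents differ by (q^k - 1)^n, the
    factor in [dwork_trace]. *)
Lemma trunc_identity M k : (k <= M)%N ->
  let D m := (cdet (fsub (dwork_trunc N b) (box n X N)))`_m in
  ps_mul (trunc_L M) (dwork_prod (dwork_exps n).1 D) k = dwork_prod (dwork_exps n).2 D k.
Proof.
move=> kM D; have [s hs sE] := logd_trunc_L M.
have hD := logd_cdet (fsub (dwork_trunc N b) (box n X N)); rewrite -/D in hD.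
have h1 := logdM hs (logd_dwork_prod (dwork_exps n).1 hD).
have h2 := logd_dwork_prod (dwork_exps n).2 hD.
apply: (logd_uniq (M := k) (@Om_char0 R S) h1 h2) => // -[|l] lk.
  rewrite !mulr0 addr0; case: hs => L0 /(_ 0%N).
  rewrite mul0r ps_mul_at0 L0 mulr1 => /esym/eqP.
  by rewrite oppr_eq0 => /eqP.
rewrite sE ?(leq_trans lk) //; apply/eqP; rewrite addrC subr_eq addrC -subr_eq -mulrBl.
apply/eqP; rewrite dwork_exps_sum.
under eq_bigr do rewrite tr_fsub.
rewrite dwork_trace // -dwork_powX tr_fsub; congr (_ ^+ _ * _).
by rewrite -[in LHS](ltn_predK (qk_gt1 S (ltn0Sn l))) -natr1 addrK.
Qed.

End TruncatedL.

(** * Integral power series and their congruences *)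

Section Approximation.
Variables (R : realType) (S : padic_setting R) (n : nat).
Notation Om := (Om S).
Notation ord := (@ord R S).
Notation K := (Kfield S).
Notation q := (card_q S).
Notation vge C x := ((C%:E <= ord x%R)%E).
Notation Zn := 'rV[int]_n.
Implicit Types f g : nat -> Om.

Definition ps_int f := forall m, vge 0 (f m).
Definition ps_cg (C : R) f g := forall m, vge C (f m - g m).

Lemma ps_int_one : ps_int (@ps_one Om).
Proof. by move=> m; exact: vge_nat. Qed.

Lemma ps_intM f g : ps_int f -> ps_int g -> ps_int (ps_mul f g).
Proof. by move=> hf hg m; apply: vge_sum => i _; apply: vgeMl. Qed.

Lemma ps_cgM C f f' g g' : ps_int f -> ps_int g' -> ps_cg C f f' -> ps_cg C g g' ->
  ps_cg C (ps_mul f g) (ps_mul f' g').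
Proof. by move=> hf hg h h' m; apply: cg_sum => i _; apply: cgM. Qed.

Lemma ps_int_inv f : f 0%N = 1 -> ps_int f -> ps_int (ps_inv f).
Proof.
move=> f0 hf m; elim/ltn_ind: m => -[|m] IH.
  by rewrite ps_inv_at0 //; exact: vge1.
rewrite ps_invS //; apply/vgeN/vge_sum => i _; apply: vgeMl => //.
by apply: IH; rewrite ltnS leq_subr.
Qed.

Lemma ps_cg_inv C f g : f 0%N = 1 -> g 0%N = 1 -> ps_int f -> ps_int g ->
  ps_cg C f g -> ps_cg C (ps_inv f) (ps_inv g).
Proof.
move=> f0 g0 hf hg h m; elim/ltn_ind: m => -[|m] IH.
  by rewrite !ps_inv_at0 // subrr vge0.
rewrite !ps_invS // -opprD; apply: vgeN; apply: cg_sum => i _.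
apply: cgM => //; first exact: ps_int_inv.
by apply: IH; rewrite ltnS leq_subr.
Qed.

Lemma ps_int_subst d f : ps_int f -> ps_int (ps_subst_exp d f).
Proof. by move=> h m; rewrite /ps_subst_exp; case: ifP => // _; exact: vge0. Qed.

Lemma ps_cg_subst C d f g : ps_cg C f g -> ps_cg C (ps_subst_exp d f) (ps_subst_exp d g).
Proof.
by move=> h m; rewrite /ps_subst_exp; case: ifP => // _; rewrite subrr vge0.
Qed.

Lemma ps_int_big (I : eqType) (r : seq I) (f : I -> nat -> Om) :
  (forall i, i \in r -> ps_int (f i)) ->
  ps_int (\big[@ps_mul Om/@ps_one Om]_(i <- r) f i).
Proof.
move=> h; rewrite big_seq; apply: (big_ind ps_int) => //; first exact: ps_int_one.
exact: ps_intM.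
Qed.

Lemma ps_cg_big C (I : eqType) (r : seq I) (f g : I -> nat -> Om) :
  (forall i, i \in r -> ps_int (f i)) -> (forall i, i \in r -> ps_int (g i)) ->
  (forall i, i \in r -> ps_cg C (f i) (g i)) ->
  ps_cg C (\big[@ps_mul Om/@ps_one Om]_(i <- r) f i)
          (\big[@ps_mul Om/@ps_one Om]_(i <- r) g i).
Proof.
elim: r => [|i r IH] hf hg h m; first by rewrite !big_nil subrr vge0.
have tl j : j \in r -> j \in i :: r by rewrite in_cons => ->; rewrite orbT.
rewrite !big_cons; apply: ps_cgM; first by apply: hf; rewrite mem_head.
- by apply: ps_int_big => j /tl/hg.
- by apply: h; rewrite mem_head.
- by apply: IH => j /tl; [exact: hf | exact: hg | exact: h].
Qed.

Lemma ps_int_dwork_prod r f : ps_int f -> ps_int (dwork_prod r f).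
Proof.
move=> h; apply: ps_int_big => i _ m; apply: vgeMl => //.
by apply/vgeX0/vgeX0/vge_nat.
Qed.

Lemma ps_cg_dwork_prod C r f g : ps_int f -> ps_int g -> ps_cg C f g ->
  ps_cg C (dwork_prod r f) (dwork_prod r g).
Proof.
move=> hf hg h; have h0 i m : vge 0 ((q%:R ^+ i) ^+ m : Om) by apply/vgeX0/vgeX0/vge_nat.
apply: ps_cg_big => i _ m; [exact: vgeMl | exact: vgeMl |].
by rewrite /ps_dil -mulrBr; apply: vgeMl.
Qed.

(** The series 1 + O(T^M). Euler factors of degree M are of this form, which makes the degree bound
    in [L_function] immaterial once it is large enough. *)
Definition one_below M f := f 0%N = 1 /\ forall j, (0 < j < M)%N -> f j = 0.

Lemma one_below_one M : one_below M (@ps_one Om).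
Proof. by split=> // -[]. Qed.

Lemma ps_mul_one_below M f g j : one_below M g -> (j < M)%N -> ps_mul f g j = f j.
Proof.
move=> [g0 hg] jM; rewrite /ps_mul big_ord_recr /= subnn g0 mulr1 big1 ?add0r // => i _.
by rewrite hg ?mulr0 // subn_gt0 ltn_ord (leq_ltn_trans (leq_subr _ _)).
Qed.

Lemma one_belowM M f g : one_below M f -> one_below M g -> one_below M (ps_mul f g).
Proof.
move=> hf hg; split; first by rewrite ps_mul_at0 hf.1 hg.1 mulr1.
by move=> j jM; have /andP[_ ?] := jM; rewrite (ps_mul_one_below _ hg) // hf.2.
Qed.

Lemma one_below_inv M f : one_below M f -> one_below M (ps_inv f).
Proof.
move=> [f0 hf]; split; first exact: ps_inv_at0.
move=> j; elim/ltn_ind: j => -[|j] IH // /andP[_ jM].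
rewrite ps_invS // big1 ?oppr0 // => i _.
by rewrite hf ?mul0r //= (leq_trans _ jM) // !ltnS -ltnS.
Qed.

Lemma one_below_subst d f : f 0%N = 1 -> one_below d (ps_subst_exp d f).
Proof.
move=> f0; split; first by rewrite /ps_subst_exp dvdn0 div0n.
move=> j /andP[j0 jd]; rewrite /ps_subst_exp; case: ifP => // /(dvdn_leq j0).
by rewrite leqNgt jd.
Qed.

End Approximation.

(** * L-functions of nuclear matrices *)

Section DworkL.
Variables (R : realType) (S : padic_setting R) (n : nat) (J : choiceType).
Notation Om := (Om S).
Notation ord := (@ord R S).
Notation K := (Kfield S).
Notation q := (card_q S).
Notation vge C x := ((C%:E <= ord x%R)%E).
Notation Zn := 'rV[int]_n.

Definition dwork_mx (B : J -> J -> lser S n) (y z : Zn * J) : Om :=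
  B y.2 z.2 (q%:Z *: z.1 - y.1).

Definition decay (C : R) (N : nat) (B : J -> J -> lser S n) :=
  forall u, (N < usize u)%N -> forall i j, vge C (B i j u).

Definition col_decay (C : R) (X : {fset J}) (B : J -> J -> lser S n) :=
  forall j, j \notin X -> forall i u, vge C (B i j u).

Definition nuclear_matrix (B : J -> J -> lser S n) :=
  [/\ forall i j u, vge 0 (B i j u), forall C, exists N, decay C N B
    & forall C, exists X, col_decay C X B].

Lemma mono_at_vge k x u : (0 < k)%N -> x \in mu S n k -> vge 0 (mono_at x u).
Proof.
move=> k0; have [_ h _] := muP S n k0 => /h hx; apply: vge_prod0 => i _.
apply: (unity_vge (m := (q ^ k).-1)); first exact: qk1_gt0.
by rewrite exprnP exprz_exp mulrC -exprz_exp -exprnP hx exp1rz.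
Qed.

Section Minors.
Variable B : J -> J -> lser S n.
Hypothesis B0 : forall i j u, vge 0 (B i j u).

(** A column with index outside [X] is small by itself. Otherwise take in [Y] the column with the
    largest |v|, which exceeds N: every row u of the minor has |u| <= |v|, so |q v - u| >= (q - 1)
    |v| > N and the whole column is small within the minor. *)
Lemma dwork_minor_out C X N Y : col_decay C X B -> decay C N B ->
  ~~ (Y `<=` box n X N)%fset -> vge C (principal_minor (dwork_mx B) Y).
Proof.
move=> hX hN /fsubsetPn[z zY]; rewrite in_box negb_and => /orP[zV|zX]; last first.
  by apply: (@vge_minor_col _ _ _ _ Y z) => [y w||y _]; [exact: B0 | | exact: hX].
pose z0 := [` zY]%fset.
have [z' _ zmax] := @arg_maxnP {: Y} z0 predT (fun w => usize (val w).1) isT.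
apply: (@vge_minor_col _ _ _ _ Y (val z')) => [y w||y yY]; [exact: B0 | exact: valP |].
 apply: hN.
have h1 : (usize y.1 <= usize (val z').1)%N := zmax [` yY]%fset isT.
have h2 : (usize z.1 <= usize (val z').1)%N := zmax z0 isT.
have h3 : (N < usize z.1)%N by rewrite ltnNge -in_ball.
have := usizeD (q%:Z *: (val z').1 - y.1) y.1; rewrite subrK usizeZ absz_nat.
have : (2 * usize (val z').1 <= q * usize (val z').1)%N by rewrite leq_mul2r q_gt1 orbT.
move: h1 h2 h3; move: (usize (val z').1) (usize y.1) (usize (_ - _)) (usize z.1) => a e f g.
by move: (q * a)%N => h; lia.
Qed.

Lemma dwork_minors_null : nuclear_matrix B -> minors_null (dwork_mx B).
Proof.
move=> [_ hN hX] C; have [N hNC] := hN C; have [X hXC] := hX C.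
by exists (box n X N) => Y; exact: dwork_minor_out.
Qed.

End Minors.

Variable phi : vec S n J -> vec S n J.
Notation B := (matrix_of phi).
Hypothesis nB : nuclear_matrix B.

Definition eval_mx (x : 'rV[Om]_n) i j := ls_eval (B i j) x.

Let B0 : forall i j u, vge 0 (B i j u). Proof. by case: nB. Qed.

Lemma eval_null k x i j : (0 < k)%N -> x \in mu S n k ->
  null (fun u => B i j u * mono_at x u).
Proof.
move=> k0 xk C; have [_ /(_ C)[N hN] _] := nB; exists (ball n N) => u.
rewrite in_ball -ltnNge => /hN h; apply: vgeMr => //.
exact: mono_at_vge xk.
Qed.

Lemma eval_int k x i j : (0 < k)%N -> x \in mu S n k -> vge 0 (eval_mx x i j).
Proof.
by move=> k0 xk; apply: vge_osum => u; apply: vgeMl => //; exact: mono_at_vge xk.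
Qed.

Lemma eval_col C X k x i j : col_decay C X B -> (0 < k)%N -> x \in mu S n k ->
  j \notin X -> vge C (eval_mx x i j).
Proof.
move=> hX k0 xk jX; apply: vge_osum => u; apply: vgeMr; first exact: hX.
exact: mono_at_vge xk.
Qed.

Lemma eval_cg C N k x i j : decay C N B -> (0 < k)%N -> x \in mu S n k ->
  vge C (eval_mx x i j - trunc_eval N B x i j).
Proof.
move=> hN k0 xk; apply: osum_approx; first exact: eval_null xk.
move=> u; rewrite in_ball -ltnNge => /hN h; apply: vgeMr => //.
exact: mono_at_vge xk.
Qed.

Lemma eval_cols_null k x : (0 < k)%N -> x \in mu S n k -> cols_null (eval_mx x).
Proof.
move=> k0 xk C; have [_ _ /(_ C)[X hX]] := nB; exists X => j jX i.
exact: eval_col xk jX.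
Qed.

Lemma fiber_matrixS d x :
  fiber_matrix phi d.+1 x = imx_mul (eval_mx x) (fiber_matrix phi d (frob S 1 x)).
Proof.
rewrite /fiber_matrix (big_nat_recl _ _ _ (leq0n d)) frob0.
rewrite (eq_bigr (fun l i j => ls_eval (B i j) (frob S l (frob S 1 x)))) // => l _.
by rewrite frobD addn1.
Qed.

Lemma fiber_int d k x i j : (0 < k)%N -> x \in mu S n k -> vge 0 (fiber_matrix phi d x i j).
Proof.
move=> k0; elim: d x i j => [|d IH] x i j xk.
  by rewrite /fiber_matrix big_geq //; exact: vge_nat.
rewrite fiber_matrixS; apply: vge_osum => l; apply: vgeMl; first exact: eval_int xk.
by apply: IH; exact: frob_mu.
Qed.

Lemma imx_mul1 A : imx_mul A (@imx_one R S J) = A.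
Proof.
apply/funext => i; apply/funext => j; rewrite /imx_mul (@osum1 _ _ _ _ j) => [|l lj].
  by rewrite /imx_one eqxx mulr1.
by rewrite /imx_one (negbTE lj) mulr0.
Qed.

Lemma fiber_col C X d k x i j : col_decay C X B -> (0 < k)%N -> x \in mu S n k ->
  j \notin X -> vge C (fiber_matrix phi d.+1 x i j).
Proof.
move=> hX k0; elim: d x i j => [|d IH] x i j xk jX.
  rewrite fiber_matrixS /fiber_matrix big_geq // imx_mul1.
  exact: eval_col xk jX.
rewrite fiber_matrixS; apply: vge_osum => l; apply: vgeMl; first exact: eval_int xk.
by apply: IH => //; exact: frob_mu.
Qed.

Lemma trunc_fiber_int X N d k x i j : (0 < k)%N -> x \in mu S n k ->
  vge 0 (trunc_fiber X N B d x i j).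
Proof.
move=> k0; elim: d x i j => [|d IH] x i j xk; first exact: vge_nat.
apply: vge_sum => l _; apply: vgeMl; last by apply: IH; exact: frob_mu.
by apply: vge_sum => u _; apply: vgeMl => //; exact: mono_at_vge xk.
Qed.

Lemma fiber_cg C X N d k x i j : col_decay C X B -> decay C N B ->
  (0 < k)%N -> x \in mu S n k -> i \in X -> j \in X ->
  vge C (fiber_matrix phi d x i j - trunc_fiber X N B d x i j).
Proof.
move=> hX hN k0; elim: d x i j => [|d IH] x i j xk iX jX.
  by rewrite /fiber_matrix big_geq // subrr vge0.
have xk1 : frob S 1 x \in mu S n k by exact: frob_mu.
rewrite fiber_matrixS.
apply: (@vge_trans _ _ _ _ (\sum_(l <- X) eval_mx x i l * fiber_matrix phi d (frob S 1 x) l j)).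
  apply: osum_approx => [D|l lX].
    have [Y hY] := eval_cols_null k0 xk D; exists Y => l lY.
    by apply: vgeMr; [exact: hY | exact: fiber_int xk1].
  by apply: vgeMr; [exact: eval_col hX k0 xk lX | exact: fiber_int xk1].
rewrite /= -sumrB; apply: vge_sum_seq => l lX; apply: cgM.
- exact: eval_int xk.
- exact: trunc_fiber_int xk1.
- exact: eval_cg xk.
- exact: IH.
Qed.

Lemma fiber_fredholm_cg C X N d k x : col_decay C X B -> decay C N B ->
  (0 < k)%N -> x \in mu S n k -> (0 < d)%N ->
  ps_cg C (fredholm (fiber_matrix phi d x))
          (fun m => (cdet (trunc_fiber_mx X N B d x))`_m).
Proof.
move=> hX hN k0 xk; case: d => // d _ m; apply: fredholm_approx.
- by move=> i j; exact: fiber_int xk.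
- apply: cols_null_minors; first by move=> i j; exact: fiber_int xk.
  move=> D; have [_ _ /(_ D)[Y hY]] := nB; exists Y => j jY i.
  exact: fiber_col hY k0 xk jY.
- apply: vge_minor_out; first by move=> i j; exact: fiber_int xk.
  by move=> j jX i; exact: fiber_col hX k0 xk jX.
- by move=> a b; rewrite mxE; exact: trunc_fiber_int xk.
- by move=> a b; rewrite mxE; apply: (fiber_cg _ hX hN k0 xk); exact: fvalP.
Qed.

Lemma cdet_at0 m (A : 'M[Om]_m) : (cdet A)`_0 = 1.
Proof. by case: (logd_cdet A). Qed.

Lemma euler_int d P : closed_point d P -> ps_int (euler_factor phi d P).
Proof.
move=> /teich_liftP[d0 xd _]; apply: ps_int_inv.
  by rewrite /ps_subst_exp dvdn0 div0n fredholm_at0.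
apply: ps_int_subst => m; apply: vge_fredholm => i j; exact: fiber_int xd.
Qed.

Lemma trunc_euler_int X N d P : closed_point d P -> ps_int (trunc_euler X N B d P).
Proof.
move=> /teich_liftP[d0 xd _]; apply: ps_int_inv.
  by rewrite /ps_subst_exp dvdn0 div0n cdet_at0.
apply: ps_int_subst => m; apply: vge_cdet => a b; rewrite mxE.
exact: trunc_fiber_int xd.
Qed.

Lemma euler_cg C X N d P : col_decay C X B -> decay C N B -> closed_point d P ->
  ps_cg C (euler_factor phi d P) (trunc_euler X N B d P).
Proof.
move=> hX hN /teich_liftP[d0 xd _]; apply: ps_cg_inv.
- by rewrite /ps_subst_exp dvdn0 div0n fredholm_at0.
- by rewrite /ps_subst_exp dvdn0 div0n cdet_at0.
- by apply: ps_int_subst => m; apply: vge_fredholm => i j; exact: fiber_int xd.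
- apply: ps_int_subst => m; apply: vge_cdet => a b; rewrite mxE.
  exact: trunc_fiber_int xd.
- by apply: ps_cg_subst; exact: (fiber_fredholm_cg hX hN d0 xd d0).
Qed.

Definition partial_L M : nat -> Om :=
  \big[@ps_mul Om/@ps_one Om]_(1 <= d < M.+1)
    \big[@ps_mul Om/@ps_one Om]_(P <- fset_set (@closed_point R S n d))
      euler_factor phi d P.

Lemma in_closed_points d P : P \in fset_set (@closed_point R S n d) -> closed_point d P.
Proof. by rewrite in_fset_set ?inE //; exact: closed_point_finite. Qed.

Lemma partial_L_int M : ps_int (partial_L M).
Proof.
apply: ps_int_big => d _; apply: ps_int_big => P /in_closed_points.
exact: euler_int.
Qed.

Lemma partial_L_cg C X N M : col_decay C X B -> decay C N B ->
  ps_cg C (partial_L M) (trunc_L X N B M).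
Proof.
move=> hX hN; apply: ps_cg_big => d _; first 2 last.
- apply: ps_cg_big => P /in_closed_points Pd; [exact: euler_int | | exact: euler_cg].
  exact: trunc_euler_int.
- by apply: ps_int_big => P /in_closed_points; exact: euler_int.
- by apply: ps_int_big => P /in_closed_points; exact: trunc_euler_int.
Qed.

Lemma L_functionE M m : (m <= M)%N -> L_function phi m = partial_L M m.
Proof.
elim: M => [|M IH]; first by rewrite leqn0 => /eqP ->.
rewrite leq_eqVlt => /orP[/eqP -> //|]; rewrite ltnS => mM.
rewrite IH // /partial_L [in RHS]big_nat_recr //= -/(partial_L M).
rewrite (@ps_mul_one_below _ _ M.+1) //.
apply: (big_ind (@one_below _ _ M.+1)); first exact: one_below_one.
  by move=> f g; exact: one_belowM.
move=> P _; apply: one_below_inv; apply: one_below_subst.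
exact: fredholm_at0.
Qed.

Theorem dwork_L_function :
  ps_mul (L_function phi) (dwork_prod (dwork_exps n).1 (fredholm (dwork_mx B))) =
  dwork_prod (dwork_exps n).2 (fredholm (dwork_mx B)).
Proof.
apply/funext => m; apply/eqP; rewrite -subr_eq0; apply/eqP/vge_all0 => C.
have [_ /(_ C)[N hN] /(_ C)[X hX]] := nB.
rewrite (@eq_ps_mul _ _ (partial_L m) _ _ m _ (fun _ _ => erefl)); last first.
  by move=> i im; exact: L_functionE.
set D := fredholm (dwork_mx B).
pose Dt m := (cdet (fsub (dwork_trunc N B) (box n X N)))`_m.
have tr0 y z : vge 0 (dwork_trunc N B y z).
  by rewrite /dwork_trunc /=; case: ifP => _ //; exact: vge0.
have D0 : ps_int D by move=> k; apply: vge_fredholm => y z; exact: B0.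
have Dt0 : ps_int Dt by move=> k; apply: vge_cdet => a b; rewrite mxE.
have DDt : ps_cg C D Dt.
  move=> k; apply: fredholm_approx.
  - by move=> y z; exact: B0.
  - exact: dwork_minors_null.
  - by move=> Y; exact: dwork_minor_out.
  - by move=> a b; rewrite mxE.
  - move=> a b; rewrite mxE /dwork_trunc /=; case: ifP => uV; first by rewrite subrr vge0.
    by rewrite subr0; apply: hN; rewrite ltnNge -in_ball uV.
apply: (@vge_trans _ _ _ _ (dwork_prod (dwork_exps n).2 Dt m)); last first.
  by apply/vgeBC/ps_cg_dwork_prod.
rewrite -(@trunc_identity _ _ _ _ X N B m m) //.
apply: ps_cgM; first exact: partial_L_int.
- exact: ps_int_dwork_prod.
- exact: partial_L_cg.
- exact: ps_cg_dwork_prod.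
Qed.

End DworkL.

(** * Growth in families *)

Section Logarithms.
Variables (R : realType) (S : padic_setting R).
Notation q := (card_q S).
Notation logq := (logq S).

Lemma lnq_gt0 : 0 < ln q%:R :> R.
Proof. by apply: ln_gt0; rewrite ltr1n q_gt1. Qed.

Lemma logq_ge0 m : 0 <= logq m.
Proof.
apply: divr_ge0; last exact: ltW lnq_gt0.
by case: m => [|m]; [rewrite ln0 | rewrite ln_ge0 // ler1n].
Qed.

Lemma logq_gt0 m : (1 < m)%N -> 0 < logq m.
Proof. by move=> m1; rewrite divr_gt0 ?lnq_gt0 // ln_gt0 // ltr1n. Qed.

Lemma logq_le m m' : (0 < m)%N -> (m <= m')%N -> logq m <= logq m'.
Proof.
move=> m0 mm; rewrite ler_pM2r ?invr_gt0 ?lnq_gt0 // ler_ln ?posrE ?ltr0n ?ler_nat //.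
exact: leq_trans mm.
Qed.

Lemma logqM a b : (0 < a)%N -> (0 < b)%N -> logq (a * b) = logq a + logq b.
Proof. by move=> a0 b0; rewrite /logq natrM lnM ?posrE ?ltr0n // mulrDl. Qed.

Lemma logq1 : logq 1 = 0.
Proof. by rewrite /logq ln1 mul0r. Qed.

Lemma logq_large (C : R) : exists N, forall m, (N <= m)%N -> C <= logq m.
Proof.
have [N hN] := real_archi (expR (C * ln q%:R)); exists N => m Nm.
have h : expR (C * ln q%:R) <= m%:R by apply: le_trans hN _; rewrite ler_nat.
rewrite ler_pdivlMr ?lnq_gt0 // -[leLHS]expRK ler_ln ?posrE ?expR_gt0 //.
exact: lt_le_trans (expR_gt0 _) h.
Qed.

(** As r = q^d is less than q, (q - r) w absorbs the constant [N0] for large w, leaving m >= r w. *)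
Lemma logq_shift (d : R) (N0 : nat) : d < 1 -> exists2 N1, (0 < N1)%N &
  forall w m, (N1 <= w)%N -> (q * w <= m + N0)%N -> (0 < m)%N /\ d + logq w <= logq m.
Proof.
move=> d1; pose r := expR (d * ln q%:R).
have rq : r < q%:R.
  have q0 : 0 < q%:R :> R by rewrite ltr0n ltnW ?q_gt1.
  by rewrite -[ltRHS](lnK q0) ltr_expR gtr_pMl ?lnq_gt0.
have [N hN] := real_archi (N0%:R / (q%:R - r)); exists N.+1 => // w m Nw qw.
have w0 : 0 < w%:R :> R by rewrite ltr0n (leq_trans _ Nw).
have h : r * w%:R <= m%:R.
  have h1 : N0%:R <= (q%:R - r) * w%:R.
    rewrite mulrC -ler_pdivrMr ?subr_gt0 //; apply: le_trans hN _.
    by rewrite ler_nat ltnW.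
  have h2 : q%:R * w%:R <= m%:R + N0%:R :> R by rewrite -natrM -natrD ler_nat.
  by rewrite mulrBl in h1; lra.
have m0 : 0 < m%:R :> R by apply: lt_le_trans h; rewrite mulr_gt0 ?expR_gt0.
split; first by rewrite ltr0n in m0.
rewrite /logq ler_pdivlMr ?lnq_gt0 // mulrDl divfK ?gt_eqF ?lnq_gt0 //.
have -> : d * ln q%:R = ln r by rewrite expRK.
by rewrite -lnM ?posrE ?expR_gt0 // ler_ln ?posrE ?mulr_gt0 ?expR_gt0.
Qed.

End Logarithms.

Section LimInf.
Variable R : realType.

Lemma liminf_size_ge (U : Type) (sz : U -> nat) (g : U -> \bar R) (c : \bar R) N :
  (forall u, (N <= sz u)%N -> (c <= g u)%E) -> (c <= liminf_size sz g)%E.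
Proof.
move=> h; apply: (@le_trans _ _ (ereal_inf (g @` [set u | (N <= sz u)%N]))).
  by apply: le_ereal_inf_tmp => _ [u /= Nu <-]; exact: h.
by apply: ereal_sup_ubound; exists N.
Qed.

Lemma liminf_size_lt (U : Type) (sz : U -> nat) (g : U -> \bar R) (c : \bar R) (c' : \bar R) :
  (c <= liminf_size sz g)%E -> (c' < c)%E ->
  exists N, forall u, (N <= sz u)%N -> (c' <= g u)%E.
Proof.
move=> h cc; have /ereal_sup_gt[_ [N _ <-] hN] := lt_le_trans cc h.
exists N => u Nu; apply: ltW; apply: lt_le_trans hN _.
by apply: ereal_inf_lbound; exists u.
Qed.

Lemma le_mulVr (r s : R) (x : \bar R) : 0 < s ->
  (r%:E <= x * (s^-1)%:E)%E = ((r * s)%:E <= x)%E.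
Proof.
move=> s0; case: x => [x| |].
- by rewrite -EFinM !lee_fin ler_pdivlMr.
- by rewrite gt0_mulye ?lte_fin ?invr_gt0 // !leey.
- by rewrite gt0_mulNye ?lte_fin ?invr_gt0 // !leeNy_eq.
Qed.

End LimInf.

(** Replaces the sum |q v - u| + |u| by a product, whose logarithm splits. *)
Lemma add_le_mul N a e m : (0 < N)%N -> (N <= a)%N -> (e <= m)%N -> (0 < m)%N ->
  (a + e <= a * m + N)%N.
Proof. by case: a m => [|a] [|m]; rewrite ?mulSn ?mulnS; lia. Qed.

Section Family.
Variables (R : realType) (S : padic_setting R) (n : nat) (J : choiceType).
Notation Om := (Om S).
Notation ord := (@ord R S).
Notation K := (Kfield S).
Notation q := (card_q S).
Notation vge C x := ((C%:E <= ord x%R)%E).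
Notation Zn := 'rV[int]_n.
Notation logq := (logq S).
Notation Zp := (Defs.Zp ord).

Definition linear_growth (c : R) (f : Om -> nat -> Om) :=
  exists D : R, forall k m, Zp k -> vge (c * m%:R - D) (f k m).

Lemma linear_growth_one c : linear_growth c (fun=> @ps_one Om).
Proof.
exists 0 => k [|m] _; first by rewrite mulr0 subrr; exact: vge1.
exact: vge0.
Qed.

Lemma linear_growthM c f g : linear_growth c f -> linear_growth c g ->
  linear_growth c (fun k => ps_mul (f k) (g k)).
Proof.
move=> [D hD] [E hE]; exists (D + E) => k m hk; apply: vge_sum => i _.
have -> : c * m%:R - (D + E) = (c * i%:R - D) + (c * (m - i)%N%:R - E).
  by rewrite natrB -1?ltnS //; ring.
by apply: vgeM; [exact: hD | exact: hE].
Qed.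

Lemma linear_growth_dwork_prod c r f : linear_growth c f ->
  linear_growth c (fun k => dwork_prod r (f k)).
Proof.
move=> [D hD]; rewrite /dwork_prod; elim: r => [|i r IH].
  by have [E hE] := linear_growth_one c; exists E => k m hk; rewrite big_nil; exact: hE.
have [E hE] : linear_growth c (fun k => ps_mul (ps_dil (q%:R ^+ i) (f k))
    (\big[@ps_mul Om/@ps_one Om]_(j <- r) ps_dil (q%:R ^+ j) (f k))).
  apply: linear_growthM => //; exists D => k m hk; apply: vgeMl; last exact: hD.
  by apply/vgeX0/vgeX0/vge_nat.
by exists E => k m hk; rewrite big_cons; exact: hE.
Qed.

Lemma linear_growth_liminf c c' f : c < c' -> linear_growth c' f ->
  (c%:E <= liminf_size id (fun m : nat =>
     ereal_inf [set ord (f k m) | k in Zp] * (m%:R^-1)%:E))%E.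
Proof.
move=> cc [D hD]; have [N hN] := real_archi (D / (c' - c)).
apply: (@liminf_size_ge _ _ _ _ _ N.+1) => m /= Nm.
have m0 : 0 < m%:R :> R by rewrite ltr0n (leq_trans _ Nm).
rewrite le_mulVr //; apply: le_ereal_inf_tmp => _ [k hk <-].
apply: vge_le (hD k m hk); rewrite lerBrDr -lerBrDl -mulrBl mulrC.
rewrite -ler_pdivrMr ?subr_gt0 //; apply: le_trans hN _.
by rewrite ler_nat ltnW.
Qed.

(** Besides the uniform decay in u and in the columns, this asks for a modulus of continuity in k
    common to all entries, from which that of the Fredholm coefficients follows. *)
Definition uniform_family (c : R) (B : Om -> J -> J -> lser S n) :=
  [/\ forall k, Zp k -> forall i j u, intring (B k i j u),
      forall c', c' < c -> exists N, forall k, Zp k -> forall u, (N <= usize u)%N ->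
        forall i j, vge (c' * logq (usize u)) (B k i j u),
      forall C, exists X, forall k, Zp k -> col_decay C X (B k)
    & forall C, exists N : nat, forall k k', Zp k -> Zp k' ->
        (exists2 z, Zp z & k - k' = (prime_p S)%:R ^+ N * z) ->
        forall i j u, vge C (B k i j u - B k' i j u)].

Variables (c : R) (B : Om -> J -> J -> lser S n).
Hypothesis c0 : 0 < c.
Hypothesis uB : uniform_family c B.

Lemma uniform_family_nuclear k : Zp k -> nuclear_matrix (B k).
Proof.
move=> hk; have [h1 h2 h3 _] := uB; split.
- by move=> i j u; case: (h1 k hk i j u).
- move=> C; have c2 : c / 2 < c by have := c0; lra.
  have [N hN] := h2 _ c2; have [M hM] := logq_large S (C / (c / 2)).
  exists (maxn N M) => u; rewrite gtn_max => /andP[Nu Mu] i j.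
  apply: vge_le (hN k hk u (ltnW Nu) i j); rewrite mulrC -ler_pdivrMr; last by have := c0; lra.
  exact: hM (ltnW Mu).
- by move=> C; have [X hX] := h3 C; exists X; exact: hX.
Qed.

(** With weights c1 log_q max(1, |v|), a column with |v| > N1 has weighted valuation at least c2,
    because |q v - u| max(1, |u|) is at least q |v| up to a constant and the slack c2 < c1 absorbs
    that constant. Each of the finitely many bad columns loses at most [Kc], so a minor of order m
    has valuation at least c2 m minus a constant. *)
Lemma fredholm_growth c2 : 0 < c2 -> c2 < c ->
  linear_growth c2 (fun k => fredholm (dwork_mx (B k))).
Proof.
move=> c20 c2c; have [h1 h2 h3 _] := uB.
pose c1 := (c2 + c) / 2; have c1c : c1 < c by rewrite /c1; lra.
have c21 : c2 < c1 by rewrite /c1; lra.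
have c10 : 0 < c1 by lra.
have [N0' hN0] := h2 _ c1c; pose N0 := N0'.+1.
have d1 : c2 / c1 < 1 by rewrite ltr_pdivrMr // mul1r.
have [N1 N10 hN1] := logq_shift S N0 d1.
(* [Kc] bounds the weight when |v| <= N1; outside [X] the extra valuation [Kc] pays for it. *)
pose Kc := c1 * logq N1; have [X hX] := h3 (c2 + Kc).
pose Lg (u : Zn) := logq (maxn 1 (usize u)).
pose bad := box n X N1.
pose g z := if z \in bad then - Kc else c2.
pose la (z : Zn * J) := c1 * Lg z.1.
have Lg0 u : 0 <= Lg u by exact: logq_ge0.
have Kc0 : 0 <= Kc by rewrite mulr_ge0 ?logq_ge0 // ltW.
have entry k y z : Zp k -> vge (g z + la z - la y) (dwork_mx (B k) y z).
  move=> hk; rewrite /g /la; case: y z => [u i] [v j] /=.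
  have b0 : vge 0 (dwork_mx (B k) (u, i) (v, j)).
    by case: (h1 k hk i j (q%:Z *: v - u)).
  have cLu : 0 <= c1 * Lg u by rewrite mulr_ge0 // ltW.
  have Lv : (usize v <= N1)%N -> c1 * Lg v <= Kc.
    move=> vN; rewrite ler_pM2l //; apply: logq_le; first by rewrite leq_maxl.
    by rewrite geq_max N10.
  case: ifP => [|/negbT]; rewrite in_box /= in_ball.
    by move=> /andP[/Lv vN _]; apply: vge_le b0; lra.
  rewrite negb_and -ltnNge; have [vN _ | vN /= jX] := ltnP N1 (usize v); last first.
    by apply: vge_le (hX k hk j jX i _); have := Lv vN; lra.
  (* The decay is only known from [N0] on; below it, [a' = 1] has logarithm 0 and integrality
     suffices. *)
  set a := usize (q%:Z *: v - u); pose a' := if (N0 <= a)%N then a else 1%N.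
  have ha : vge (c1 * logq a') (dwork_mx (B k) (u, i) (v, j)).
    rewrite /a'; case: ifP => aN; last by rewrite logq1 mulr0.
    by apply: (hN0 k hk); exact: ltnW.
  have a'0 : (0 < a')%N by rewrite /a'; case: ifP => // /(leq_trans _); exact.
  have m0 : (0 < maxn 1 (usize u))%N by rewrite leq_maxl.
  have qa : (q * usize v <= a' * maxn 1 (usize u) + N0)%N.
    have := usizeD (q%:Z *: v - u) u; rewrite subrK usizeZ absz_nat -/a => h.
    apply: leq_trans h _; rewrite /a'; case: (leqP N0 a) => aN.
      exact: add_le_mul aN (leq_maxr _ _) (leq_maxl _ _).
    by rewrite mul1n addnC leq_add ?leq_maxr // ltnW.
  have [_] := hN1 (usize v) _ (ltnW vN) qa.
  rewrite logqM // -/(Lg u).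
  have -> : logq (usize v) = Lg v.
    by congr logq; apply/esym/maxn_idPr; exact: leq_trans (ltnW vN).
  rewrite -(ler_pM2l c10) !mulrDr [c1 * (c2 / c1)]mulrC divfK ?gt_eqF // => h.
  by apply: vge_le ha; lra.
exists ((c2 + Kc) * #|` bad|%:R) => k m hk.
apply: vgeMl; first exact: vge_sign.
apply: vge_osum => Y; case: eqP => [Ym|_]; last exact: vge0.
have := @vge_minor_weight _ _ _ (dwork_mx (B k)) Y g la (fun y z => entry k y z hk).
apply: vge_le.
(* [Y] contains at most all of [bad], so the loss does not depend on its size m. *)
have -> : \sum_(z <- Y) g z = \sum_(z <- Y) c2 - \sum_(z <- Y | z \in bad) (c2 + Kc).
  rewrite [X in _ - X]big_mkcond -sumrB; apply: eq_bigr => z _; rewrite /g.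
  by case: ifP => _; [ring | rewrite subr0].
rewrite lerB // ?big_const_seq ?count_predT ?iter_addr_0.
  by rewrite -Ym mulr_natr.
rewrite -[leLHS]mulr_natr ler_wpM2l ?addr_ge0 ?(ltW c20) // ler_nat.
rewrite -size_filter; apply: uniq_leq_size; first by rewrite filter_uniq ?fset_uniq.
by move=> z; rewrite mem_filter => /andP[].
Qed.

Lemma dwork_prod_entire r eps : 0 < eps ->
  entire_family (c - eps) (fun k => dwork_prod r (fredholm (dwork_mx (B k)))).
Proof.
move=> e0; have [h1 _ _ h4] := uB.
have int k : Zp k -> ps_int (fredholm (dwork_mx (B k))).
  by move=> hk m; apply: vge_fredholm => y z; case: (h1 k hk y.2 z.2 (q%:Z *: z.1 - y.1)).
split.
- move=> k hk; apply: ps_big_at0 => i _.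
  by rewrite /ps_dil expr0 mul1r fredholm_at0.
- move=> k m hk; split; last by apply: ps_int_dwork_prod; exact: int.
  suff : forall m, dwork_prod r (fredholm (dwork_mx (B k))) m \in K by [].
  apply: (big_ind (fun f : nat -> Om => forall m, f m \in K)) => [l|f g hf hg l|i _ l].
  + exact: Knat.
  + by apply: Ksum => i _; exact: KM.
  + apply: KM; first by rewrite -exprM -natrX; exact: Knat.
    by apply: K_fredholm => y z; case: (h1 k hk y.2 z.2 (q%:Z *: z.1 - y.1)).
- move=> m C; have [N hN] := h4 C; exists N => k k' hk hk' kk.
  apply: ps_cg_dwork_prod; [exact: int | exact: int |] => l; apply: cg_fredholm.
  + by move=> y z; case: (h1 k hk y.2 z.2 (q%:Z *: z.1 - y.1)).
  + by move=> y z; case: (h1 k' hk' y.2 z.2 (q%:Z *: z.1 - y.1)).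
  + apply: dwork_minors_null; last exact: uniform_family_nuclear.
    by move=> i j u; case: (h1 k hk i j u).
  + apply: dwork_minors_null; last exact: uniform_family_nuclear.
    by move=> i j u; case: (h1 k' hk' i j u).
  + by move=> y z; exact: hN.
(* The maximum with c / 2 keeps the rate positive when [eps] is large. *)
- pose c2 := Num.max (c - eps / 2) (c / 2).
  apply: (@linear_growth_liminf _ c2).
    by rewrite /c2 lt_max; apply/orP; left; lra.
  apply: linear_growth_dwork_prod; apply: fredholm_growth.
    by rewrite /c2 lt_max; apply/orP; right; have := c0; lra.
  by rewrite /c2 gt_max; apply/andP; split; have := c0; lra.
Qed.

Theorem L_strong_family (phi : Om -> vec S n J -> vec S n J) eps :
  (forall k, Zp k -> matrix_of (phi k) = B k) -> 0 < eps ->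
  strong_family (c - eps) (fun k => L_function (phi k)).
Proof.
move=> phiB e0.
exists (fun k => dwork_prod (dwork_exps n).2 (fredholm (dwork_mx (B k)))).
exists (fun k => dwork_prod (dwork_exps n).1 (fredholm (dwork_mx (B k)))).
split; [exact: dwork_prod_entire | exact: dwork_prod_entire |] => k hk.
rewrite -phiB //; apply: dwork_L_function; rewrite phiB //.
exact: uniform_family_nuclear.
Qed.

End Family.

(** * The limiting sigma-module *)

Section PadicIntegers.
Variables (R : realType) (S : padic_setting R).
Notation Om := (Om S).
Notation ord := (@ord R S).
Notation K := (Kfield S).
Notation p := (prime_p S).
Notation vge C x := ((C%:E <= ord x%R)%E).
Notation Zp := (Defs.Zp ord).

Lemma Om_nat_neq0 m : (m.+1%:R : Om) != 0.
Proof. by rewrite ((pcharf0P Om).1 (@Om_char0 R S)). Qed.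

Lemma ppow_small (C : R) : exists N, vge C (p%:R ^+ N : Om).
Proof.
have p0 : p%:R != 0 :> Om.
  by rewrite -(prednK (prime_gt0 (prime_pP S))); exact: Om_nat_neq0.
have [r pr] := ord_fin p0.
have r0 : 0 < r by have := @ord_p_gt0 R S; rewrite pr lte_fin.
have [N hN] := real_archi (C / r); exists N.
have pv : vge r (p%:R : Om) by rewrite pr.
by apply: vge_le (vgeX N pv); rewrite -mulr_natl -ler_pdivrMr.
Qed.

(** A negative integer -(m + 1) is approximated by the natural number p^N (m + 1) - (m + 1). *)
Lemma Zp_nat k (C : R) : Zp k -> exists m : nat, vge C (k - m%:R).
Proof.
move=> /(_ C)[[m|m] hm]; first by exists m.
have [N hN] := ppow_small C; exists (p ^ N * m.+1 - m.+1)%N.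
apply: vge_trans hm _; rewrite natrB; last by rewrite leq_pmull // expn_gt0 prime_gt0 ?prime_pP.
rewrite NegzE mulrNz -pmulrn natrM natrX opprB addrA addNr add0r.
by apply/vgeN/vgeMr => //; exact: vge_nat.
Qed.

Lemma Zp_int k : Zp k -> vge 0 k.
Proof.
move=> /(Zp_nat 0)[m hm]; rewrite -(subrK m%:R k); apply: vgeD => //.
exact: vge_nat.
Qed.

Lemma Zp_K k : Zp k -> k \in K.
Proof.
move=> hk; apply: KQp => C; have [z hz] := hk C; exists z%:~R.
by rewrite ratr_int_Om.
Qed.

Lemma Zp_subn k m : Zp k -> Zp (k - m%:R).
Proof.
move=> hk C; have [z hz] := hk C; exists (z - m%:Z).
by rewrite rmorphB /= -pmulrn opprB addrA subrK.
Qed.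

Lemma binom_nat (a m : nat) : binom (a%:R : Om) m = 'C(a, m)%:R.
Proof.
have f0 : m`!%:R != 0 :> Om by rewrite -(prednK (fact_gt0 m)); exact: Om_nat_neq0.
rewrite /binom; apply: (mulIf f0); rewrite divfK // -natrM bin_ffact.
have [am|ma] := ltnP a m.
  by rewrite ffact_small // (bigD1 (Ordinal am)) //= subrr mul0r.
rewrite ffact_prod natr_prod; apply: eq_bigr => i _; rewrite natrB //.
by apply: leq_trans ma; exact: ltnW.
Qed.

(** [r] is the valuation of 1 / m!, so the loss of precision depends on [m] alone. *)
Lemma binom_cg m : exists r : R, forall (C : R) (k k' : Om), vge 0 k -> vge 0 k' ->
  vge C (k - k') -> vge (C + r) (binom k m - binom k' m).
Proof.
have f0 : m`!%:R^-1 != 0 :> Om.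
  by rewrite invr_eq0 -(prednK (fact_gt0 m)); exact: Om_nat_neq0.
have [r hr] := ord_fin f0; exists r => C k k' k0 k0' kk.
rewrite /binom -mulrBl; apply: vgeM; last by rewrite hr.
apply: cg_prod => i _; [apply: vgeB => // | apply: vgeB => // |]; try exact: vge_nat.
by rewrite opprB addrA subrK.
Qed.

(** By continuity from natural k, where the value is an ordinary binomial coefficient. *)
Lemma binom_int k m : Zp k -> vge 0 (binom k m).
Proof.
move=> hk; have [r hr] := binom_cg m; have [a ha] := Zp_nat (- r) hk.
rewrite -(subrK (binom a%:R m) (binom k m)); apply: vgeD; last first.
  by rewrite binom_nat; exact: vge_nat.
by rewrite -(addNr r); apply: hr ha; [exact: Zp_int | exact: vge_nat].
Qed.

Lemma binom_K k m : Zp k -> binom k m \in K.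
Proof.
move=> hk; apply: KM; last by apply/KV/Knat.
by apply: Kprod => i _; apply: KB; [exact: Zp_K | exact: Knat].
Qed.

Lemma binom_unif (C : R) (M : nat) : exists N : nat, forall k k', Zp k -> Zp k' ->
  (exists2 z, Zp z & k - k' = p%:R ^+ N * z) ->
  forall m, (m < M)%N -> vge C (binom k m - binom k' m).
Proof.
elim: M => [|M [N hN]]; first by exists 0%N.
have [r hr] := binom_cg M; have [N' hN'] := ppow_small (C - r).
exists (N + N')%N => k k' hk hk' [z hz kk] m; rewrite ltnS leq_eqVlt => /orP[/eqP -> |mM].
  rewrite -(subrK r C); apply: hr; [exact: Zp_int | exact: Zp_int |].
  rewrite kk exprD -mulrA; apply: vgeMl; first by apply/vgeX0/vge_nat.
  by apply: vgeMr => //; exact: Zp_int.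
apply: hN => //; exists (p%:R ^+ N' * z); last by rewrite kk exprD mulrA.
move=> D; have [a ha] := hz D; exists ((p ^ N')%N%:Z * a).
rewrite rmorphM /= -pmulrn natrX -mulrBr; apply: vgeMl => //.
by apply/vgeX0/vge_nat.
Qed.

End PadicIntegers.

(** * Laurent series in A_0 and the logarithmic weight *)

Section Laurent.
Variables (R : realType) (S : padic_setting R) (n : nat).
Notation Om := (Om S).
Notation ord := (@ord R S).
Notation K := (Kfield S).
Notation q := (card_q S).
Notation vge C x := ((C%:E <= ord x%R)%E).
Notation Zn := 'rV[int]_n.
Notation logq := (logq S).
Notation Zp := (Defs.Zp ord).
Implicit Types a b : lser S n.

Lemma A0_null a : A0 a -> null a.
Proof.
move=> [_ h] C; have [N hN] := h C; exists (ball n N) => u.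
by rewrite in_ball -ltnNge => Nu; apply: hN; exact: ltnW.
Qed.

Lemma ls_mul_null a b u : null a -> (forall v, vge 0 (b v)) ->
  null (fun v => a v * b (u - v)).
Proof.
move=> na hb C; have [X hX] := na C; exists X => v vX.
by apply: vgeMr => //; exact: hX.
Qed.

Lemma ls_mul_cg (C : R) a a' b b' : null a -> null a' -> (forall v, vge 0 (a v)) ->
  (forall v, vge 0 (b v)) -> (forall v, vge 0 (b' v)) ->
  (forall v, vge C (a v - a' v)) -> (forall v, vge C (b v - b' v)) ->
  forall u, vge C (ls_mul a b u - ls_mul a' b' u).
Proof.
move=> na na' a0 b0 b0' aa bb u; apply: cg_osum; [exact: ls_mul_null | exact: ls_mul_null |].
by move=> v; apply: cgM.
Qed.

Lemma ls_one_mul a : ls_mul (@ls_one R S n) a = a.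
Proof.
apply/funext => u; rewrite /ls_mul (@osum1 _ _ _ _ 0) /ls_one ?eqxx ?mul1r ?subr0 //.
by move=> v /negbTE ->; rewrite mul0r.
Qed.

Lemma ls_zero_mul a : ls_mul (@ls_zero R S n) a = @ls_zero R S n.
Proof.
apply/funext => u; rewrite /ls_mul (@osum1 _ _ _ _ 0) /ls_zero ?mul0r //.
by move=> v _; rewrite mul0r.
Qed.

Lemma A0_mul a b : A0 a -> A0 b -> A0 (ls_mul a b).
Proof.
move=> [ha da] [hb db]; split=> [u|C].
  split; first by apply: Kosum => v; apply: KM; [case: (ha v) | case: (hb (u - v))].
  by apply: vge_osum => v; apply: vgeMl; [case: (ha v) | case: (hb (u - v))].
have [N hN] := da C; have [M hM] := db C; exists (N + M)%N => u NMu.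
apply: vge_osum => v; have [Nv|vN] := leqP N (usize v).
  by apply: vgeMr; [exact: hN | case: (hb (u - v))].
apply: vgeMl; first by case: (ha v).
apply: hM; have := usizeD v (u - v); rewrite addrC subrK => h.
by move: (usize u) (usize v) (usize _) NMu vN h => x y z; lia.
Qed.

Lemma A0_sigma a : A0 a -> A0 (ls_sigma a).
Proof.
move=> [ha da]; split=> [u|C].
  rewrite /ls_sigma; case: ifP => _; first exact: ha.
  by split; [exact: K0 | exact: vge0].
have [N hN] := da C; exists (q * N)%N => u; rewrite /ls_sigma; case: forallP => [h|_ _]; last exact: vge0.
set v : Zn := \row_i _; have uv : u = q%:Z *: v.
  by apply/rowP => i; rewrite !mxE mulrC divzK.
rewrite uv usizeZ absz_nat leq_pmul2l => [Nv|]; last by rewrite ltnW ?q_gt1.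
exact: hN.
Qed.

Lemma ls_sigma_one : ls_sigma (@ls_one R S n) = @ls_one R S n.
Proof.
apply/funext => u; rewrite /ls_sigma /ls_one; case: forallP => [h|h].
  congr (_%:R); congr nat_of_bool; apply/eqP/eqP => [/rowP e|->]; last first.
    by apply/rowP => i; rewrite !mxE div0z.
  apply/rowP => i; have := e i; rewrite !mxE => e'.
  by rewrite -(divzK (h i)) e' mul0r.
case: eqP => // u0; case: h => i; by rewrite u0 mxE dvdz0.
Qed.

Lemma ls_sigma_zero : ls_sigma (@ls_zero R S n) = @ls_zero R S n.
Proof. by apply/funext => u; rewrite /ls_sigma /ls_zero if_same. Qed.

(* [Lam u = c1 * log_q (1 + |u| / M)]: subadditive since [(1 + x) (1 + y) >= 1 + x + y]. *)
Lemma weight_exists (c' c2 : R) (N : nat) : 0 < c' -> c' < c2 ->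
  exists Lam : Zn -> R, [/\ forall u v, Lam (u + v) <= Lam u + Lam v, Lam 0 = 0,
    exists N1, forall u, (N1 <= usize u)%N -> c' * logq (usize u) <= Lam u
    & forall u, Lam u <= 1 \/ (N <= usize u)%N /\ Lam u <= c2 * logq (usize u)].
Proof.
move=> c0 cc; pose c1 := (c' + c2) / 2.
have c10 : 0 < c1 by rewrite /c1; lra.
have c1c' : c' < c1 by rewrite /c1; lra.
have c1c2 : c1 < c2 by rewrite /c1; lra.
have lq := lnq_gt0 S.
(* Beyond [N2], c1 log_q (2 |u|) <= c2 log_q |u|, and 1 + |u| / M <= 2 |u|. *)
have [N2 hN2] := logq_large S (c1 * (ln 2 / ln q%:R) / (c2 - c1)).
pose N' := (maxn N N2).+1.
(* From ln (1 + x) <= x, this scale makes the weight at most 1 as long as |u| < N'. *)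
have [M' hM'] := real_archi (c1 * N'%:R / ln q%:R); pose M := M'.+1.
have M0 : 0 < M%:R :> R by rewrite ltr0n.
pose x (u : Zn) : R := 1 + (usize u)%:R / M%:R.
have x1 u : 1 <= x u by rewrite lerDl divr_ge0.
have x0 u : 0 < x u by apply: lt_le_trans (x1 u).
pose Lam (u : Zn) : R := c1 * (ln (x u) / ln q%:R).
have LamE u v : (Lam u <= c1 * (v / ln q%:R)) = (ln (x u) <= v).
  by rewrite ler_pM2l // ler_pM2r // invr_gt0.
exists Lam; split.
- move=> u v; rewrite /Lam -mulrDr -mulrDl -lnM ?posrE // LamE ler_ln ?posrE ?mulr_gt0 //.
  rewrite /x; have h : (usize (u + v))%:R / M%:R <= (usize u)%:R / M%:R + (usize v)%:R / M%:R :> R.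
    by rewrite -mulrDl ler_pM2r ?invr_gt0 // -natrD ler_nat usizeD.
  have h1 : 0 <= (usize u)%:R / M%:R :> R by rewrite divr_ge0.
  have h2 : 0 <= (usize v)%:R / M%:R :> R by rewrite divr_ge0.
  by have := mulr_ge0 h1 h2; lra.
- by rewrite /Lam /x usize0 mul0r addr0 ln1 mul0r mulr0.
- have [N1 hN1] := logq_large S (c1 * (ln M%:R / ln q%:R) / (c1 - c')).
  exists N1.+1 => u Nu; have u0 : 0 < (usize u)%:R :> R by rewrite ltr0n (leq_trans _ Nu).
  have := hN1 _ (ltnW Nu); rewrite ler_pdivrMr ?subr_gt0 // => h.
  apply: (@le_trans _ _ (c1 * (ln ((usize u)%:R / M%:R) / ln q%:R))).
    rewrite ln_div ?posrE // mulrBl -/(logq (usize u)).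
    by move: h; rewrite [logq _ * _]mulrC mulrBl; lra.
  rewrite /Lam ler_pM2l // ler_pM2r ?invr_gt0 // ler_ln ?posrE ?divr_gt0 //.
  by rewrite lerDr.
- move=> u; have [uN|Nu] := ltnP (usize u) N'; [left|right].
    apply: (@le_trans _ _ (c1 * (((usize u)%:R / M%:R) / ln q%:R))).
      rewrite LamE; apply: le_ln1Dx; apply: (@lt_le_trans _ _ 0); first by rewrite oppr_lt0.
      by rewrite divr_ge0.
    have -> : c1 * ((usize u)%:R / M%:R / ln q%:R) = c1 * (usize u)%:R / ln q%:R / M%:R by ring.
    rewrite ler_pdivrMr // mul1r; apply: (@le_trans _ _ (c1 * N'%:R / ln q%:R)).
      by rewrite ler_pM2r ?invr_gt0 // ler_pM2l // ler_nat ltnW.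
    apply: le_trans hM' _.
    by rewrite ler_nat.
  split; first by apply: leq_trans Nu; rewrite leqW // leq_maxl.
  have u1 : 1 <= (usize u)%:R :> R by rewrite ler1n (leq_trans _ Nu).
  have u0 : 0 < (usize u)%:R :> R by lra.
  have : (N2 <= usize u)%N by apply: leq_trans Nu; rewrite leqW // leq_maxr.
  move=> /hN2; rewrite ler_pdivrMr ?subr_gt0 // => h.
  apply: (@le_trans _ _ (c1 * ((ln 2 + ln (usize u)%:R) / ln q%:R))).
    rewrite LamE -lnM ?posrE // ler_ln ?posrE ?mulr_gt0 // /x.
    have : (usize u)%:R / M%:R <= (usize u)%:R :> R.
      by rewrite ler_pdivrMr // ler_peMr ?ler1n.
    by lra.
  by rewrite mulrDl mulrDr -/(logq (usize u)); move: h; rewrite mulrBr; lra.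
Qed.

End Laurent.

(** The finitely many monomials exempted in [phi_inf_col_null] are the multisets of such words. *)
Fixpoint short_words (T : Type) (r : seq T) m : seq (seq T) :=
  if m is m'.+1 then [::] :: [seq x :: s | x <- r, s <- short_words r m'] else [:: [::]].

Lemma short_wordsP (T : eqType) (r s : seq T) m :
  (size s <= m)%N -> {subset s <= r} -> s \in short_words r m.
Proof.
elim: m s => [|m IH] [|x s] //= sm sr; rewrite in_cons /=.
apply/allpairsP; exists (x, s); split=> //=; first by apply: sr; rewrite mem_head.
by apply: IH => // y ys; apply: sr; rewrite in_cons ys orbT.
Qed.

(** * Series bounded below by a subadditive weight *)

Section Good.
Variables (R : realType) (S : padic_setting R) (n : nat).
Notation Om := (Om S).
Notation ord := (@ord R S).
Notation K := (Kfield S).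
Notation pi := (varpi S).
Notation p := (prime_p S).
Notation vge C x := ((C%:E <= ord x%R)%E).
Notation Zn := 'rV[int]_n.
Notation Zp := (Defs.Zp ord).
Notation lone := (@ls_one R S n).
Implicit Types (a b : lser S n) (s t : R).

Variable Lam : Zn -> R.
Hypothesis LamD : forall u v, Lam (u + v) <= Lam u + Lam v.
Hypothesis Lam0 : Lam 0 = 0.

(** The two bounds behave differently under products: [s] is additive and counts factors of the
    uniformizer, while [Lam] is merely preserved, by subadditivity. *)
Definition good s a := forall u, [/\ a u \in K, vge s (a u) & vge (Lam u) (a u)].

Lemma good_zero s : good s (@ls_zero R S n).
Proof. by move=> u; split; [exact: K0 | exact: vge0 | exact: vge0]. Qed.

Lemma good_one : good 0 lone.
Proof.
move=> u; split; [exact: Knat | exact: vge_nat |]; rewrite /ls_one.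
by case: eqP => [->|_]; [rewrite Lam0; exact: vge1 | exact: vge0].
Qed.

Lemma good_le s t a : s <= t -> good t a -> good s a.
Proof. by move=> st h u; case: (h u) => ? h2 ?; split=> //; exact: vge_le h2. Qed.

Lemma good_mul s t a b : good s a -> good t b -> good (s + t) (ls_mul a b).
Proof.
move=> ha hb u; split.
- by apply: Kosum => v; apply: KM; [case: (ha v) | case: (hb (u - v))].
- by apply: vge_osum => v; apply: vgeM; [case: (ha v) | case: (hb (u - v))].
- apply: vge_osum => v; apply: (@vge_le _ _ _ (Lam v + Lam (u - v))).
    by rewrite -[in leLHS](subrK v u) addrC LamD.
  by apply: vgeM; [case: (ha v) | case: (hb (u - v))].
Qed.

Lemma good_osum (T : choiceType) s (F : T -> lser S n) :
  (forall i, good s (F i)) -> good s (fun u => osum (fun i => F i u)).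
Proof.
move=> h u; split; [apply: Kosum | apply: vge_osum | apply: vge_osum] => i;
  by case: (h i u).
Qed.

Lemma good_sum (T : Type) (r : seq T) s (F : T -> lser S n) :
  (forall i, good s (F i)) -> good s (fun u => \sum_(i <- r) F i u).
Proof.
move=> h u; split; [apply: Ksum | apply: vge_sum | apply: vge_sum] => i _;
  by case: (h i u).
Qed.

Lemma good_scale s z a : z \in K -> vge 0 z -> good s a -> good s (fun u => z * a u).
Proof.
move=> Kz z0 h u; have [h1 h2 h3] := h u.
by split; [exact: KM | exact: vgeMl | exact: vgeMl].
Qed.

Lemma good_iter a m : good 1 a -> good m%:R (iter m (ls_mul a) lone).
Proof.
move=> h; elim: m => [|m IH]; first exact: good_one.
by rewrite -addn1 addnC natrD iterD; exact: good_mul.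
Qed.

Lemma good_pow a k : Zp k -> good 1 (ls_sub a lone) -> good 0 (ls_pow a k).
Proof.
move=> hk h; apply: (@good_osum _ 0 (fun m u => binom k m * iter m (ls_mul (ls_sub a lone)) lone u)).
move=> m; apply: good_scale; [exact: binom_K | exact: binom_int |].
by apply: good_le (good_iter m h).
Qed.

(** Without a quotient in A_0, [ls_div] is [ls_zero], which is good. Otherwise [key] is a bootstrap:
    each use of the fixed point equation raises the cap [t] by one, as [d] has valuation at least
    1. *)
Lemma good_div b a : A0 a -> good 1 (ls_sub a lone) -> good 1 b ->
  good 1 (ls_scale pi (ls_div b (ls_scale pi a))).
Proof.
move=> Aa hd hb; rewrite /ls_div; case: xgetP => [y _ [[yint _] e]|_]; last first.
  move=> u; rewrite /ls_scale /ls_zero mulr0.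
  by split; [exact: K0 | exact: vge0 | exact: vge0].
set z := ls_scale pi y; set d := ls_sub a lone.
have z1 u : vge 1 (z u).
  by apply: vgeMr; [rewrite ord_varpi | case: (yint u)].
have z0 u : vge 0 (z u) by apply: vge_le (z1 u).
(* dividing by [a = 1 + d] solves the fixed point equation [z = b - d z] *)
have zE u : z u = b u - ls_mul d z u.
  have <- : b u - z u = ls_mul d z u; last by ring.
  have na := A0_null Aa.
  have eb : b u = osum (fun v => a v * z (u - v)).
    rewrite -e; congr osum; apply/funext => v.
    by rewrite /z /ls_scale; ring.
  have ez : z u = osum (fun v => lone v * z (u - v)) by rewrite -{1}[z]ls_one_mul.
  rewrite {1}ez eb osumB.
  - by congr osum; apply/funext => v; rewrite /d /ls_sub; ring.
  - exact: ls_mul_null.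
  - apply: ls_mul_null => // C; exists [fset 0]%fset => v; rewrite inE /ls_one => /negbTE ->.
    exact: vge0.
have key (t : nat) u : vge (Num.min (Lam u) t%:R) (z u).
  elim: t u => [|t IH] u; first by apply: vge_le (z0 u); rewrite ge_min lexx orbT.
  rewrite zE; apply: vgeB.
    by have [_ _ h] := hb u; apply: vge_le h; rewrite ge_min lexx.
  apply: vge_osum => v; have [_ d1 dL] := hd v.
  have Lu : Lam u <= Lam v + Lam (u - v) by rewrite -[in leLHS](subrK v u) addrC LamD.
  have := IH (u - v); rewrite minEle; case: ifP => _ h.
    apply: vge_le (vgeM dL h); by rewrite ge_min Lu.
  apply: vge_le (vgeM d1 h); by rewrite ge_min nat1r lexx orbT.
move=> u; split=> //.
  by apply: KM; [exact: varpi_Kfield | case: (yint u)].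
have [t ht] := real_archi (Lam u); apply: vge_le (key t u).
by rewrite le_min lexx.
Qed.

Hypothesis LamInf : forall C, exists N, forall u, (N <= usize u)%N -> C <= Lam u.

Lemma good_A0 s a : 0 <= s -> good s a -> A0 a.
Proof.
move=> s0 h; split=> [u|C]; first by case: (h u) => ? h2 _; split=> //; exact: vge_le h2.
have [N hN] := LamInf C; exists N => u /hN; by case: (h u) => _ _ h3 hC; exact: vge_le h3.
Qed.

Lemma good_null s a : 0 <= s -> good s a -> null a.
Proof. by move=> s0 /(good_A0 s0)/A0_null. Qed.

Lemma good_int s a u : 0 <= s -> good s a -> vge 0 (a u).
Proof. by move=> s0 h; case: (h u) => _ h2 _; exact: vge_le h2. Qed.

(** Terms from [M] on vanish modulo [C] thanks to [F], as binomial coefficients are integral; below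
    [M] the binomial coefficients themselves are close. *)
Lemma osum_binom_cg (C : R) (M : nat) k k' (F : nat -> Om) : Zp k -> Zp k' ->
  C <= M%:R -> (forall m, (m < M)%N -> vge C (binom k m - binom k' m)) ->
  (forall m, vge m%:R (F m)) ->
  vge C (osum (fun m => binom k m * F m) - osum (fun m => binom k' m * F m)).
Proof.
move=> hk hk' CM h hF.
have F0 m : vge 0 (F m) by apply: vge_le (hF m).
have nl l : Zp l -> null (fun m => binom l m * F m).
  move=> hl D; have [N hN] := real_archi D; exists [fset i | i in iota 0 N]%fset => m mN.
  apply: vgeMl; first exact: binom_int.
  apply: vge_le (hF m); apply: le_trans hN _; rewrite ler_nat leqNgt.
  by apply: contra mN => mN; apply/imfsetP; exists m => //=; rewrite mem_iota.
apply: cg_osum; [exact: nl | exact: nl |] => m; rewrite -mulrBl.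
have [mM|Mm] := ltnP m M; first by apply: vgeMr => //; exact: h.
apply: vgeMl; first by apply: vgeB; exact: binom_int.
by apply: vge_le (hF m); apply: le_trans CM _; rewrite ler_nat.
Qed.

Lemma ls_pow_cg (C : R) (M : nat) k k' a u : Zp k -> Zp k' -> C <= M%:R ->
  (forall m, (m < M)%N -> vge C (binom k m - binom k' m)) ->
  good 1 (ls_sub a lone) -> vge C (ls_pow a k u - ls_pow a k' u).
Proof.
move=> hk hk' CM h ha; apply: osum_binom_cg CM h _ => // m.
by case: (good_iter m ha u).
Qed.

(** * Estimates for phi_(infty,k) *)

Section Limiting.
Variables (I : {pred nat}) (I1 : 1%N \in I).
Notation idx := (idx I).
Notation idx_tail := (idx_tail I).
Notation mono := (mono I).
Notation e_ := (@basis_vec R S n idx).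
Notation e1 := (i1 I1).
Notation mone := (@mi_one R S n I).
Implicit Types g h : Minf S n I.

Definition mgood s g := forall w, good s (g w).

Lemma mgood_one : mgood 0 mone.
Proof.
by move=> w; rewrite /mi_one /basis_vec; case: ifP => _; [exact: good_one | exact: good_zero].
Qed.

Lemma mgood_mul s t g h : mgood s g -> mgood t h -> mgood (s + t) (mi_mul g h).
Proof.
by move=> hg hh w; apply: (@good_sum mono _ _ (fun w' => ls_mul (g w') (h (msetB w w'))))
  => w'; exact: good_mul.
Qed.

Lemma mgood_iter g m : mgood 1 g -> mgood m%:R (iter m (mi_mul g) mone).
Proof.
move=> h; elim: m => [|m IH]; first exact: mgood_one.
by rewrite -addn1 addnC natrD iterD; exact: mgood_mul.
Qed.

Lemma mgood_pow1 g k : Zp k -> mgood 1 g -> mgood 0 (mi_pow1 g k).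
Proof.
move=> hk h w; apply: (@good_osum _ 0 (fun m u => binom k m * iter m (mi_mul g) mone w u)).
move=> m; apply: good_scale; [exact: binom_K | exact: binom_int |].
by apply: good_le (mgood_iter m h w).
Qed.

Lemma mi_pow1_cg (C : R) (M : nat) k k' g w u : Zp k -> Zp k' -> C <= M%:R ->
  (forall m, (m < M)%N -> vge C (binom k m - binom k' m)) ->
  mgood 1 g -> vge C (mi_pow1 g k w u - mi_pow1 g k' w u).
Proof.
move=> hk hk' CM h ha; apply: osum_binom_cg CM h _ => // m.
by case: (mgood_iter m ha w u).
Qed.

Lemma mi_mul_cg (C : R) s t g g' h h' : 0 <= s -> 0 <= t ->
  mgood s g -> mgood s g' -> mgood t h -> mgood t h' ->
  (forall w u, vge C (g w u - g' w u)) -> (forall w u, vge C (h w u - h' w u)) ->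
  forall w u, vge C (mi_mul g h w u - mi_mul g' h' w u).
Proof.
move=> s0 t0 mg mg' mh mh' gg hh w u; apply: cg_sum => w' _.
apply: ls_mul_cg => //; try (by move=> v; apply: good_int; last by eauto).
- exact: good_null (mg w').
- exact: good_null (mg' w').
Qed.

Lemma mgood_prod (T : Type) (r : seq T) (f : T -> R) (F : T -> Minf S n I) :
  (forall i, mgood (f i) (F i)) ->
  mgood (\sum_(i <- r) f i) (\big[@mi_mul R S n I/mone]_(i <- r) F i).
Proof.
move=> h; elim/big_rec2: _ => [|i s g _ hg]; first exact: mgood_one.
exact: mgood_mul.
Qed.

Lemma mgood_Upsilon s (a : vec S n idx) : (forall i, good s (a i)) -> mgood s (Upsilon I1 a).
Proof.
move=> h w; rewrite /Upsilon; case: (enum_mset w) => [|i [|j r]] //.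
exact: good_zero.
Qed.

Variable phi : vec S n idx -> vec S n idx.
Notation u1 := (unit_coord I1 phi).
Hypothesis u1A0 : A0 u1.
Hypothesis u1good : good 1 (ls_sub u1 lone).
Hypothesis b_good : forall i, i != e1 -> good 1 (phi (e_ e1) i).
Hypothesis col_good : forall i, i != e1 -> forall j, good 1 (phi (e_ i) j).

Lemma error_good : mgood 1 (mi_scale pi (Upsilon I1 (error_vec I1 phi))).
Proof.
have h i : good 1 (ls_scale pi (error_vec I1 phi i)).
  rewrite /error_vec; case: ifP => [_|/negbT ie]; last by apply: good_div => //; exact: b_good.
  move=> u; rewrite /ls_scale /ls_zero mulr0.
  by split; [exact: K0 | exact: vge0 | exact: vge0].
move=> w; rewrite /mi_scale /Upsilon; case: (enum_mset w) => [|i [|j r]] //.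
move=> u; rewrite /ls_scale /ls_zero mulr0.
by split; [exact: K0 | exact: vge0 | exact: vge0].
Qed.

Lemma tail_neq (i : idx_tail) : val i != e1.
Proof. by apply: contra (valP i) => /eqP ->. Qed.

(** The two powers with exponent k - r are integral and respect the weight, so the valuation comes
    from the r factors Upsilon(phi(e_i)). The bound [t] may vary with i, for use in
    [phi_inf_col_null]. *)
Lemma phi_inf_col_good k w (t : idx_tail -> R) : Zp k ->
  (forall i j, good (t i) (phi (e_ (val i)) j)) ->
  mgood (\sum_(i <- enum_mset w) t i) (phi_inf_col I1 phi k w).
Proof.
move=> hk ht w'; rewrite /phi_inf_col -[\sum_(i <- _) _]add0r.
have hkr : Zp (k - (size (enum_mset w))%:R) by exact: Zp_subn.
apply: good_mul; first exact: good_pow.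
rewrite -[\sum_(i <- _) _]add0r; apply: mgood_mul.
  by apply: mgood_pow1 => //; exact: error_good.
by apply: mgood_prod => i; apply: mgood_Upsilon.
Qed.

Lemma phi_inf_col_good1 k w : Zp k ->
  mgood (size (enum_mset w))%:R (phi_inf_col I1 phi k w).
Proof.
move=> hk; have := @phi_inf_col_good k w (fun=> 1) hk (fun i j => col_good (tail_neq i) j).
by rewrite big_const_seq count_predT iter_addr_0.
Qed.

(** k enters through two binomial series only, both with exponent k - r; the shift by r cancels in k
    - k', hence one modulus for all monomials. *)
Lemma phi_inf_col_cg (C : R) : exists N : nat, forall k k', Zp k -> Zp k' ->
  (exists2 z, Zp z & k - k' = p%:R ^+ N * z) ->
  forall w w' u, vge C (phi_inf_col I1 phi k w w' u - phi_inf_col I1 phi k' w w' u).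
Proof.
have [M CM] := real_archi C; have [N hN] := binom_unif S C M.
exists N => k k' hk hk' [z hz kk] w w' u; rewrite /phi_inf_col.
set m := size _; have hkr : Zp (k - m%:R) by exact: Zp_subn.
have hkr' : Zp (k' - m%:R) by exact: Zp_subn.
have hb l : (l < M)%N -> vge C (binom (k - m%:R) l - binom (k' - m%:R) l).
  by apply: hN => //; exists z => //; rewrite opprB addrA subrK.
have gp l : Zp l -> good 0 (ls_pow u1 l) by move=> hl; exact: good_pow.
have ge l : Zp l -> mgood 0 (mi_pow1 (mi_scale pi (Upsilon I1 (error_vec I1 phi))) l).
  by move=> hl; apply: mgood_pow1 => //; exact: error_good.
have gP : mgood 0 (\big[@mi_mul R S n I/mone]_(i <- enum_mset w)
    Upsilon I1 (phi (e_ (val i)))).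
  have := @mgood_prod _ (enum_mset w) (fun=> 0) (fun i => Upsilon I1 (phi (e_ (val i)))).
  rewrite big1 //; apply => i; apply: mgood_Upsilon => j.
  exact: good_le (col_good (tail_neq i) j).
have gm l : Zp l -> mgood 0 (mi_mul (mi_pow1 (mi_scale pi (Upsilon I1 (error_vec I1 phi))) l)
   (\big[@mi_mul R S n I/mone]_(i <- enum_mset w) Upsilon I1 (phi (e_ (val i))))).
  by move=> hl; have := mgood_mul (ge _ hl) gP; rewrite addr0.
apply: ls_mul_cg.
- exact: good_null (gp _ hkr).
- exact: good_null (gp _ hkr').
- by move=> v; exact: good_int (gp _ hkr).
- by move=> v; exact: good_int (gm _ hkr w').
- by move=> v; exact: good_int (gm _ hkr' w').
- by move=> v; exact: ls_pow_cg CM hb _.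
- move=> v; apply: (mi_mul_cg (lexx 0) (lexx 0) (ge _ hkr) (ge _ hkr') gP gP).
    by move=> v1 v2; apply: mi_pow1_cg CM hb _ => //; exact: error_good.
  by move=> v1 v2; rewrite subrr vge0.
Qed.

Lemma phi_inf_matrix k w' w :
  matrix_of (phi_inf I1 phi k) w' w = phi_inf_col I1 phi k w w'.
Proof.
apply/funext => u; rewrite /matrix_of /phi_inf /semilinear_ext.
rewrite (@osum1 _ _ _ _ w) => [|j jw].
  by rewrite /basis_vec eqxx ls_sigma_one ls_one_mul.
by rewrite /basis_vec (negbTE jw) ls_sigma_zero ls_zero_mul.
Qed.

Hypothesis col_null : forall C : R, exists X : {fset idx}, forall i, i \notin X ->
  forall j u, vge C (phi (e_ i) j u).

(** A monomial with at least [M] factors gains 1 from each, and one involving an index outside [X0]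
    has a single factor of valuation at least [C]. What remains are the short words over a finite
    alphabet. *)
Lemma phi_inf_col_null (C : R) : exists X : {fset mono}, forall k, Zp k ->
  forall w, w \notin X -> forall w' u, vge C (phi_inf_col I1 phi k w w' u).
Proof.
have [X0 hX0] := col_null C; have [M hM] := real_archi C.
pose r : seq idx_tail := pmap insub (enum_fset X0).
exists [fset (seq_mset s : mono) | s in short_words r M]%fset => k hk w wX w' u.
(* The maximum with 1 serves when [C] is small: every factor must still count for at least 1. *)
pose t (i : idx_tail) := if val i \in X0 then 1 else Num.max C 1.
have t1 i : 1 <= t i by rewrite /t; case: ifP => // _; rewrite le_max lexx orbT.
have ht i j : good (t i) (phi (e_ (val i)) j).
  move=> v; have [h1 h2 h3] := col_good (tail_neq i) j v; split=> //.
  rewrite /t; case: ifPn => // iX; rewrite maxEle; case: ifP => // _.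
  exact: hX0.
have [_ h _] := phi_inf_col_good w hk ht w' u; apply: vge_le h.
have [Ms|sM] := leqP M (size (enum_mset w)).
  apply: le_trans hM _; apply: (@le_trans _ _ (size (enum_mset w))%:R); first by rewrite ler_nat.
  have -> : (size (enum_mset w))%:R = \sum_(i <- enum_mset w) (1 : R).
    by rewrite big_const_seq count_predT iter_addr_0.
  exact: ler_sum.
have [i iw iX] : exists2 i, i \in enum_mset w & val i \notin X0.
  apply/hasP; apply: contraNT wX; rewrite -all_predC => /allP h0.
  apply/imfsetP; exists (enum_mset w) => /=; last by rewrite seq_mset_id.
  apply: short_wordsP; first exact: ltnW.
  by move=> i /h0 /=; rewrite negbK mem_pmap_sub.
rewrite (big_rem i) //= -[leLHS]addr0; apply: lerD.
  by rewrite /t (negbTE iX) le_max lexx.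
by apply: sumr_ge0 => j _; apply: le_trans (t1 j).
Qed.

Lemma phi_inf_nuclear k : Zp k -> nuclear (phi_inf I1 phi k).
Proof.
move=> hk; have colA w w' : A0 (phi_inf_col I1 phi k w w').
  by apply: good_A0 (phi_inf_col_good1 w hk w').
split.
- move=> a Aa i; rewrite /phi_inf /semilinear_ext.
  have At j : A0 (ls_mul (ls_sigma (a j)) (phi_inf_col I1 phi k j i)).
    by apply: A0_mul => //; exact: A0_sigma.
  split=> [u|C].
    split; first by apply: Kosum => j; case: (At j) => /(_ u)[].
    by apply: vge_osum => j; case: (At j) => /(_ u)[].
  have [X hX] := phi_inf_col_null C.
  have /choice[N hN] : forall j, exists N, forall u, (N <= usize u)%N ->
      vge C (ls_mul (ls_sigma (a j)) (phi_inf_col I1 phi k j i) u).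
    by move=> j; case: (At j) => _ /(_ C).
  exists (\max_(j <- X) N j)%N => u Nu; apply: vge_osum => j.
  have [jX|jX] := boolP (j \in X).
    by apply: hN; apply: leq_trans Nu; exact: leq_bigmax_seq.
  apply: vge_osum => v; apply: vgeMl; last exact: hX.
  by have [/(_ v)[]] := A0_sigma (Aa j).
- move=> a _.
  have e : (fun j => phi_inf I1 phi k (basis_vec S j)) = phi_inf_col I1 phi k.
    by apply/funext => j; apply/funext => i; exact: phi_inf_matrix.
  exact: (congr1 (fun col => semilinear_ext col a) (esym e)).
- move=> C; have [X hX] := phi_inf_col_null C; exists X => j jX i u.
  by rewrite phi_inf_matrix; exact: hX.
Qed.

End Limiting.
End Good.

Theorem theorem8p1 (R : realType) (S : padic_setting R) (n : nat)
    (hn : (0 < n)%N) (c : R) (hc : 0 < c)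
    (I : {pred nat}) (Ipos : forall i, i \in I -> (0 < i)%N) (I1 : 1%N \in I)
    (phi : vec S n (idx I) -> vec S n (idx I))
    (hphi : nuclear phi)
    (hconv : log_convergent c phi)
    (hord : ordinary_slope_zero phi 1)
    (hu : piA0 (ls_sub (matrix_of phi (i1 I1) (i1 I1)) (@ls_one R S n)))
    (hb : forall i : idx I, val i <> 1%N -> piA0 (matrix_of phi i (i1 I1))) :
  uniformly_log_convergent c (phi_inf I1 phi) /\
  forall eps : R, 0 < eps ->
    strong_family (c - eps) (fun k => L_function (phi_inf I1 phi k)).
Proof.
have [phiA _ phiN] := hphi; have [zmod _ _] := hord.
have A0_basis (j i : idx I) : A0 (basis_vec S j i : lser S n).
  rewrite /basis_vec; case: ifP => _.
    split=> [u|C]; first by split; [exact: Knat | exact: vge_nat].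
    exists 1%N => u; rewrite /ls_one; case: eqP => [->|_ _]; last exact: vge0.
    by rewrite usize0.
  by split=> [u|C]; [split; [exact: K0 | exact: vge0] | exists 0%N => u _; exact: vge0].
have BA0 i j : A0 (matrix_of phi i j) by apply: phiA => l; exact: A0_basis.
have piA0P (a : lser S n) u : piA0 a -> a u \in Kfield S /\ (1%:E <= ord (a u))%E.
  move=> [b [hb' _] ->]; have [Kb b0] := hb' u; split.
    by apply: KM => //; exact: varpi_Kfield.
  by apply: vgeMr => //; rewrite ord_varpi.
have hB (c2 : R) : c2 < c -> exists N, forall u : 'rV[int]_n, (N <= usize u)%N -> forall i j,
    ((c2 * logq S (usize u))%:E <= ord (matrix_of phi i j u))%E.
  move=> c2c; have c2c' : (c2%:E < c%:E)%E by rewrite lte_fin.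
  (* |u| >= 2 makes log_q |u| positive, so that the quotient can be cleared. *)
  have [N hN] := liminf_size_lt hconv c2c'; exists (maxn N 2) => u.
  rewrite geq_max => /andP[Nu u2] i j; have := hN u Nu.
  rewrite le_mulVr; last exact: logq_gt0.
  by move=> h; apply: le_trans h _; apply: ereal_inf_lbound; exists (i, j).
have core (c' : R) : 0 < c' -> c' < c -> exists Lam : 'rV[int]_n -> R,
    [/\ [/\ forall u v, Lam (u + v) <= Lam u + Lam v, Lam 0 = 0 &
        exists N1, forall u, (N1 <= usize u)%N -> c' * logq S (usize u) <= Lam u],
      good Lam 1 (ls_sub (unit_coord I1 phi) (@ls_one R S n)),
      forall i, i != i1 I1 -> good Lam 1 (phi (basis_vec S (i1 I1)) i)
    & forall i, i != i1 I1 -> forall j, good Lam 1 (phi (basis_vec S i) j)].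
  move=> c'0 c'c; pose c2 := (c' + c) / 2.
  have c'2 : c' < c2 by rewrite /c2; lra.
  have c2c : c2 < c by rewrite /c2; lra.
  have [N hN] := hB _ c2c; have [Lam [LD L0 Linf Lle]] := weight_exists S n N c'0 c'2.
  (* Decay is asked for u different from 0 only, where u_1 - 1 has the same coefficients as u_1; at
     0 the weight vanishes and divisibility is enough. *)
  have gd (a : lser S n) : (forall u, a u \in Kfield S /\ (1%:E <= ord (a u))%E) ->
      (forall u, u != 0 -> (N <= usize u)%N -> ((c2 * logq S (usize u))%:E <= ord (a u))%E) ->
      good Lam 1 a.
    move=> h1 h2 u; have [Ku u1] := h1 u; split=> //.
    have [->|u0] := eqVneq u 0; first by rewrite L0; have [_] := h1 0; apply: vge_le.
    have [L1|[Nu L2]] := Lle u; first exact: vge_le u1.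
    exact: vge_le L2 (h2 u u0 Nu).
  exists Lam; split=> //.
  - apply: gd => [u|u u0 Nu]; first exact: piA0P.
    by rewrite /ls_sub /ls_one (negbTE u0) subr0; exact: hN.
  - move=> i ie; apply: gd => [u|u _ Nu]; last exact: hN.
    apply: piA0P; apply: hb => i1E; case/eqP: ie; exact: val_inj.
  - move=> i ie j; apply: gd => [u|u _ Nu]; last exact: hN.
    apply: piA0P; apply: zmod; rewrite ltn_neqAle (Ipos _ (valP i)) andbT eq_sym.
    by apply: contra ie => /eqP i1E; apply/eqP/val_inj.
have inf (c' : R) (Lam : 'rV[int]_n -> R) : 0 < c' ->
    (exists N1, forall u, (N1 <= usize u)%N -> c' * logq S (usize u) <= Lam u) ->
    forall C, exists N, forall u, (N <= usize u)%N -> C <= Lam u.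
  move=> c'0 [N1 hN1] C; have [N2 hN2] := logq_large S (C / c').
  exists (maxn N1 N2) => u; rewrite geq_max => /andP[/hN1 h /hN2 h2].
  by apply: le_trans h; rewrite mulrC -ler_pdivrMr.
(* Estimates without a rate (integrality, nuclearity, continuity) all use one weight, for c / 2;
   only [growth] lets the rate approach c. *)
have c20 : 0 < c / 2 by lra.
have c2c : c / 2 < c by lra.
have [Lam [[LD L0 /(inf _ _ c20) LI] gu gb gc]] := core _ c20 c2c.
have uA0 : A0 (unit_coord I1 phi) := BA0 (i1 I1) (i1 I1).
have cnull C : exists X : {fset idx I}, forall i, i \notin X ->
    forall j u, (C%:E <= ord (phi (basis_vec S i) j u))%E.
  by have [X hX] := phiN C; exists X.
have growth c' : c' < c -> exists N, forall k, Defs.Zp (@ord R S) k -> forall u : 'rV[int]_n,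
    (N <= usize u)%N -> forall i j,
    ((c' * logq S (usize u))%:E <= ord (matrix_of (phi_inf I1 phi k) i j u))%E.
  (* [c'] may be negative, whereas [core] requires a positive rate. *)
  move=> c'c; pose c1 := Num.max c' (c / 2).
  have c10 : 0 < c1 by rewrite lt_max c20 orbT.
  have c1c : c1 < c by rewrite gt_max c'c c2c.
  have [Lam' [[LD' L0' [N1 hN1]] gu' gb' gc']] := core _ c10 c1c.
  exists N1 => k hk u Nu i j; rewrite phi_inf_matrix.
  have [_ _ h] := phi_inf_col_good1 LD' L0' uA0 gu' gb' gc' j hk i u.
  apply: vge_le h; apply: le_trans (hN1 u Nu).
  by rewrite ler_wpM2r ?logq_ge0 // le_max lexx.
have uf : uniform_family c (fun k => matrix_of (phi_inf I1 phi k)).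
  split=> //.
  - move=> k hk i j u; rewrite phi_inf_matrix.
    have [h1 h2 _] := phi_inf_col_good1 LD L0 uA0 gu gb gc j hk i u.
    by split=> //; exact: vge_le h2.
  - move=> C; have [X hX] := phi_inf_col_null LD L0 uA0 gu gb gc cnull C.
    by exists X => k hk j jX i u; rewrite phi_inf_matrix; exact: hX.
  - move=> C; have [N hN] := phi_inf_col_cg LD L0 LI uA0 gu gb gc C.
    exists N => k k' hk hk' kk i j u; have := hN k k' hk hk' kk j i u.
    rewrite -(phi_inf_matrix I1 phi k i j).
    rewrite -(phi_inf_matrix I1 phi k' i j).
    exact.
split; last by move=> eps e0; exact: (L_strong_family hc uf).
split.
- by move=> k hk; exact: (phi_inf_nuclear LD L0 LI uA0 gu gb gc cnull hk).
- apply/lee_subgt0Pr => e e0; rewrite -EFinB.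
  have ce : c - e < c by lra.
  have [N hN] := growth _ ce; apply: (@liminf_size_ge _ _ _ _ _ (maxn N 2)) => u.
  rewrite geq_max => /andP[Nu u2]; rewrite le_mulVr; last exact: logq_gt0.
  apply: le_ereal_inf_tmp => _ [k hk <-]; apply: le_ereal_inf_tmp => _ [[i j] _ <-] /=.
  exact: hN.
- move=> C _; have [_ _ /(_ C)[X hX] _] := uf; exists X => j jX u k i hk.
  exact: hX.
Qed.
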